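(* For a topological Clifford semigroup $S$, the following are equivalent: (1) $S$ is $C^1$ at the idempotents with finite-dimensional charts (i.e. in the definition below every Banach space $X_e$ can be taken finite-dimensional); (2) $S$ is a strong semilattice of finite-dimensional Lie groups, i.e. $S$ is a strong semilattice of topological groups in which every maximal subgroup $G_e$ (with the subspace topology) is a finite-dimensional Lie group.
   Context: An inverse semigroup is a semigroup $S$ in which every $x$ has a unique $x^{-1}$ with $xx^{-1}x=x$ and $x^{-1}xx^{-1}=x^{-1}$. A Clifford semigroup is an inverse semigroup with $xx^{-1}=x^{-1}x$ for all $x$. $E(S)$ denotes the set of idempotents, ordered by $e\le f\iff ef=e$. For $e\in E(S)$, $G_e:=\{x\in S: xx^{-1}=e\}$ is a group with identity $e$, and $S=\bigsqcup_{e}G_e$; for $e\le f$, $\varphi_{f,e}\colon G_f\to G_e$, $x\mapsto ex$. A topological Clifford semigroup is a Clifford semigroup with a topology making multiplication and inversion continuous; $G_e$ carries the subspace topology. $S$ is a strong semilattice of topological groups if the bonding maps are continuous and the topology of $S$ is the disjoint-union topology of the subspaces $G_e$. $S$ is $C^1$ at the idempotents if for every $e\in E(S)$ there exist a Banach space $X_e$, open sets $e\in U_e\subseteq W_e\subseteq S$, and a homeomorphism $\varphi_e\colon W_e\to V_e$ onto an open subset $V_e\subseteq X_e$ with $\varphi_e(e)=0$, such that $U_eU_e\subseteq W_e$ and $(u,v)\mapsto \varphi_e(\varphi_e^{-1}(u)\varphi_e^{-1}(v))$ is of class $C^1$ (Fréchet) on $\varphi_e(U_e)\times\varphi_e(U_e)$.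 *)

(* Defs.v *)
From HB Require Import structures.
From mathcomp Require Import all_boot all_order all_algebra.
From mathcomp Require Import all_classical all_reals all_analysis.
From mathcomp Require Import Rstruct Rstruct_topology.
Set Implicit Arguments. Unset Strict Implicit. Unset Printing Implicit Defensive.
Import Order.TTheory GRing.Theory Num.Theory.
Import numFieldNormedType.Exports.
Local Open Scope classical_set_scope.
Local Open Scope ring_scope.

Definition top_clifford (S : topologicalType) (mul : S -> S -> S) (inv : S -> S) : Prop :=
  (((forall x y z, mul x (mul y z) = mul (mul x y) z)) /\ ((forall x, mul (mul x (inv x)) x = x /\ mul (mul (inv x) x) (inv x) = inv x)) /\ ((forall x y, mul (mul x y) x = x -> mul (mul y x) y = y -> y = inv x)) /\ ((forall x, mul x (inv x) = mul (inv x) x)) /\ (continuous (fun p : S * S => mul p.1 p.2)) /\ (continuous inv)).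

Definition idem (S : Type) (mul : S -> S -> S) : set S := [set e | mul e e = e].

Definition maxsub (S : Type) (mul : S -> S -> S) (inv : S -> S) (e : S) : set S :=
  [set x | mul x (inv x) = e].

Definition open_in (S : topologicalType) (G A : set S) : Prop :=
  exists2 O : set S, open O & A = O `&` G.

Definition strong_semilattice_top_groups (S : topologicalType)
    (mul : S -> S -> S) (inv : S -> S) : Prop :=
  (* the bonding maps phi_{f,e} : G_f -> G_e, x |-> e x, are continuous *)
  (forall e f, idem mul e -> idem mul f -> mul e f = e ->
     {within maxsub mul inv f, continuous (fun x => mul e x)}) /\
  (forall A : set S, open A <->
     (forall e, idem mul e -> open_in (maxsub mul inv e) (A `&` maxsub mul inv e))).

Section Smooth.
Context {R : realType} {V W : normedModType R}.

Fixpoint iterD (vs : seq V) (f : V -> W) : V -> W :=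
  match vs with
  | [::] => f
  | v :: vs' => fun x => 'D_v (iterD vs' f) x
  end.

Definition smooth_on (U : set V) (f : V -> W) : Prop :=
  forall vs : seq V,
    {within U, continuous (iterD vs f)} /\
    (forall v x, U x -> derivable (iterD vs f) x v).

(* C^1 in the Frechet sense on U: Frechet differentiable at every point of U,
   and x |-> 'd f x continuous for the operator norm (written out). *)
Definition C1_on (U : set V) (f : V -> W) : Prop :=
  (forall x, U x -> differentiable f x) /\
  (forall x0, U x0 -> forall eps : R, 0 < eps ->
     exists2 d : R, 0 < d & forall x, U x -> `|x - x0| < d ->
       forall v : V, `|'d f x v - 'd f x0 v| <= eps * `|v|).
End Smooth.

Record chart (R : realType) (S : topologicalType) (n : nat) := Chart {
  ch_W : set S; ch_V : set 'rV[R]_n;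
  ch_phi : S -> 'rV[R]_n; ch_psi : 'rV[R]_n -> S }.

Definition is_chart (R : realType) (S : topologicalType) (n : nat) (G : set S)
    (c : chart R S n) : Prop :=
  ((ch_W c `<=` G) /\ (open_in G (ch_W c)) /\ (open (ch_V c)) /\ ((forall x, ch_W c x -> ch_V c (ch_phi c x) /\ ch_psi c (ch_phi c x) = x)) /\ ((forall y, ch_V c y -> ch_W c (ch_psi c y) /\ ch_phi c (ch_psi c y) = y)) /\ ({within ch_W c, continuous (ch_phi c)}) /\ ({within ch_V c, continuous (ch_psi c)})).

Definition lie_group (R : realType) (S : topologicalType)
    (mul : S -> S -> S) (inv : S -> S) (G : set S) : Prop :=
  (forall x y, G x -> G y -> x <> y ->
     exists U1 U2 : set S, ((open U1) /\ (open U2) /\ (U1 x) /\ (U2 y) /\ (U1 `&` U2 `&` G = set0))) /\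
  exists (n : nat) (A : set (chart R S n)),
  (((forall c, A c -> is_chart G c)) /\ ((forall x, G x -> exists2 c, A c & ch_W c x)) /\ (
      (forall c1 c2, A c1 -> A c2 ->
         smooth_on [set u | ch_V c1 u /\ ch_W c2 (ch_psi c1 u)]
                   (fun u => ch_phi c2 (ch_psi c1 u)))) /\ (
      (forall c1 c2 c3, A c1 -> A c2 -> A c3 ->
         smooth_on [set p : 'rV[R]_n * 'rV[R]_n |
                      [/\ ch_V c1 p.1, ch_V c2 p.2 &
                          ch_W c3 (mul (ch_psi c1 p.1) (ch_psi c2 p.2))]]
                   (fun p => ch_phi c3 (mul (ch_psi c1 p.1) (ch_psi c2 p.2))))) /\ (
      (forall c1 c2, A c1 -> A c2 ->
         smooth_on [set u | ch_V c1 u /\ ch_W c2 (inv (ch_psi c1 u))]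
                   (fun u => ch_phi c2 (inv (ch_psi c1 u)))))).

Definition C1_at_idempotents_findim (R : realType) (S : topologicalType)
    (mul : S -> S -> S) : Prop :=
  forall e, idem mul e ->
  exists (n : nat) (U W : set S) (V : set 'rV[R]_n)
         (phi : S -> 'rV[R]_n) (psi : 'rV[R]_n -> S),
  ((open U) /\ (open W) /\ (U e) /\ (U `<=` W) /\ (open V) /\ (
      (forall x, W x -> V (phi x) /\ psi (phi x) = x)) /\ ((forall y, V y -> W (psi y) /\ phi (psi y) = y)) /\ ({within W, continuous phi}) /\ ({within V, continuous psi}) /\ (phi e = 0) /\ ((forall u v, U u -> U v -> W (mul u v))) /\ (C1_on [set p : 'rV[R]_n * 'rV[R]_n | (phi @` U) p.1 /\ (phi @` U) p.2]
            (fun p => phi (mul (psi p.1) (psi p.2))))).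

(* Main.v *)
(* Isolated idempotents: since idempotents are central, the C^1 equation x * x = x has e as its
   only solution near e, so the maximal subgroups are open and S is their topological sum.

   A C^1 locally Euclidean group is a Lie group: write lam for a chart with lam 1 = 0; all that is
   used is that multiplication is strictly differentiable at (1, 1).
   - One-parameter subgroups with prescribed velocity X are ultrafilter limits of
     x_N ^ floor(t N), where lam x_N = X / N. Conversely lam composed with any continuous
     one-parameter subgroup is additive up to a relatively small error near 0, hence
     differentiable at 0.
   - With c_i the subgroup of velocity e_i, psi t = c_1(t_1) ... c_n(t_n) is a local coordinate
     system (canonical coordinates of the second kind). Conjugation by any g maps the c_i to
     one-parameter subgroups, so it has a derivative Ad g at 1.
   - s |-> Ad (c_i (- s)) is a continuous one-parameter group of matrices, hence smooth; therefore
     so is the matrix M(t) of the logarithmic derivative psi(t)^-1 dpsi(t).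
   - For F a product of translates of psi and its inverse, u = psi^-1 o F is differentiable with
     du = (F^-1 dF) M(u)^-1, where F^-1 dF is smooth. The right-hand side is as regular as u, so
     u is smooth. This applies to chart changes, multiplication and inversion. *)

Require Import Defs.
From HB Require Import structures.
From mathcomp Require Import all_boot all_order all_algebra.
From mathcomp Require Import all_classical all_reals all_analysis.
From mathcomp Require Import Rstruct Rstruct_topology.
From mathcomp Require Import ring lra zify.
Set Implicit Arguments. Unset Strict Implicit. Unset Printing Implicit Defensive.
Import Order.TTheory GRing.Theory Num.Theory.
Import numFieldNormedType.Exports.
Local Open Scope classical_set_scope.
Local Open Scope ring_scope.
(* [iterD] is also the name of a lemma of ssrnat. *)
Import Defs.

(** * Groups with a chart that is strictly differentiable at the identity *)

(** The chart controls the product to first order near the identity only; elsewhere translations and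
    conjugations are merely continuous, so smooth translations and flows of invariant vector fields
    are out of reach. Regularity has to come from homomorphisms out of R, which are differentiable
    as soon as they are continuous; this is used twice, for one-parameter subgroups and for
    one-parameter groups of matrices. Derivatives of group-valued maps are always taken at the
    identity, after the increment has been moved there by F(x)^-1. A single ultrafilter supplies
    limits for all t at once, with no proof that the approximating sequences converge. For the
    isolation of idempotents, e is not yet an identity for nearby points, so the derivative of the
    product at (e, e) is unknown; two estimates along the same axis are played against each other
    instead. In the converse direction, smoothness of a Lie group is expressed by iterated
    directional derivatives, from which Frechet differentiability must be recovered. *)

(* [mul_strict] is strict differentiability of the multiplication at (1, 1), with derivative
   (u, v) |-> u + v; nothing is assumed about its differentiability elsewhere. *)
Record strict_chart (R : realType) (n : nat) (T : groupType) := StrictChart {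
  dom : set T;
  lam : T -> 'rV[R]_n;
  dom1 : dom 1%g;
  lam1 : lam 1%g = 0;
  lam_inj : forall x y, dom x -> dom y -> lam x = lam y -> x = y;
  lam_surj : exists2 r : R, 0 < r & forall z, `|z| < r -> exists2 x, dom x & lam x = z;
  mul_strict : forall e : R, 0 < e -> exists2 d : R, 0 < d &
    forall x x' y y', dom x /\ `|lam x| < d -> dom x' /\ `|lam x'| < d ->
      dom y /\ `|lam y| < d -> dom y' /\ `|lam y'| < d ->
      dom (x * y)%g /\
      `|lam (x * y)%g - lam (x' * y')%g - (lam x - lam x' + (lam y - lam y'))|
        <= e * (`|lam x - lam x'| + `|lam y - lam y'|);
  inv_cont : forall e : R, 0 < e -> exists2 d : R, 0 < d &
    forall x, dom x /\ `|lam x| < d -> dom x^-1%g /\ `|lam x^-1%g| < e;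
  conj_cont : forall g (e : R), 0 < e -> exists2 d : R, 0 < d &
    forall x, dom x /\ `|lam x| < d ->
      dom (g * x * g^-1)%g /\ `|lam (g * x * g^-1)%g| < e }.

Section StrictChart.
Variables (R : realType) (n : nat) (T : groupType) (C : strict_chart R n T).
Local Notation dom := (dom C).
Local Notation lam := (lam C).
Local Notation lam1 := (lam1 C).
Implicit Types (x y g : T) (e d r : R).

Definition sm r x := dom x /\ `|lam x| < r.

Lemma sm_le r s x : r <= s -> sm r x -> sm s x.
Proof. by move=> rs [? /lt_le_trans h]; split => //; exact: h. Qed.

Lemma sm1 r : 0 < r -> sm r 1%g.
Proof. by move=> r0; split; [exact: dom1|rewrite lam1 normr0]. Qed.

Lemma sm_minl r s x : sm (Num.min r s) x -> sm r x.
Proof. by apply: sm_le; rewrite ge_min lexx. Qed.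

Lemma sm_minr r s x : sm (Num.min r s) x -> sm s x.
Proof. by apply: sm_le; rewrite ge_min lexx orbT. Qed.

Lemma sm_mul e : 0 < e -> exists2 d : R, 0 < d &
  forall x y, sm d x -> sm d y -> sm e (x * y)%g.
Proof.
move=> e0; have [d d0 Hd] := mul_strict C ltr01.
exists (Num.min d (e / 4)); first by rewrite lt_min d0 divr_gt0.
move=> x y hx hy.
have [xy] := Hd x 1%g y 1%g (sm_minl hx) (sm1 d0) (sm_minl hy) (sm1 d0).
rewrite mul1g lam1 !subr0 mul1r => h; split => //.
have [_ hx'] := sm_minr hx; have [_ hy'] := sm_minr hy.
have := ler_distD (lam x + lam y) (lam (x * y)%g) 0.
rewrite !subr0; have := ler_normD (lam x) (lam y); lra.
Qed.

Lemma lam_mulr e : 0 < e -> exists2 d : R, 0 < d &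
  forall x y, sm d x -> sm d y -> dom (x * y)%g /\
  `|lam (x * y)%g - lam x - lam y| <= e * `|lam y|.
Proof.
move=> e0; have [d d0 Hd] := mul_strict C e0; exists d => // x y hx hy.
have [xy] := Hd x x y 1%g hx hx hy (sm1 d0).
by rewrite mulg1 lam1 subrr !subr0 normr0 !add0r.
Qed.

Lemma lam_mull e : 0 < e -> exists2 d : R, 0 < d &
  forall x y, sm d x -> sm d y -> dom (x * y)%g /\
  `|lam (x * y)%g - lam x - lam y| <= e * `|lam x|.
Proof.
move=> e0; have [d d0 Hd] := mul_strict C e0; exists d => // x y hx hy.
have [xy] := Hd x 1%g y y hx (sm1 d0) hy hy.
by rewrite mul1g lam1 subrr !subr0 normr0 !addr0 addrAC.
Qed.

Lemma lam_inv e : 0 < e -> exists2 d : R, 0 < d &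
  forall x, sm d x -> dom x^-1%g /\ `|lam x^-1%g + lam x| <= e * `|lam x|.
Proof.
move=> e0; have [d d0 Hd] := lam_mulr e0.
have [d' d'0 Hd'] := inv_cont C d0.
exists (Num.min d d'); first by rewrite lt_min d0.
move=> x hx; have hi := Hd' _ (sm_minr hx); split; first by case: hi.
have [_] := Hd _ _ hi (sm_minl hx).
by rewrite mulVg lam1 sub0r -opprD normrN.
Qed.

(** This is [lam_mulr] for the product x (x^-1 y) = y. A relative error of at most 1/2 bounds the
    quotient by twice the coordinate difference, so coordinates measure left quotients. *)
Lemma lam_div e : 0 < e -> exists2 d : R, 0 < d &
  forall x y, sm d x -> sm d y -> [/\ dom (x^-1 * y)%g,
    `|lam (x^-1 * y)%g| <= 2 * `|lam y - lam x| &
    `|lam y - lam x - lam (x^-1 * y)%g| <= e * `|lam (x^-1 * y)%g|].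
Proof.
move=> e0; have e'0 : 0 < Num.min e (1/2) by rewrite lt_min e0 divr_gt0.
have [d d0 Hd] := lam_mulr e'0.
have [d1 d10 Hd1] := sm_mul d0.
have [d2 d20 Hd2] := inv_cont C d10.
exists (Num.min d (Num.min d1 d2)); first by rewrite !lt_min d0 d10.
move=> x y hx hy.
have hxy : sm d (x^-1 * y)%g.
  apply: Hd1; last exact: sm_minl (sm_minr hy).
  by apply: Hd2; exact: sm_minr (sm_minr hx).
have [_] := Hd _ _ (sm_minl hx) hxy; rewrite mulVKg => h.
split; first by case: hxy.
  have h1 : `|lam y - lam x - lam (x^-1 * y)%g| <= 1/2 * `|lam (x^-1 * y)%g|.
    by apply: (le_trans h); rewrite ler_wpM2r// ge_min lexx orbT.
  have := ler_distD (lam y - lam x) (lam (x^-1 * y)%g) 0.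
  rewrite !subr0 distrC; lra.
by apply: (le_trans h); rewrite ler_wpM2r// ge_min lexx.
Qed.

Lemma sm_conj g e : 0 < e -> exists2 d : R, 0 < d &
  forall x, sm d x -> sm e (g^-1 * x * g)%g.
Proof.
move=> e0; have [d d0 Hd] := conj_cont C g^-1%g e0.
by exists d => // x /Hd; rewrite invgK.
Qed.

(** Each new factor costs an error of at most e |lam x|, because [lam_mulr] charges only the right
    factor. The bound on k |lam x| keeps every power in the domain. *)
Lemma lam_expg e : 0 < e -> e <= 1 -> exists2 d : R, 0 < d &
  forall x k, sm d x -> k%:R * `|lam x| < d ->
    dom (x ^+ k)%g /\ `|lam (x ^+ k)%g - k%:R *: lam x| <= e * (k%:R * `|lam x|).
Proof.
move=> e0 e1; have [d d0 Hd] := lam_mulr e0.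
(* With e <= 1 the k-th power has a coordinate of norm at most 2 k |lam x|, which must stay below
   d. *)
exists (d / 2); first by rewrite divr_gt0.
move=> x k hx; have hxd : sm d x by apply: sm_le hx; lra.
elim: k => [_|k IH hk].
  by rewrite expg0 lam1 scale0r subrr normr0 !mul0r mulr0; split => //; exact: dom1.
have hk' : k%:R * `|lam x| < d / 2.
  by apply: le_lt_trans hk; rewrite ler_wpM2r// ler_nat.
have [dk lk] := IH hk'.
have hxk : sm d (x ^+ k)%g.
  split => //; have := ler_distD (k%:R *: lam x) (lam (x ^+ k)%g) 0.
  rewrite !subr0 normrZ ger0_norm//.
  have : e * (k%:R * `|lam x|) <= k%:R * `|lam x|.
    by rewrite ler_piMl// mulr_ge0.
  lra.
have [dS lS] := Hd _ _ hxk hxd; rewrite expgSr; split => //.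
have -> : lam (x ^+ k * x)%g - k.+1%:R *: lam x =
   (lam (x ^+ k * x)%g - lam (x ^+ k)%g - lam x) + (lam (x ^+ k)%g - k%:R *: lam x).
  by apply/rowP => j; rewrite !mxE -natr1; ring.
apply: le_trans (ler_normD _ _) _.
by apply: le_trans (lerD lS lk) _; rewrite -natr1; lra.
Qed.

End StrictChart.

(** * Integer powers in a group *)

Section IntPowers.
Variable T : groupType.
Implicit Type x : T.

Definition zexpg x (z : int) : T :=
  match z with Posz k => (x ^+ k)%g | Negz k => (x ^- k.+1)%g end.

(** Every integer is a difference of naturals, so this form replaces sign distinctions in the proof
    of additivity. *)
Lemma zexpg_subz x (p q : nat) : zexpg x (p%:Z - q%:Z) = (x ^+ p * x ^- q)%g.
Proof.
have [qp|pq] := leqP q p.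
  by rewrite subzn//= -{2}(subnK qp) expgnDr mulgK.
have -> : p%:Z - q%:Z = Negz (q - p).-1 by lia.
rewrite /= prednK ?subn_gt0// -{2}(subnK (ltnW pq)) expgnDr invgM.
by rewrite mulVKg.
Qed.

Lemma zexpgD x (a b : int) : zexpg x (a + b) = (zexpg x a * zexpg x b)%g.
Proof.
have Hz (z : int) : exists p q : nat, z = p%:Z - q%:Z.
  case: z => k; first by exists k, 0%N; rewrite subr0.
  by exists 0%N, k.+1; rewrite sub0r NegzE.
have [p [q ->]] := Hz a; have [p' [q' ->]] := Hz b.
have -> : p%:Z - q%:Z + (p'%:Z - q'%:Z) = (p + p')%N%:Z - (q' + q)%N%:Z by lia.
rewrite !zexpg_subz !expgnDr invgM -!mulgA; congr (_ * _)%g.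
by rewrite !mulgA; congr (_ * _)%g; exact/commuteV/commuteX2.
Qed.

Lemma zexpgM x (a : int) (k : nat) : zexpg x (k%:Z * a) = (zexpg x a ^+ k)%g.
Proof.
elim: k => [|k IH]; first by rewrite mul0r.
by rewrite expgS -IH -zexpgD; congr zexpg; lia.
Qed.

End IntPowers.

(** * Limits in the group along filters and ultrafilters *)

Section OneParameter.
Variables (R : realType) (n : nat) (T : groupType) (C : strict_chart R n T).
Local Notation dom := (dom C).
Local Notation lam := (lam C).
Local Notation sm := (sm C).
Implicit Types (x g : T) (e d r : R).

Lemma lam_zexpg e : 0 < e -> e <= 1 -> exists2 d : R, 0 < d &
  forall x (z : int), sm d x -> `|z|%:~R * `|lam x| < d ->
    dom (zexpg x z) /\
    `|lam (zexpg x z) - z%:~R *: lam x| <= e * (`|z|%:~R * `|lam x|).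
Proof.
(* With N = |z| |lam x|, inverting a power adds an error e/3 times a coordinate of size at most 2 N,
   on top of the error e/3 N of the power itself. *)
move=> e0 e1; have e3 : 0 < e / 3 by rewrite divr_gt0.
have e31 : e / 3 <= 1 by lra.
have [d d0 Hd] := lam_expg C e3 e31.
have [d' d'0 Hd'] := lam_inv C e3.
exists (Num.min d (d' / 2)); first by rewrite lt_min d0 divr_gt0.
move=> x [k|k] hx.
  rewrite /= => hk.
  have [||h1 h2] := Hd x k; first exact: sm_minl hx.
    by apply: lt_le_trans hk _; rewrite ge_min lexx.
  split => //; apply: le_trans h2 _; by rewrite ler_wpM2r//; lra.
rewrite NegzE normrN /= => hk.
have [||h1 h2] := Hd x k.+1; first exact: sm_minl hx.
  by apply: lt_le_trans hk _; rewrite ge_min lexx.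
have lkx : `|k.+1%:R *: lam x| = k.+1%:R * `|lam x| by rewrite normrZ ger0_norm.
have -> : `|k.+1%:Z|%:~R = k.+1%:R :> R by [].
have hkd : k.+1%:R * `|lam x| < d' / 2.
  by apply: lt_le_trans hk _; rewrite ge_min lexx orbT.
have N0 : 0 <= k.+1%:R * `|lam x| by rewrite mulr_ge0.
move: (_ * `|lam x|) lkx hkd N0 h2 => N lkx hkd N0 h2.
have e3N : e / 3 * N <= N by rewrite ler_piMl.
have l1 : `|lam (x ^+ k.+1)%g| <= N + e / 3 * N.
  have := ler_distD (k.+1%:R *: lam x) (lam (x ^+ k.+1)%g) 0.
  rewrite !subr0; lra.
have [|h3 h4] := Hd' (x ^+ k.+1)%g; first by split => //; lra.
split => //.
have -> : lam (x ^- k.+1)%g - (- k.+1%:Z)%:~R *: lam x =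
   (lam (x ^- k.+1)%g + lam (x ^+ k.+1)%g) - (lam (x ^+ k.+1)%g - k.+1%:R *: lam x).
  by apply/rowP => j; rewrite !mxE mulrNz pmulrn; ring.
apply: le_trans (ler_normB _ _) _; apply: le_trans (lerD h4 h2) _.
have : e / 3 * `|lam (x ^+ k.+1)%g| <= e / 3 * (2 * N) by rewrite ler_wpM2l//; lra.
lra.
Qed.

(** The sets [sm e] shrink to the identity because the chart is injective; this separation property
    is behind the uniqueness of limits. *)
Lemma sm_eq1 x : (forall e, 0 < e -> sm e x) -> x = 1%g.
Proof.
move=> h; have [dx _] := h 1 ltr01; apply: (@lam_inj _ _ _ C) => //.
  exact: dom1.
rewrite lam1; apply/eqP; rewrite -normr_eq0; apply/eqP/le_anti/andP; split => //.
by apply/ler_addgt0Pr => e e0; rewrite add0r; case: (h e e0) => _ /ltW.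
Qed.

(** Convergence to g, with the translates of [sm e] by g as neighbourhoods: T is an abstract group
    and carries no topology of its own. *)
Definition tends (F : set_system nat) (y : nat -> T) g :=
  forall e, 0 < e -> \forall i \near F, sm e (g^-1 * y i)%g.

Lemma tends_unique F {FF : ProperFilter F} y g h :
  tends F y g -> tends F y h -> g = h.
Proof.
move=> yg yh; suff /mulg1_eq : (g^-1 * h)%g = 1%g by rewrite invgK.
apply: sm_eq1 => e e0.
have [d d0 Hd] := sm_mul C e0; have [d' d'0 Hd'] := inv_cont C d0.
have [i [hi1 hi2]] := filter_ex (filterI (yg _ d0) (yh _ d'0)).
have := Hd _ _ hi1 (Hd' _ hi2).
by rewrite invgM invgK mulgA mulgK.
Qed.

(** Since (g h)^-1 y z is the product of h^-1 (g^-1 y) h and h^-1 z, continuity of conjugation is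
    what makes limits multiplicative. *)
Lemma tends_mul F {FF : ProperFilter F} y z g h :
  tends F y g -> tends F z h -> tends F (fun i => y i * z i)%g (g * h)%g.
Proof.
move=> yg zh e e0.
have [d d0 Hd] := sm_mul C e0; have [d' d'0 Hd'] := sm_conj C h d0.
apply: filterS2 (yg _ d'0) (zh _ d0) => i /Hd' h1 h2.
by have := Hd _ _ h1 h2; rewrite invgM !mulgA mulgK.
Qed.

Lemma tends_cst F {FF : ProperFilter F} g : tends F (fun=> g) g.
Proof. by move=> e e0; apply: nearW => i; rewrite mulVg; exact: sm1. Qed.

Lemma tends_expg F {FF : ProperFilter F} y g k :
  tends F y g -> tends F (fun i => y i ^+ k)%g (g ^+ k)%g.
Proof.
move=> yg; elim: k => [|k IH]; first exact: tends_cst.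
rewrite expgS; rewrite (_ : (fun i => _) = (fun i => y i * y i ^+ k)%g); first exact: tends_mul.
by apply/funext => i; rewrite expgS.
Qed.

Lemma tends1 F {FF : ProperFilter F} y : (forall e, 0 < e -> \forall i \near F, sm e (y i)) ->
  tends F y 1%g.
Proof. by move=> h e /h; apply: filterS => i; rewrite invg1 mul1g. Qed.

(** A closed ball of coordinates is compact, so an ultrafilter living there has a limit p;
    [lam_surj] realises p by some g, and [lam_div] turns closeness of coordinates into closeness in
    the group. *)
Lemma tends_ultra : exists2 r : R, 0 < r &
  forall F {UF : UltraFilter F} y, (\forall i \near F, sm r (y i)) ->
    exists g, [/\ dom g, tends F y g & lam \o y @ F --> lam g].
Proof.
have [d d0 Hd] := lam_div C ltr01; have [r r0 Hr] := lam_surj C.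
set s := Num.min d r; have s0 : 0 < s by rewrite lt_min d0.
have sd : s <= d by rewrite ge_min lexx.
have sr : s <= r by rewrite ge_min lexx orbT.
exists (s / 2); first by rewrite divr_gt0.
move=> F UF y ys.
set A := [set z : 'rV[R]_n | `|z| <= s / 2].
have cA : compact A.
  apply: bounded_closed_compact.
    by exists (s / 2); split => [|t /ltW t1 z /le_trans]; [exact: num_real|exact].
  apply: (closed_comp (f := fun z : 'rV[R]_n => `|z|) (D := [set z | z <= s / 2])).
    by move=> z _; exact: norm_continuous.
  exact: closed_le.
have FA : (lam \o y @ F) A by apply: filterS ys => i [_ /ltW].
have PF : ProperFilter F := ultra_proper.
have [p [Ap cp]] := cA (lam \o y @ F) _ FA.
(* A cluster point of an ultrafilter is a limit: otherwise the complement of a neighbourhood would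
   belong to it. *)
have yp : lam \o y @ F --> p.
  move=> B Bp; have [//|nB] := in_ultra_setVsetC ((lam \o y) @^-1` B) UF.
  by have [z []] := cp (~` B) B nB Bp.
have [g dg gp] : exists2 g, dom g & lam g = p.
  apply: Hr; by apply: le_lt_trans Ap _; lra.
have hg : sm d g.
  split => //; rewrite gp; by apply: le_lt_trans Ap _; lra.
exists g; split => //; last by rewrite gp.
move=> e e0; move/cvgrPdist_lt : yp => /(_ (e / 2)); rewrite divr_gt0// => /(_ isT).
apply: filterS2 ys => i yi pi.
have [|h1 h2 _] := Hd _ (y i) hg.
  case: yi => h1 h2; split => //; by apply: lt_le_trans h2 _; lra.
split => //; apply: le_lt_trans h2 _; rewrite gp distrC /=.
by rewrite mulrC -ltr_pdivlMr.
Qed.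

End OneParameter.

(** * One-parameter subgroups *)

Section OneParameterExistence.
Variables (R : realType) (n : nat) (T : groupType) (C : strict_chart R n T).
Local Notation dom := (dom C).
Local Notation lam := (lam C).
Local Notation sm := (sm C).
Local Notation tends := (tends C).

(** Floors are additive only up to a bounded defect p; the corresponding power of x_N tends to 1 and
    disappears in the limit. *)
Lemma floor_natM (a : R) (k : nat) : exists2 p : nat, (p <= k)%N &
  Num.floor (k%:R * a) = k%:Z * Num.floor a + p%:Z.
Proof.
have /andP[a1 a2] := floor_itv a.
have /andP[b1 b2] := floor_itv (k%:R * a).
set f := Num.floor a in a1 a2 *; set g := Num.floor _ in b1 b2 *.
have h1 : k%:Z * f <= g.
  rewrite -ltzD1 -(ltr_int R); apply: le_lt_trans b2.
  by rewrite intrM -pmulrn ler_wpM2l.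
have h2 : g <= k%:Z * f + k%:Z.
  rewrite -(ler_int R) (le_trans b1)//.
  have -> : (k%:Z * f + k%:Z)%:~R = k%:R * (f + 1)%:~R :> R.
    by rewrite !intrD !intrM -!pmulrn; ring.
  by rewrite ler_wpM2l// ltW.
exists (absz (g - k%:Z * f)%R); first by lia.
lia.
Qed.

Lemma floorD_nat (a b : R) : exists2 p : nat, (p <= 1)%N &
  Num.floor (a + b) = Num.floor a + Num.floor b + p%:Z.
Proof.
have /andP[a1 a2] := floor_itv a.
have /andP[b1 b2] := floor_itv b.
have /andP[c1 c2] := floor_itv (a + b).
set f := Num.floor a in a1 a2 *; set g := Num.floor b in b1 b2 *.
set h := Num.floor _ in c1 c2 *.
have h1 : f + g < h + 1.
  by rewrite -(ltr_int R); apply: le_lt_trans c2; rewrite intrD lerD.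
have h2 : h < f + g + 2.
  by rewrite -(ltr_int R); apply: le_lt_trans c1 _; rewrite !intrD in a2 b2 *; lra.
by exists (absz (h - f - g)%R); lia.
Qed.

Lemma one_param (X : 'rV[R]_n) : exists c : R -> T,
  (forall s t, c (s + t) = (c s * c t)%g) /\
  forall e : R, 0 < e -> exists2 d : R, 0 < d &
    forall t, `|t| < d -> dom (c t) /\ `|lam (c t) - t *: X| <= e * `|t|.
Proof.
have Xsmall (e : R) : 0 < e -> \forall N \near \oo, `|X| * N.+1%:R^-1 < e.
  move=> e0; have X1 : 0 < `|X| + 1 by rewrite ltr_wpDl.
  have e'0 : 0 < e / (`|X| + 1) by rewrite divr_gt0.
  apply: filterS (near_infty_natSinv_lt (PosNum e'0)) => N /=.
  rewrite ltr_pdivlMr// => h; apply: le_lt_trans h.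
  by rewrite mulrC ler_wpM2l// lerDl.
have [r0 r0gt Hr0] := lam_surj C.
(* The default 1 can be taken only for small N, while X / (N+1) may still lie outside the range of
   the chart. *)
pose xs N : T := xget 1%g [set x | dom x /\ lam x = N.+1%:R^-1 *: X].
have xsP : \forall N \near \oo, dom (xs N) /\ lam (xs N) = N.+1%:R^-1 *: X.
  apply: filterS (Xsmall _ r0gt) => N hN.
  apply: (@xgetPex _ 1%g [set x | dom x /\ lam x = N.+1%:R^-1 *: X]).
  have [|x dx lx] := Hr0 (N.+1%:R^-1 *: X); last by exists x.
  by rewrite normrZ ger0_norm// mulrC.
(* One ultrafilter refining the filter at infinity serves all t, so that the limits for s and t can
   be multiplied. *)
have [U [UU oU]] := ultraFilterLemma (F := \oo%classic) _.
have PU : ProperFilter U by exact: ultra_proper.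
pose z (t : R) N := Num.floor (t * N.+1%:R).
pose y t N := zexpg (xs N) (z t N).
have xsn N : dom (xs N) /\ lam (xs N) = N.+1%:R^-1 *: X ->
    `|lam (xs N)| = `|X| * N.+1%:R^-1.
  by move=> [_ ->]; rewrite normrZ ger0_norm// mulrC.
have zb t N : `|z t N|%:~R * (`|X| * N.+1%:R^-1) <= `|t| * `|X| + `|X| * N.+1%:R^-1.
  have /andP[z1 z2] := floor_itv (t * N.+1%:R); rewrite -/(z t N) in z1 z2.
  have N0 : 0 < N.+1%:R :> R by [].
  have h : `|z t N|%:~R <= `|t| * N.+1%:R + 1 :> R.
    have -> : `|z t N|%:~R = `|(z t N)%:~R| :> R by rewrite intr_norm.
    rewrite intrD in z2; have := ler_norm (t * N.+1%:R).
    have := ler_norm (- (t * N.+1%:R)); rewrite normrN normrM (ger0_norm (ltW N0)).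
    by move=> ? ?; rewrite ler_norml; lra.
  have -> : `|t| * `|X| + `|X| * N.+1%:R^-1 = (`|t| * N.+1%:R + 1) * (`|X| * N.+1%:R^-1).
    by field.
  by rewrite ler_wpM2r// mulr_ge0.
have [v vE] : exists v : nat -> R, forall N, `|X| * N.+1%:R^-1 = v N.
  by exists (fun N => `|X| * N.+1%:R^-1).
have v0 N : 0 <= v N by rewrite -vE mulr_ge0.
have {}zb t N : `|z t N|%:~R * v N <= `|t| * `|X| + v N by rewrite -vE.
have {}xsn N : dom (xs N) /\ lam (xs N) = N.+1%:R^-1 *: X -> `|lam (xs N)| = v N.
  by rewrite -vE; exact: xsn.
have {}Xsmall (e : R) : 0 < e -> \forall N \near \oo, v N < e.
  by move=> /Xsmall; apply: filterS => N; rewrite vE.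
(* Bounded powers of [xs N] tend to 1: this absorbs the floor defects. *)
have claim1 k (p : nat -> nat) : (forall N, (p N <= k)%N) ->
    tends U (fun N => xs N ^+ p N)%g 1%g.
  move=> pk; apply: tends1 => e e0.
  have [d d0 Hd] := lam_expg C ltr01 (lexx _).
  set m := Num.min d (e / 2); have m0 : 0 < m by rewrite lt_min d0 divr_gt0.
  have k1 : 0 < k%:R + 1 :> R by rewrite ltr_wpDl.
  apply: oU; apply: filterS2 xsP (Xsmall (m / (k%:R + 1)) _); last by rewrite divr_gt0.
  move=> N hN; rewrite ltr_pdivlMr// -(xsn _ hN) => lN.
  have pN : (p N)%:R * `|lam (xs N)| <= k%:R * `|lam (xs N)|.
    by rewrite ler_wpM2r// ler_nat.
  have md : m <= d by rewrite ge_min lexx.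
  have me : m <= e / 2 by rewrite ge_min lexx orbT.
  have k0 : 0 <= k%:R * `|lam (xs N)| by rewrite mulr_ge0.
  have l0 : 0 <= `|lam (xs N)| by [].
  have [||h1 h2] := Hd (xs N) (p N); first by split; [case: hN|lra].
    lra.
  split => //; have := ler_distD ((p N)%:R *: lam (xs N)) (lam (xs N ^+ p N)%g) 0.
  rewrite !subr0 normrZ (@ger0_norm _ (p N)%:R)//; lra.
(* The radius d is independent of N, so the estimate survives the limit. *)
have claim2 e : 0 < e -> e <= 1 -> exists2 d : R, 0 < d & forall t, `|t| < d ->
    \forall N \near U, dom (y t N) /\
      `|lam (y t N) - (z t N)%:~R *: lam (xs N)| <= e * (`|t| * `|X| + v N).
  move=> e0 e1; have [d d0 Hd] := lam_zexpg C e0 e1.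
  have X1 : 0 < `|X| + 1 by rewrite ltr_wpDl.
  exists (d / 2 / (`|X| + 1)); first by rewrite !divr_gt0.
  move=> t; rewrite ltr_pdivlMr// => td.
  apply: oU; apply: filterS2 xsP (Xsmall (d / 2) _); last by rewrite divr_gt0.
  move=> N hN lN; have tX : `|t| * `|X| <= `|t| * (`|X| + 1) by rewrite ler_wpM2l// lerDl.
  have XN0 := v0 N.
  have zN := zb t N; have l0 : 0 <= `|t| * `|X| by rewrite mulr_ge0.
  have [||h1 h2] := Hd (xs N) (z t N).
  - by split; [case: hN|rewrite (xsn _ hN); lra].
  - by rewrite (xsn _ hN); lra.
  split => //; apply: le_trans h2 _; rewrite ler_wpM2l//; first exact: ltW.
  by rewrite (xsn _ hN).
have [r r0' Hr] := tends_ultra C.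
have [d1 d10 Hd1] := claim2 1 ltr01 (lexx _).
have X1 : 0 < `|X| + 1 by rewrite ltr_wpDl.
(* The coordinate of [y t N] is at most twice |t| |X| + [v N], and each of these two terms stays
   below r / 4. *)
set d2 := Num.min d1 (r / 4 / (`|X| + 1)).
have d20 : 0 < d2 by rewrite lt_min d10 !divr_gt0.
have claim3 t : `|t| < d2 -> exists g, [/\ dom g, tends U (y t) g & lam \o y t @ U --> lam g].
  rewrite lt_min => /andP[td1 td2]; apply: Hr.
  have r4 : 0 < r / 4 by rewrite divr_gt0.
  apply: filterS3 (Hd1 _ td1) (oU _ xsP) (oU _ (Xsmall _ r4)) => N [h1 h2] hN lN.
  split => //; move: td2; rewrite ltr_pdivlMr// => td2.
  have tX : `|t| * `|X| <= `|t| * (`|X| + 1) by rewrite ler_wpM2l// lerDl.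
  have := ler_distD ((z t N)%:~R *: lam (xs N)) (lam (y t N)) 0.
  rewrite !subr0 normrZ (xsn _ hN) -intr_norm; have := zb t N; lra.
(* Any t is k+1 times a small one, so its limit is a power of a limit obtained from compactness, up
   to a floor defect. *)
have claim4 t : exists g, tends U (y t) g.
  have [k tk] : exists k : nat, `|t| / k.+1%:R < d2.
    exists (Num.bound (`|t| / d2)); rewrite ltr_pdivrMr// mulrC -ltr_pdivrMr//.
    by apply: lt_le_trans (archi_boundP _) _; rewrite ?ler_nat ?divr_ge0// ltW.
  have [|g [_ yg _]] := claim3 (t / k.+1%:R).
    by rewrite normrM normfV [`|k.+1%:R|]ger0_norm.
  have fl N := floor_natM (t / k.+1%:R * N.+1%:R) k.+1.
  pose p N := sval (cid2 (fl N)).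
  have pk N : (p N <= k.+1)%N := s2valP (cid2 (fl N)).
  have pE N : z t N = k.+1%:Z * z (t / k.+1%:R) N + (p N)%:Z.
    rewrite -(s2valP' (cid2 (fl N))) /z; congr Num.floor.
    by rewrite mulrA [k.+1%:R * _]mulrC divfK// pnatr_eq0.
  exists (g ^+ k.+1 * 1)%g.
  rewrite (_ : y t = fun N => y (t / k.+1%:R)%R N ^+ k.+1 * xs N ^+ p N)%g.
    by apply: tends_mul (tends_expg _ yg) (claim1 _ _ pk).
  by apply/funext => N; rewrite /y pE zexpgD zexpgM.
pose c t := sval (cid (claim4 t)).
have yc t : tends U (y t) (c t) := svalP (cid (claim4 t)).
exists c; split.
  move=> s t; apply: tends_unique (yc (s + t)) _.
  have fl N := floorD_nat (s * N.+1%:R) (t * N.+1%:R).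
  pose p N := sval (cid2 (fl N)).
  have pk N : (p N <= 1)%N := s2valP (cid2 (fl N)).
  have pE N : z (s + t) N = z s N + z t N + (p N)%:Z.
    by rewrite -(s2valP' (cid2 (fl N))) /z; congr Num.floor; rewrite mulrDl.
  rewrite (_ : y (s + t) = fun N => y s N * y t N * xs N ^+ p N)%g.
    rewrite -[X in tends _ _ X]mulg1.
    exact: tends_mul (tends_mul (yc s) (yc t)) (claim1 _ _ pk).
  by apply/funext => N; rewrite /y pE !zexpgD.
move=> e e0; set e' := Num.min 1 (e / (`|X| + 1)).
have e'0 : 0 < e' by rewrite lt_min ltr01 divr_gt0.
have e'le : e' <= 1 by rewrite ge_min lexx.
have [d d0 Hd] := claim2 e' e'0 e'le.
exists (Num.min d d2); first by rewrite lt_min d0.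
move=> t; rewrite lt_min => /andP[td td2].
have [g [dg yg lg]] := claim3 t td2.
have cg : c t = g := tends_unique (yc t) yg.
rewrite cg; split => //.
(* The estimate for the limit is read off at a single index N at which each of the three N-dependent
   errors is below h / 3. *)
apply/ler_addgt0Pr => h h0; have h2 : 0 < h / 3 by rewrite divr_gt0.
move/cvgrPdist_lt : lg => /(_ _ h2) lg.
have /filter_ex[N [[_ h3 hN lN] /= h4]] : \forall N \near U, [/\ dom (y t N),
  `|lam (y t N) - (z t N)%:~R *: lam (xs N)| <= e' * (`|t| * `|X| + v N),
  dom (xs N) /\ lam (xs N) = N.+1%:R^-1 *: X & v N < h / 3] /\
  `|lam g - (lam \o y t) N| < h / 3.
  apply: filterS3 (filterI (Hd _ td) lg) (oU _ xsP) (oU _ (Xsmall _ h2)).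
  by move=> N [[]].
have zt : `|(z t N)%:~R *: lam (xs N) - t *: X| <= v N.
  have /andP[z1 z2] := floor_itv (t * N.+1%:R); rewrite -/(z t N) in z1 z2.
  rewrite intrD in z2.
  have -> : (z t N)%:~R *: lam (xs N) - t *: X =
     (((z t N)%:~R - t * N.+1%:R) * N.+1%:R^-1) *: X.
    by rewrite hN.2 scalerA -scalerBl; congr (_ *: _); rewrite mulrBl mulfK// pnatr_eq0.
  rewrite -vE normrZ normrM mulrC ler_wpM2l// [`|N.+1%:R^-1|]ger0_norm//.
  by rewrite -[leRHS]mul1r ler_wpM2r// ler_norml; lra.
have -> : lam g - t *: X = (lam g - lam (y t N)) + (lam (y t N) - (z t N)%:~R *: lam (xs N))
  + ((z t N)%:~R *: lam (xs N) - t *: X) by rewrite subrKA subrKA.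
apply: le_trans (ler_normD _ _) _; apply: le_trans (lerD (ler_normD _ _) (lexx _)) _.
have XN0 := v0 N.
have e'1 : e' * (v N) <= v N.
  by rewrite ler_piMl// ge_min lexx.
have e'X : e' * (`|t| * `|X|) <= e * `|t|.
  have : e' * (`|X| + 1) <= e by rewrite -ler_pdivlMr// ge_min lexx orbT.
  have : e' * `|X| <= e' * (`|X| + 1) by rewrite ler_pM2l// lerDl.
  move=> a1 a2; have a3 := le_trans a1 a2.
  by rewrite [`|t| * _]mulrC mulrA ler_wpM2r.
rewrite mulrDr in h3; rewrite /= in h4; lra.
Qed.

End OneParameterExistence.

(** * Almost additive maps of a real variable *)

Section QuasiAdditive.
Variables (R : realType) (m k : nat) (q : R -> 'M[R]_(m, k)).
Hypothesis qD : forall e : R, 0 < e -> exists2 d : R, 0 < d &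
  forall s t, `|s| < d -> `|t| < d -> `|q (s + t) - q s - q t| <= e * `|q t|.
Hypothesis q_small : forall e : R, 0 < e -> exists2 d : R, 0 < d &
  forall t, `|t| < d -> `|q t| <= e.

(** At s = t = 0 the defect is - q 0, so |q 0| <= 1/2 |q 0|. *)
Lemma quasi_additive0 : q 0 = 0.
Proof.
have h2 : 0 < 1 / 2 :> R by rewrite divr_gt0.
have [d d0 Hd] := qD h2.
have := Hd 0 0; rewrite normr0 addr0 subrr sub0r normrN => /(_ d0 d0) h.
by apply/eqP; rewrite -normr_eq0; apply/eqP; have := normr_ge0 (q 0); lra.
Qed.

Lemma quasi_additive_natmul (e : R) (d : R) : 0 < e ->
  (forall s t, `|s| < d -> `|t| < d -> `|q (s + t) - q s - q t| <= e * `|q t|) ->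
  forall (j : nat) t, `|t| < d -> j%:R * `|t| < d ->
    `|q (j%:R * t) - j%:R *: q t| <= j%:R * e * `|q t|.
Proof.
move=> e0 Hd j t td; elim: j => [|j IH] jd.
  by rewrite !mul0r scale0r quasi_additive0 subrr normr0.
have jd' : j%:R * `|t| < d.
  by apply: le_lt_trans jd; rewrite ler_wpM2r// ler_nat.
have := Hd (j%:R * t) t _ td; rewrite normrM ger0_norm// => /(_ jd') h.
have -> : j.+1%:R * t = j%:R * t + t by rewrite -natr1 mulrDl mul1r.
have -> : q (j%:R * t + t) - j.+1%:R *: q t =
   (q (j%:R * t + t) - q (j%:R * t) - q t) + (q (j%:R * t) - j%:R *: q t).
  by apply/matrixP => a b; rewrite !mxE -natr1; ring.
apply: le_trans (ler_normD _ _) _; apply: le_trans (lerD h (IH jd')) _.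
by rewrite -natr1; lra.
Qed.

(* Commensurability of [r * s] and [s] up to a remainder that becomes negligible. *)
Lemma quasi_additive_scale (e : R) : 0 < e -> e <= 1 / 2 -> exists2 d : R, 0 < d &
  forall r s, 0 <= r <= 1 -> `|s| < d -> `|q (r * s) - r *: q s| <= 4 * e * r * `|q s|.
Proof.
move=> e0 e2; have [d d0 Hd] := qD e0; exists d => // r s /andP[r0 r1] sd.
apply/ler_addgt0Pr => h h0; have h4 : 0 < h / 4 by rewrite divr_gt0.
have [d' d'0 Hd'] := q_small h4.
(* Cut s into j parts, so fine that s / j and q s / j are negligible; r s then consists of p such
   parts and a remainder u. *)
pose K := Num.max (`|s| / d') (`|q s| / (h / 4)).
have K0 : 0 <= K by rewrite le_max !divr_ge0// ltW.
pose j := (Num.bound K).+1; have j0 : 0 < j%:R :> R by [].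
have jK : K < j%:R by apply: lt_trans (archi_boundP K0) _; rewrite ltr_nat.
have sj : `|s| / j%:R < d'.
  by rewrite ltr_pdivrMr// mulrC -ltr_pdivrMr//; apply: le_lt_trans jK; rewrite le_max lexx.
have qj : `|q s| / j%:R < h / 4.
  by rewrite ltr_pdivrMr// mulrC -ltr_pdivrMr//; apply: le_lt_trans jK; rewrite le_max lexx orbT.
have jneq : j%:R != 0 :> R by rewrite lt0r_neq0.
pose p := Num.truncn (r * j%:R).
have rj0 : 0 <= r * j%:R by rewrite mulr_ge0.
have /andP[p1 p2] := truncn_itv rj0; rewrite -/p in p1 p2.
set t := s / j%:R.
have st : s = j%:R * t by rewrite /t mulrC divfK.
have tn : `|t| = `|s| / j%:R by rewrite /t normrM normfV [`|j%:R|]ger0_norm.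
have td : `|t| < d.
  by apply: le_lt_trans sd; rewrite tn ler_pdivrMr// ler_peMr// ler1n.
have jtd : j%:R * `|t| < d by rewrite tn mulrC divfK.
have pj : p%:R <= j%:R :> R.
  by apply: le_trans p1 _; rewrite ler_piMl.
have ptd : p%:R * `|t| < d by apply: le_lt_trans jtd; rewrite ler_wpM2r.
have hj := quasi_additive_natmul e0 Hd td jtd; rewrite -st in hj.
have hp := quasi_additive_natmul e0 Hd td ptd.
pose u := r * s - p%:R * t.
have un : `|u| <= `|s| / j%:R.
  rewrite -tn /u {1}st mulrA -mulrBl normrM ler_piMl//.
  by rewrite -natr1 in p2; rewrite ler_norml; lra.
have qu : `|q u| <= h / 4 by apply: Hd'; exact: le_lt_trans un _.
have ud : `|u| < d.
  by apply: le_lt_trans un _; rewrite -tn.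
have := Hd (p%:R * t) u; rewrite normrM [`|p%:R|]ger0_norm// => /(_ ptd ud).
have -> : p%:R * t + u = r * s by rewrite /u addrC subrK.
move=> hu.
(* The additivity error over the j parts is at most half of j |q t|, which is therefore comparable
   to |q s|. *)
have jq : j%:R * `|q t| <= 2 * `|q s|.
  have := ler_distD (q s) (j%:R *: q t) 0; rewrite !subr0 normrZ [`|j%:R|]ger0_norm//.
  rewrite distrC => h1.
  have : j%:R * e * `|q t| <= 1/2 * (j%:R * `|q t|).
    by rewrite mulrAC mulrC ler_wpM2r// mulr_ge0.
  lra.
have eu : e * `|q u| <= h / 4.
  by apply: le_trans qu; rewrite ler_piMl//; lra.
(* The two terms bounded by p e |q t| contribute at most 2 e r |q s| each, whence the factor 4; the
   other three are at most h / 4 each. *)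
have -> : q (r * s) - r *: q s = (q (r * s) - q (p%:R * t) - q u) + q u +
   (q (p%:R * t) - p%:R *: q t) - (p%:R / j%:R) *: (q s - j%:R *: q t)
   + (p%:R / j%:R - r) *: q s.
  by rewrite scalerBr scalerA divfK//; apply/matrixP => a b; rewrite !mxE; ring.
have n1 : `|(p%:R / j%:R) *: (q s - j%:R *: q t)| <= p%:R * e * `|q t|.
  rewrite normrZ ger0_norm ?divr_ge0//.
  have -> : p%:R * e * `|q t| = p%:R / j%:R * (j%:R * e * `|q t|) by field.
  by rewrite ler_wpM2l// divr_ge0.
have n2 : `|(p%:R / j%:R - r) *: q s| <= h / 4.
  rewrite normrZ; apply: le_trans (ltW qj); rewrite mulrC ler_wpM2l//.
  have -> : p%:R / j%:R - r = (p%:R - r * j%:R) / j%:R by field.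
  have ji : 0 <= j%:R^-1 :> R by rewrite invr_ge0 ltW.
  rewrite normrM (ger0_norm ji) -[leRHS]mul1r ler_wpM2r//.
  by rewrite ler_norml; rewrite -natr1 in p2; lra.
have n3 : p%:R * e * `|q t| <= 2 * e * r * `|q s|.
  have : p%:R * (e * `|q t|) <= r * j%:R * (e * `|q t|) by rewrite ler_wpM2r// mulr_ge0// ltW.
  have : (r * e) * (j%:R * `|q t|) <= (r * e) * (2 * `|q s|) by rewrite ler_wpM2l// mulr_ge0// ltW.
  lra.
apply: le_trans (ler_normD _ _) _.
apply: le_trans (lerD (ler_normB _ _) (lexx _)) _.
apply: le_trans (lerD (lerD (ler_normD _ _) (lexx _)) (lexx _)) _.
apply: le_trans (lerD (lerD (lerD (ler_normD _ _) (lexx _)) (lexx _)) (lexx _)) _.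
lra.
Qed.

(** Comparing q (r s) with r q s shows that the difference quotients are bounded, and then that they
    are Cauchy as s decreases to 0. *)
Lemma quasi_additive_derivable : exists L, forall e : R, 0 < e ->
  exists2 d : R, 0 < d & forall t, `|t| < d -> `|q t - t *: L| <= e * `|t|.
Proof.
(* With 1/8 the relative error is 1/2, so |q s| is at most twice (s / s0) |q s0| for s in [0, s0];
   this is the bound B s. *)
have [d0 d00 Hd0] : exists2 d : R, 0 < d & forall r s, 0 <= r <= 1 -> `|s| < d ->
    `|q (r * s) - r *: q s| <= 4 * (1 / 8) * r * `|q s|.
  by apply: quasi_additive_scale; lra.
pose s0 := d0 / 2; have s00 : 0 < s0 by rewrite divr_gt0.
pose B := 2 * `|q s0| / s0; have B0 : 0 <= B by rewrite /B !mulr_ge0// invr_ge0 ltW.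
have qB s : 0 <= s <= s0 -> `|q s| <= B * s.
  move=> /andP[sg sl]; have r01 : 0 <= s / s0 <= 1.
    by rewrite divr_ge0//= ?ler_pdivrMr ?mul1r// ltW.
  have s0d : `|s0| < d0 by rewrite gtr0_norm// /s0; lra.
  have := Hd0 _ s0 r01 s0d; rewrite divfK ?lt0r_neq0// => h.
  have := ler_distD ((s / s0) *: q s0) (q s) 0; rewrite !subr0 normrZ.
  have /andP[r0 _] := r01; rewrite ger0_norm//.
  have -> : B * s = 2 * (s / s0 * `|q s0|) by rewrite /B; ring.
  have : 0 <= s / s0 * `|q s0| by rewrite mulr_ge0.
  lra.
have B1 : 0 < B + 1 by rewrite ltr_wpDl.
have S4 (e : R) : 0 < e -> exists2 d : R, 0 < d & forall s' s, 0 < s' -> s' <= s -> s < d ->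
    `|s'^-1 *: q s' - s^-1 *: q s| <= e.
  move=> e0; pose e' := Num.min (1 / 2) (e / 4 / (B + 1)).
  have e'0 : 0 < e' by rewrite lt_min !divr_gt0.
  have e'2 : e' <= 1 / 2 by rewrite ge_min lexx.
  have [d dgt Hd] := quasi_additive_scale e'0 e'2.
  exists (Num.min d s0); first by rewrite lt_min dgt.
  move=> s' s s'0 s's; rewrite lt_min => /andP[sd ss0].
  have sgt : 0 < s by exact: lt_le_trans s's.
  have r01 : 0 <= s' / s <= 1.
    by rewrite divr_ge0 ?(ltW s'0) ?(ltW sgt)//= ler_pdivrMr// mul1r.
  have := Hd (s' / s) s r01; rewrite gtr0_norm// => /(_ sd).
  rewrite divfK ?lt0r_neq0// => h.
  have s'n0 : s' != 0 by rewrite lt0r_neq0.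
  have sn0 : s != 0 by rewrite lt0r_neq0.
  have -> : s'^-1 *: q s' - s^-1 *: q s = s'^-1 *: (q s' - (s' / s) *: q s).
    by rewrite scalerBr scalerA mulrA mulVf// mul1r.
  rewrite normrZ gtr0_norm ?invr_gt0// mulrC ler_pdivrMr//.
  apply: le_trans h _.
  have qs : `|q s| <= B * s by apply: qB; rewrite !ltW.
  have h1 : 4 * e' * (s' / s) * `|q s| <= 4 * e' * (s' / s) * (B * s).
    by rewrite ler_wpM2l// !mulr_ge0// ?invr_ge0 ltW.
  apply: le_trans h1 _.
  have -> : 4 * e' * (s' / s) * (B * s) = 4 * (e' * B) * s' by field.
  rewrite ler_pM2r//.
  have : e' * (B + 1) <= e / 4 by rewrite -ler_pdivlMr// ge_min lexx orbT.
  lra.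
(* By [S4] the limit along 1/(N+1) is the derivative from the right. *)
pose Q (N : nat) : 'M[R]_(m, k) := N.+1%:R^-1^-1 *: q N.+1%:R^-1.
have cQ : cvgn Q.
  apply/cauchy_cvgP; apply: cauchy_exP => e e0.
  have e2 : 0 < e / 2 by rewrite divr_gt0.
  have [d dgt Hd] := S4 _ e2.
  have [N0 _ HN0] := near_infty_natSinv_lt (PosNum dgt).
  exists (Q N0); exists N0 => // N /= N0N.
  rewrite -ball_normE /= distrC; apply: (le_lt_trans (y := e / 2)); last by lra.
  apply: Hd; rewrite ?invr_gt0//; last exact: HN0 N0 (leqnn _).
  by rewrite lef_pV2 ?posrE// ler_nat.
exists (limn Q) => e e0.
pose e' := Num.min (e / 2) (e / 2 / (B + 1)).
have e'0 : 0 < e' by rewrite lt_min !divr_gt0.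
have e'e : e' <= e / 2 by rewrite ge_min lexx.
have [d dgt Hd] := S4 _ e'0.
have pos s : 0 < s -> s < d -> `|q s - s *: limn Q| <= e' * s.
  move=> s1 sd.
  have -> : q s - s *: limn Q = s *: (s^-1 *: q s - limn Q).
    by rewrite scalerBr scalerA mulfV ?lt0r_neq0// scale1r.
  rewrite normrZ gtr0_norm// mulrC ler_pM2r//.
  have c : `|s^-1 *: q s - Q N| @[N --> \oo] --> `|s^-1 *: q s - limn Q|.
    apply: cvg_norm; apply: cvgB => //; exact: cvg_cst.
  apply: (closed_cvg (fun x : R => x <= e') _ _ _ c); first exact: closed_le.
  apply: filterS (near_infty_natSinv_lt (PosNum s1)) => N /= Ns.
  by rewrite distrC; apply: Hd; rewrite ?invr_gt0// ltW.
(* The defect of the pair (-t, t) is - (q (-t) + q t), since q 0 = 0. It is small relative to |q t|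
   <= B t, so the derivative from the left agrees with the one from the right. *)
have [d1 d10 Hd1] : exists2 d : R, 0 < d & forall t, 0 < t -> t < d ->
    `|q (- t) + q t| <= e / 2 * t.
  have h0 : 0 < e / 2 / (B + 1) by rewrite !divr_gt0.
  have [d1 d10 Hd1] := qD h0.
  exists (Num.min d1 s0); first by rewrite lt_min d10.
  move=> t t0; rewrite lt_min => /andP[td ts].
  have := Hd1 (- t) t; rewrite normrN gtr0_norm// => /(_ td td).
  rewrite addNr quasi_additive0 sub0r -opprD normrN => h.
  apply: le_trans h _.
  have qt : `|q t| <= B * t by apply: qB; rewrite !ltW.
  rewrite -mulrA ler_pM2l ?divr_gt0// ler_pdivrMl//.
  by apply: le_trans qt _; rewrite ler_pM2r// lerDl.
exists (Num.min d d1); first by rewrite lt_min dgt.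
move=> t; rewrite lt_min => /andP[td td1].
have [t0|t0|t0] := ltgtP 0 t.
- rewrite gtr0_norm// in td *; apply: le_trans (pos _ t0 td) _.
  by rewrite ler_pM2r//; lra.
- have nt : 0 < - t by rewrite oppr_gt0.
  rewrite ltr0_norm// in td td1 *.
  have -> : q t - t *: limn Q = (q (- - t) + q (- t)) - (q (- t) - (- t) *: limn Q).
    by rewrite opprK scaleNr; apply/matrixP => a b; rewrite !mxE; ring.
  apply: le_trans (ler_normB _ _) _.
  apply: le_trans (lerD (Hd1 _ nt td1) (pos _ nt td)) _.
  have : e' * - t <= e / 2 * - t by rewrite ler_pM2r.
  lra.
- by rewrite -t0 quasi_additive0 scale0r subrr !normr0 mulr0.
Qed.

End QuasiAdditive.

(** * Matrix norms and a local surjectivity lemma *)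

Section MxNorm.
Variable R : realType.

Lemma mx_norm_entry m k (A : 'M[R]_(m, k)) i j : `|A i j| <= `|A|.
Proof. by rewrite [leRHS]/Num.Def.normr/= mx_normrE; exact: (le_bigmax _ _ (i, j)). Qed.

Lemma mx_norm_le m k (A : 'M[R]_(m, k)) e :
  0 <= e -> (forall i j, `|A i j| <= e) -> `|A| <= e.
Proof.
by move=> e0 h; rewrite /Num.Def.normr/= mx_normrE bigmax_le// => -[i j] _; exact: h.
Qed.

Lemma mx_norm_mul m k p (A : 'M[R]_(m, k)) (B : 'M[R]_(k, p)) :
  `|A *m B| <= k%:R * `|A| * `|B|.
Proof.
apply: mx_norm_le => [|i j]; first by rewrite !mulr_ge0.
rewrite mxE; apply: le_trans (ler_norm_sum _ _ _) _.
have -> : k%:R * `|A| * `|B| = \sum_(l < k) `|A| * `|B|.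
  by rewrite sumr_const card_ord -mulrA mulr_natl.
by apply: ler_sum => l _; rewrite normrM ler_pM// mx_norm_entry.
Qed.

Lemma norm_sub_continuous (V : normedModType R) (t0 : V) :
  continuous (fun t : V => `|t - t0|).
Proof. by move=> t; apply: cvg_norm; exact: (cvgB cvg_id (cvg_cst t0)). Qed.

Lemma near_dist (V : normedModType R) (t : V) (e : R) :
  0 < e -> \forall s \near t, `|t - s| < e.
Proof. by move=> e0; have := nbhsx_ballx t e e0; rewrite -ball_normE. Qed.

(** Minimise |f t - z| over the closed ball. One Newton step t' = t - (f t - z) from the minimiser
    stays in the ball and at least halves the residual, so the residual is 0. *)
Lemma near_id_surj n (f : 'rV[R]_n -> 'rV[R]_n) t0 (r : R) : 0 < r ->
  (forall t t', `|t - t0| <= r -> `|t' - t0| <= r ->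
     `|f t - f t' - (t - t')| <= 1 / 2 * `|t - t'|) ->
  forall z, `|z - f t0| <= r / 2 -> exists2 t, `|t - t0| <= r & f t = z.
Proof.
move=> r0 fr z zr; pose A := [set t | `|t - t0| <= r].
have t0A : A t0 by rewrite /A /= subrr normr0 ltW.
have cA : compact A.
  apply: bounded_closed_compact.
    exists (`|t0| + r); split => [|M MM t]; first exact: num_real.
    rewrite /A /= => tr; have := ler_distD t0 t 0; rewrite !subr0; lra.
  apply: (closed_comp (f := fun t : 'rV[R]_n => `|t - t0|) (D := [set t | t <= r])).
    by move=> t _; exact: norm_sub_continuous.
  exact: closed_le.
have cf : {within A, continuous (fun t => `|f t - z|)}.
  apply/subspace_continuousP => t tA; apply/cvgrPdist_lt => e e0.
  have e2 : 0 < e / 2 by rewrite divr_gt0.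
  near=> s; have sA : A s by near: s; exact: withinT.
  have ts : `|t - s| < e / 2.
    by near: s; apply: cvg_within;  exact: (@near_dist 'rV[R]_n t (e / 2) e2).
  apply: le_lt_trans (ler_dist_dist _ _) _.
  have -> : f t - z - (f s - z) = (f t - f s - (t - s)) + (t - s).
    by apply/rowP => j; rewrite !mxE; ring.
  apply: le_lt_trans (ler_normD _ _) _; have := fr t s tA sA; lra.
have [t tA tmin] := EVT_min_rV (ex_intro _ t0 t0A) cA cf.
rewrite inE in tA; exists t; first exact: tA.
pose t' := t - (f t - z).
have t'A : A t'.
  rewrite /A /= /t'.
  have -> : t - (f t - z) - t0 = (z - f t0) - (f t - f t0 - (t - t0)).
    by apply/rowP => j; rewrite !mxE; ring.
  apply: le_trans (ler_normB _ _) _; have := fr t t0 tA t0A.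
  by rewrite /A /= in tA; lra.
have := tmin t'; rewrite inE => /(_ t'A) h1.
have h2 := fr t' t t'A tA.
have h3 : f t' - f t - (t' - t) = f t' - z.
  by rewrite /t'; apply/rowP => j; rewrite !mxE; ring.
have h4 : t' - t = - (f t - z) by rewrite /t'; apply/rowP => j; rewrite !mxE; ring.
rewrite h3 h4 normrN in h2.
apply/eqP; rewrite -subr_eq0 -normr_eq0; apply/eqP.
have := normr_ge0 (f t - z); lra.
Unshelve. all: by end_near. Qed.

End MxNorm.

(** * First-order calculus at the identity *)

Section TangentDerivative.
Variables (R : realType) (n : nat) (T : groupType) (C : strict_chart R n T).
Local Notation dom := (dom C).
Local Notation lam := (lam C).
Local Notation sm := (sm C).

Definition bounded_by (V : normedModType R) (L : V -> 'rV[R]_n) (K : R) :=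
  0 <= K /\ forall h, `|L h| <= K * `|h|.

(* [L] is the derivative at 0 of [lam \o F], for [F] with [F 0 = 1]. *)
Definition tder (V : normedModType R) (F : V -> T) (L : V -> 'rV[R]_n) :=
  forall e : R, 0 < e -> exists2 d : R, 0 < d &
    forall h, `|h| < d -> dom (F h) /\ `|lam (F h) - L h| <= e * `|h|.

Lemma tder_bound (V : normedModType R) (F : V -> T) L K : tder F L -> bounded_by L K ->
  exists2 d : R, 0 < d & forall h, `|h| < d -> dom (F h) /\ `|lam (F h)| <= (K + 1) * `|h|.
Proof.
move=> FL [K0 LK]; have [d d0 Hd] := FL _ ltr01; exists d => // h /Hd[h1 h2].
split => //; have := ler_distD (L h) (lam (F h)) 0; rewrite !subr0.
have := LK h; lra.
Qed.

Lemma tder_sm (V : normedModType R) (F : V -> T) L K (e : R) :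
  tder F L -> bounded_by L K -> 0 < e ->
  exists2 d : R, 0 < d & forall h, `|h| < d -> sm e (F h).
Proof.
move=> FL LK e0; have [d d0 Hd] := tder_bound FL LK.
have K1 : 0 < K + 1 by case: LK => K0 _; rewrite ltr_wpDl.
exists (Num.min d (e / (K + 1))); first by rewrite lt_min d0 divr_gt0.
move=> h; rewrite lt_min => /andP[/Hd[h1 h2]]; rewrite ltr_pdivlMr// => h3.
by split => //; apply: le_lt_trans h2 _; rewrite mulrC.
Qed.

Lemma tder_mul (V : normedModType R) (F G : V -> T) L M K K' :
  tder F L -> tder G M -> bounded_by L K -> bounded_by M K' ->
  tder (fun h => F h * G h)%g (fun h => L h + M h).
Proof.
move=> FL GM LK MK e e0; have K'1 : 0 < K' + 1 by case: MK => K0 _; rewrite ltr_wpDl.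
have e3 : 0 < e / 3 by rewrite divr_gt0.
have [|d d0 Hd] := lam_mulr C (e := e / 3 / (K' + 1)); first by rewrite divr_gt0.
have [d1 d10 Hd1] := tder_sm FL LK d0.
have [d2 d20 Hd2] := tder_sm GM MK d0.
have [d3 d30 Hd3] := FL _ e3; have [d4 d40 Hd4] := GM _ e3.
have [d5 d50 Hd5] := tder_bound GM MK.
exists (Num.min d1 (Num.min d2 (Num.min d3 (Num.min d4 d5)))).
  by rewrite !lt_min d10 d20 d30 d40.
move=> h; rewrite !lt_min => /and5P[h1 h2 h3 h4 h5].
have [m1 m2] := Hd _ _ (Hd1 _ h1) (Hd2 _ h2); split => //.
have [_ f2] := Hd3 _ h3; have [_ g2] := Hd4 _ h4; have [_ g3] := Hd5 _ h5.
have m3 : `|lam (F h * G h)%g - lam (F h) - lam (G h)| <= e / 3 * `|h|.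
  apply: le_trans m2 _; rewrite -mulrA ler_pM2l// ler_pdivrMl//.
have -> : lam (F h * G h)%g - (L h + M h) =
   (lam (F h * G h)%g - lam (F h) - lam (G h)) + (lam (F h) - L h) + (lam (G h) - M h).
  by apply/rowP => j; rewrite !mxE; ring.
apply: le_trans (ler_normD _ _) _; apply: le_trans (lerD (ler_normD _ _) (lexx _)) _.
lra.
Qed.

Lemma tder_inv (V : normedModType R) (F : V -> T) L K :
  tder F L -> bounded_by L K -> tder (fun h => (F h)^-1)%g (fun h => - L h).
Proof.
move=> FL LK e e0; have K1 : 0 < K + 1 by case: LK => K0 _; rewrite ltr_wpDl.
have e2 : 0 < e / 2 by rewrite divr_gt0.
have [|d d0 Hd] := lam_inv C (e := e / 2 / (K + 1)); first by rewrite divr_gt0.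
have [d1 d10 Hd1] := tder_sm FL LK d0.
have [d3 d30 Hd3] := FL _ e2.
have [d5 d50 Hd5] := tder_bound FL LK.
exists (Num.min d1 (Num.min d3 d5)); first by rewrite !lt_min d10 d30.
move=> h; rewrite !lt_min => /and3P[h1 h3 h5].
have [m1 m2] := Hd _ (Hd1 _ h1); split => //.
have [_ f2] := Hd3 _ h3; have [_ g3] := Hd5 _ h5.
have m3 : `|lam (F h)^-1%g + lam (F h)| <= e / 2 * `|h|.
  by apply: le_trans m2 _; rewrite -mulrA ler_pM2l// ler_pdivrMl.
have -> : lam (F h)^-1%g - - L h = (lam (F h)^-1%g + lam (F h)) - (lam (F h) - L h).
  by apply/rowP => j; rewrite !mxE; ring.
apply: le_trans (ler_normB _ _) _; lra.
Qed.

Lemma tder_comp (V V' : normedModType R) (F : V -> T) L (l : V' -> V) :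
  tder F L -> (forall h, `|l h| <= `|h|) -> tder (F \o l) (L \o l).
Proof.
move=> FL lh e e0; have [d d0 Hd] := FL _ e0; exists d => // h hd.
have [|h1 h2] := Hd (l h); first exact: le_lt_trans (lh h) hd.
by split => //; apply: le_trans h2 _; rewrite ler_pM2l.
Qed.

Lemma tder1 (V : normedModType R) : tder (fun _ : V => 1%g) (fun=> 0).
Proof.
move=> e e0; exists 1 => // h _; rewrite lam1 subrr normr0; split; first exact: dom1.
by rewrite mulr_ge0// ltW.
Qed.

Lemma hom0 (d : R -> T) : (forall s t, d (s + t) = (d s * d t)%g) -> d 0 = 1%g.
Proof. by move=> dD; apply: (@mulgI _ (d 0)); rewrite -dD addr0 mulg1. Qed.

Lemma homN (d : R -> T) : (forall s t, d (s + t) = (d s * d t)%g) ->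
  forall t, d (- t) = (d t)^-1%g.
Proof. by move=> dD t; apply/esym/mulg1_eq; rewrite -dD subrr hom0. Qed.

Lemma hom_tder (d : R -> T) : (forall s t, d (s + t) = (d s * d t)%g) ->
  (forall e : R, 0 < e -> exists2 r : R, 0 < r & forall t, `|t| < r -> sm e (d t)) ->
  exists Y, tder d (fun t => t *: Y).
Proof.
move=> dD dsm; have [||Y HY] := @quasi_additive_derivable _ _ _ (lam \o d).
- move=> e e0; have [r r0 Hr] := lam_mulr C e0; have [r' r'0 Hr'] := dsm _ r0.
  exists r' => // s t sr tr; have [_] := Hr _ _ (Hr' _ sr) (Hr' _ tr).
  by rewrite /= dD.
- move=> e e0; have [r r0 Hr] := dsm _ e0; exists r => // t /Hr[_ /ltW]; exact.
exists Y => e e0; have [r r0 Hr] := HY _ e0; have [r' r'0 Hr'] := dsm _ ltr01.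
exists (Num.min r r'); first by rewrite lt_min r0.
by move=> t; rewrite lt_min => /andP[/Hr ? /Hr'[]].
Qed.

End TangentDerivative.

(** * Canonical coordinates of the second kind and the adjoint representation *)

Section SecondKind.
Variables (R : realType) (n : nat) (T : groupType) (C : strict_chart R n T).
Local Notation dom := (dom C).
Local Notation lam := (lam C).
Local Notation sm := (sm C).
Variable c : 'I_n -> R -> T.
Hypothesis cD : forall i s t, c i (s + t) = (c i s * c i t)%g.
Hypothesis c_tder : forall i, tder C (c i) (fun t => t *: delta_mx 0 i).

(** Indexed by a list, so that the product can be treated one factor at a time. *)
Definition psis (s : seq 'I_n) (t : 'rV[R]_n) : T :=
  foldr (fun i a => c i (t 0 i) * a)%g 1%g s.

Lemma bounded_scale (Y : 'rV[R]_n) : bounded_by (fun t : R => t *: Y) `|Y|.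
Proof. by split => // h; rewrite normrZ mulrC. Qed.

(** Strict differentiability at 0: its two-point form yields injectivity of [psi] near 0 and feeds
    [near_id_surj]. The Lipschitz bound K on L is what the product rule consumes. *)
Definition strict (F : 'rV[R]_n -> T) (L : 'rV[R]_n -> 'rV[R]_n) (K : R) :=
  [/\ 0 <= K, forall t t', `|L t - L t'| <= K * `|t - t'| &
  forall e : R, 0 < e -> exists2 d : R, 0 < d & forall t t', `|t| < d -> `|t'| < d ->
    sm e (F t) /\ `|lam (F t) - lam (F t') - (L t - L t')| <= e * `|t - t'|].

Lemma strict_mul F G L M K K' : strict F L K -> strict G M K' ->
  strict (fun t => F t * G t)%g (fun t => L t + M t) (K + K').
Proof.
move=> [K0 LK FL] [K'0 MK GM]; split; first exact: addr_ge0.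
  move=> t t'; have -> : L t + M t - (L t' + M t') = (L t - L t') + (M t - M t').
    by apply/rowP => j; rewrite !mxE; ring.
  by apply: le_trans (ler_normD _ _) _; rewrite mulrDl lerD.
move=> e e0; have K1 : 0 < K + K' + 2 by lra.
have [|d d0 Hd] := mul_strict C (e := e / 2 / (K + K' + 2)); first by rewrite !divr_gt0.
have [d' d'0 Hd'] := sm_mul C e0.
pose m := Num.min (Num.min d d') (Num.min 1 (e / 4)).
have m0 : 0 < m by rewrite !lt_min d0 d'0 ltr01 divr_gt0.
have [d1 d10 Hd1] := FL _ m0; have [d2 d20 Hd2] := GM _ m0.
exists (Num.min d1 d2); first by rewrite lt_min d10.
move=> t t'; rewrite !lt_min => /andP[t1 t2] /andP[t'1 t'2].
have [f1 f2] := Hd1 _ _ t1 t'1; have [g1 g2] := Hd2 _ _ t2 t'2.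
have [f'1 _] := Hd1 _ _ t'1 t1; have [g'1 _] := Hd2 _ _ t'2 t2.
split; first by apply: Hd'; apply: sm_minr; apply: sm_minl; eassumption.
have [||||_ h] := Hd (F t) (F t') (G t) (G t'); try (by apply: sm_minl; apply: sm_minl; eassumption).
have me : m <= e / 4 by rewrite /m !ge_min lexx !orbT.
have m1 : m <= 1 by rewrite /m !ge_min lexx !orbT.
set D := `|t - t'| in f2 g2 *; have D0 : 0 <= D by rewrite /D.
have f3 : `|lam (F t) - lam (F t')| <= (K + 1) * D.
  have := ler_distD (L t - L t') (lam (F t) - lam (F t')) 0; rewrite !subr0.
  have : m * D <= 1 * D by rewrite ler_wpM2r.
  have := LK t t'; rewrite -/D; lra.
have g3 : `|lam (G t) - lam (G t')| <= (K' + 1) * D.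
  have := ler_distD (M t - M t') (lam (G t) - lam (G t')) 0; rewrite !subr0.
  have : m * D <= 1 * D by rewrite ler_wpM2r.
  have := MK t t'; rewrite -/D; lra.
have h' : e / 2 / (K + K' + 2) * (`|lam (F t) - lam (F t')| + `|lam (G t) - lam (G t')|)
    <= e / 2 * D.
  rewrite -mulrA ler_wpM2l//; first by lra.
  rewrite ler_pdivrMl//; lra.
have -> : lam (F t * G t)%g - lam (F t' * G t')%g - (L t + M t - (L t' + M t')) =
  (lam (F t * G t)%g - lam (F t' * G t')%g - (lam (F t) - lam (F t') + (lam (G t) - lam (G t'))))
  + (lam (F t) - lam (F t') - (L t - L t')) + (lam (G t) - lam (G t') - (M t - M t')).
  by apply/rowP => j; rewrite !mxE; ring.
apply: le_trans (ler_normD _ _) _; apply: le_trans (lerD (ler_normD _ _) (lexx _)) _.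
have : m * D <= e / 4 * D by rewrite ler_wpM2r.
lra.
Qed.

(** The homomorphism property reduces two points to one: c(t_i) = c(t'_i) c(u) with u = t_i - t'_i,
    so [lam_mulr] and the velocity at 0 suffice. *)
Lemma strict_c i : strict (fun t => c i (t 0 i)) (fun t => t 0 i *: delta_mx 0 i) 1.
Proof.
have dn : `|delta_mx 0 i : 'rV[R]_n| <= 1.
  apply: mx_norm_le => // a b; rewrite mxE; case: (_ && _); rewrite ?normr0 ?normr1//.
split => //.
  move=> t t'; rewrite -scalerBl normrZ mul1r -[leRHS]mulr1 ler_pM//.
  by have := mx_norm_entry (t - t') 0 i; rewrite !mxE.
move=> e e0; have e4 : 0 < Num.min 1 (e / 4) by rewrite lt_min ltr01 divr_gt0.
have [d d0 Hd] := lam_mulr C e4.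
have [d1 d10 Hd1] := tder_sm (c_tder i) (bounded_scale _) d0.
have [d2 d20 Hd2] := tder_sm (c_tder i) (bounded_scale _) e0.
have [d3 d30 Hd3] := c_tder i e4.
pose m := Num.min d1 (Num.min d2 d3).
have m0 : 0 < m by rewrite !lt_min d10 d20.
exists (m / 2); first by rewrite divr_gt0.
move=> t t' tm t'm.
have tt'm : `|t - t'| < m by apply: le_lt_trans (ler_normB _ _) _; lra.
have mc (u : 'rV[R]_n) : `|u| < m -> [/\ sm d (c i (u 0 i)), sm e (c i (u 0 i)) &
    `|lam (c i (u 0 i)) - u 0 i *: delta_mx 0 i| <= Num.min 1 (e / 4) * `|u 0 i|].
  rewrite !lt_min => /and3P[u1 u2 u3].
  have ui := mx_norm_entry u 0 i.
  by split; [apply: Hd1|apply: Hd2|apply Hd3]; exact: le_lt_trans ui _.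
have [t1 t2 _] : [/\ sm d (c i (t 0 i)), sm e (c i (t 0 i)) & _] := mc t ltac:(lra).
have [t'1 _ _] : [/\ sm d (c i (t' 0 i)), sm e (c i (t' 0 i)) & _] := mc t' ltac:(lra).
have [u1 _ u3] := mc (t - t') tt'm.
split => //; have [_] := Hd _ _ t'1 u1.
have -> : (c i (t' 0%R i) * c i ((t - t') 0%R i))%g = c i (t 0 i).
  by rewrite -cD; congr (c i _); rewrite !mxE; ring.
have uD : `|(t - t') 0 i| <= `|t - t'| by exact: mx_norm_entry.
move: u3 uD; rewrite !mxE; set u := t 0 i - t' 0 i => u3 uD h.
have -> : lam (c i (t 0 i)) - lam (c i (t' 0 i)) - (t 0 i *: delta_mx 0 i - t' 0 i *: delta_mx 0 i)
  = (lam (c i (t 0 i)) - lam (c i (t' 0 i)) - lam (c i u)) + (lam (c i u) - u *: delta_mx 0 i).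
  by apply/rowP => j; rewrite !mxE /u; ring.
apply: le_trans (ler_normD _ _) _.
set m' := Num.min 1 _ in e4 h u3.
have m'e : m' <= e / 4 by rewrite ge_min lexx orbT.
have m'1 : m' <= 1 by rewrite ge_min lexx.
have lu : `|lam (c i u)| <= 2 * `|u|.
  have := ler_distD (u *: delta_mx 0 i) (lam (c i u)) 0; rewrite !subr0 normrZ.
  have : m' * `|u| <= 1 * `|u| by rewrite ler_wpM2r.
  have : `|u| * `|delta_mx 0 i : 'rV[R]_n| <= `|u| * 1 by rewrite ler_wpM2l.
  lra.
have : m' * `|lam (c i u)| <= e / 4 * (2 * `|u|) by rewrite ler_pM// ltW.
have : m' * `|u| <= e / 4 * `|u| by rewrite ler_wpM2r.
have : e * `|u| <= e * `|t - t'| by rewrite ler_pM2l.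
have : 0 <= e * `|u| by rewrite mulr_ge0// ltW.
lra.
Qed.

Lemma strict_psis s : exists K,
  strict (psis s) (fun t => \sum_(i <- s) t 0 i *: delta_mx 0 i) K.
Proof.
elim: s => [|i s [K IH]].
  exists 0; split => // [t t'|e e0]; first by rewrite !big_nil subrr normr0 mul0r.
  exists 1 => // t t' _ _; rewrite !big_nil !subrr normr0; split; first exact: sm1.
  by rewrite mulr_ge0// ltW.
exists (1 + K).
have -> : (fun t : 'rV[R]_n => \sum_(j <- i :: s) t 0 j *: delta_mx 0 j : 'rV[R]_n) =
    (fun t : 'rV[R]_n => t 0 i *: delta_mx 0 i + \sum_(j <- s) t 0 j *: delta_mx 0 j).
  by apply/funext => t; rewrite big_cons.
exact: strict_mul (strict_c i) IH.
Qed.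

Definition psi := psis (enum 'I_n).

Lemma sum_enum_delta (t : 'rV[R]_n) :
  \sum_(i <- enum 'I_n) t 0 i *: delta_mx 0 i = t.
Proof. by rewrite big_enum /= -row_sum_delta. Qed.

Lemma psi_strict (e : R) : 0 < e -> exists2 d : R, 0 < d &
  forall t t', `|t| < d -> `|t'| < d ->
    sm e (psi t) /\ `|lam (psi t) - lam (psi t') - (t - t')| <= e * `|t - t'|.
Proof.
have [K [_ _ h]] := strict_psis (enum 'I_n).
by move=> /h[d d0 Hd]; exists d => // t t' t1 t2; have := Hd _ _ t1 t2; rewrite !sum_enum_delta.
Qed.

Lemma psis0 s : psis s 0 = 1%g.
Proof.
by elim: s => //= i s ->; rewrite mulg1 mxE; exact: hom0 (cD i).
Qed.

Lemma psi0 : psi 0 = 1%g. Proof. exact: psis0. Qed.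

End SecondKind.

Section Adjoint.
Variables (R : realType) (n : nat) (T : groupType) (C : strict_chart R n T).
Local Notation dom := (dom C).
Local Notation lam := (lam C).
Local Notation sm := (sm C).
Implicit Types (g h x : T).

(** The rows of B are the images of basis vectors, which can be rescaled into any ball, and the norm
    is the largest entry. *)
Lemma mx_norm_le_local (B : 'M[R]_n) (e d : R) : 0 <= e -> 0 < d ->
  (forall v : 'rV[R]_n, `|v| < d -> `|v *m B| <= e * `|v|) -> `|B| <= e.
Proof.
move=> e0 d0 h; apply: mx_norm_le => // i j.
have dn : `|delta_mx 0 i : 'rV[R]_n| <= 1.
  by apply: mx_norm_le => // a b; rewrite mxE; case: (_ && _); rewrite ?normr0 ?normr1.
have d2 : 0 < d / 2 by rewrite divr_gt0.
have vd : `|(d / 2) *: delta_mx 0 i : 'rV[R]_n| < d.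
  rewrite normrZ (gtr0_norm d2).
  have : d / 2 * `|delta_mx 0 i : 'rV[R]_n| <= d / 2 * 1 by rewrite ler_pM2l.
  by lra.
have H := h _ vd; rewrite -scalemxAl -rowE normrZ (gtr0_norm d2) normrZ (gtr0_norm d2) in H.
rewrite mulrCA ler_pM2l// in H.
have := mx_norm_entry (row i B) 0 j; rewrite mxE => h1.
apply: le_trans h1 (le_trans H _); by rewrite ler_piMr.
Qed.

(* Row-vector convention: [Ad] is an antihomomorphism, see [AdM]. *)
Definition adP g (A : 'M[R]_n) := forall e : R, 0 < e -> exists2 d : R, 0 < d &
  forall x, sm d x -> `|lam (g * x * g^-1)%g - lam x *m A| <= e * `|lam x|.

(** [lam] takes all small values, so the two matrices agree on a ball up to arbitrarily small
    relative error. *)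
Lemma adP_unique g A B : adP g A -> adP g B -> A = B.
Proof.
move=> gA gB; apply/eqP; rewrite -subr_eq0 -normr_eq0 eq_le normr_ge0 andbT.
apply/ler_addgt0Pr => e e0; rewrite add0r.
have e2 : 0 < e / 2 by rewrite divr_gt0.
have [d1 d10 H1] := gA _ e2; have [d2 d20 H2] := gB _ e2; have [r r0 Hr] := lam_surj C.
apply: (@mx_norm_le_local _ _ (Num.min r (Num.min d1 d2))) => //; first exact: ltW.
  by rewrite !lt_min r0 d10.
move=> v; rewrite !lt_min => /and3P[vr v1 v2]; have [x dx xv] := Hr v vr.
rewrite -xv in v1 v2 *; have h1 := H1 x (conj dx v1); have h2 := H2 x (conj dx v2).
have -> : lam x *m (A - B) =
    (lam (g * x * g^-1)%g - lam x *m B) - (lam (g * x * g^-1)%g - lam x *m A).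
  by rewrite mulmxBr; apply/rowP => j; rewrite !mxE; ring.
by apply: le_trans (ler_normB _ _) _; lra.
Qed.

(** The default 0 never matters once the one-parameter subgroups are available, by [adP_ex]. *)
Definition Ad g : 'M[R]_n := xget 0 [set A | adP g A].

Lemma Ad_eq g A : adP g A -> Ad g = A.
Proof.
move=> gA; apply: (adP_unique (g := g)) => //.
exact: (@xgetPex _ 0 [set A | adP g A] (ex_intro _ A gA)).
Qed.

Variable c : 'I_n -> R -> T.
Hypothesis cD : forall i s t, c i (s + t) = (c i s * c i t)%g.
Hypothesis c_tder : forall i, tder C (c i) (fun t => t *: delta_mx 0 i).
Local Notation psi := (psi c).

(** [near_id_surj] applies to the composite of [lam] and [psi], whose derivative at 0 is the
    identity. The two inequalities allow passing between the two coordinate systems at first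
    order. *)
Lemma psi_surj (e : R) : 0 < e -> exists2 r : R, 0 < r & forall x, sm r x ->
  exists t, [/\ `|t| < e, psi t = x, `|lam x - t| <= e * `|t| & `|t| <= 2 * `|lam x|].
Proof.
move=> e0; pose e' := Num.min e (1 / 2).
have e'0 : 0 < e' by rewrite lt_min e0 divr_gt0.
have e'e : e' <= e by rewrite ge_min lexx.
have e'2 : e' <= 1 / 2 by rewrite ge_min lexx orbT.
have [d d0 Hd] := psi_strict cD c_tder e'0.
pose r := Num.min d e / 2; have r0 : 0 < r by rewrite divr_gt0// lt_min d0.
have rd : r < d by rewrite /r; have : Num.min d e <= d := ltac:(by rewrite ge_min lexx); lra.
have re : r < e by rewrite /r; have : Num.min d e <= e := ltac:(by rewrite ge_min lexx orbT); lra.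
exists (r / 2); first by rewrite divr_gt0.
move=> x [dx xr]; have [||t tr tx] := @near_id_surj R n (lam \o psi) 0 r r0 _ (lam x).
- move=> t t'; rewrite !subr0 => tr t'r /=.
  have [_ h] := Hd t t' (le_lt_trans tr rd) (le_lt_trans t'r rd).
  by apply: le_trans h _; rewrite ler_wpM2r.
- by rewrite /= psi0// lam1 subr0 ltW.
rewrite subr0 in tr; rewrite /= in tx.
have td := le_lt_trans tr rd.
have n0 : `|0 : 'rV[R]_n| < d by rewrite normr0.
have [[dt _]] := Hd t 0 td n0; rewrite psi0// lam1 !subr0 tx => h.
exists t; split.
- exact: le_lt_trans tr re.
- exact: (lam_inj (s := C)).
- by apply: le_trans h _; rewrite ler_wpM2r.
have : e' * `|t| <= 1 / 2 * `|t| by rewrite ler_wpM2r.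
by have := ler_distD (lam x) t 0; rewrite !subr0 distrC; lra.
Qed.

(** The velocities Y are fixed index by index before the induction on s, since they become the rows
    of one matrix. *)
Lemma tder_conj_psis g : exists Y : 'I_n -> 'rV[R]_n, forall s, exists K,
  tder C (fun t => g * psis c s t * g^-1)%g (fun t => \sum_(i <- s) t 0 i *: Y i) /\
  bounded_by (fun t : 'rV[R]_n => \sum_(i <- s) t 0 i *: Y i) K.
Proof.
have /choice[Y HY] : forall i, exists Y, tder C (fun t => g * c i t * g^-1)%g (fun t => t *: Y).
  move=> i; apply: hom_tder.
    by move=> s t; rewrite cD !mulgA mulgVK.
  move=> e e0; have [d d0 Hd] := conj_cont C g e0.
  have [r r0 Hr] := tder_sm (c_tder i) (bounded_scale _) d0.
  by exists r => // t /Hr /Hd.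
exists Y; elim => [|i s [K [IH1 IH2]]].
  exists 0; split; last by split => // h; rewrite big_nil normr0 mul0r.
  move=> e e0; have [d d0 Hd] := @tder1 _ _ _ C 'rV[R]_n e e0.
  by exists d => // t /Hd; rewrite big_nil /= mulg1 mulgV.
have b : bounded_by (fun t : 'rV[R]_n => t 0 i *: Y i) `|Y i|.
  by split => // h; rewrite normrZ mulrC ler_wpM2l// mx_norm_entry.
have t1 : tder C (fun t : 'rV[R]_n => g * c i (t 0%R i) * g^-1)%g (fun t => t 0 i *: Y i).
  by apply: (tder_comp (l := fun t : 'rV[R]_n => t 0 i) (HY i)) => h; exact: mx_norm_entry.
exists (`|Y i| + K).
have -> : (fun t : 'rV[R]_n => \sum_(j <- i :: s) t 0 j *: Y j) =
    (fun t : 'rV[R]_n => t 0 i *: Y i + \sum_(j <- s) t 0 j *: Y j).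
  by apply/funext => t; rewrite big_cons.
split; last first.
  case: b IH2 => [b0 b1] [K0 K1]; split; first exact: addr_ge0.
  by move=> h; apply: le_trans (ler_normD _ _) _; rewrite mulrDl lerD.
have := tder_mul t1 IH1 b IH2; congr tder.
by apply/funext => t /=; rewrite !mulgA mulgVK.
Qed.

(** g psi(t) g^-1 has derivative t A at 0, with the velocities Y_i as rows of A; replacing t by lam
    (psi t) costs only o(t). *)
Lemma adP_ex g : exists A, adP g A.
Proof.
have [Y HY] := tder_conj_psis g; have [K [tY _]] := HY (enum 'I_n).
pose A : 'M[R]_n := \matrix_(i, j) Y i 0 j; exists A => e e0.
have YA (t : 'rV[R]_n) : \sum_(i <- enum 'I_n) t 0 i *: Y i = t *m A.
  rewrite big_enum /= mulmx_sum_row; apply: eq_bigr => i _; congr (_ *: _).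
  by apply/rowP => j; rewrite !mxE.
have A1 : 0 < n%:R * `|A| + 1 by rewrite ltr_wpDl// mulr_ge0.
pose e' := e / 4 / (n%:R * `|A| + 1); have e'0 : 0 < e' by rewrite !divr_gt0.
have e4 : 0 < e / 4 by rewrite divr_gt0.
have [d d0 Hd] := tY _ e4.
have m0 : 0 < Num.min d e' by rewrite lt_min d0.
have [r r0 Hr] := psi_surj m0; exists r => // x /Hr[t [td <- xt tx]].
move: td; rewrite lt_min => /andP[/Hd[_ h] _]; rewrite -/psi YA in h.
have -> : lam (g * psi t * g^-1)%g - lam (psi t) *m A =
  (lam (g * psi t * g^-1)%g - t *m A) - (lam (psi t) - t) *m A.
  by rewrite mulmxBl; apply/rowP => j; rewrite !mxE; ring.
apply: le_trans (ler_normB _ _) _.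
have h2 : `|(lam (psi t) - t) *m A| <= e / 4 * `|t|.
  apply: le_trans (mx_norm_mul _ _) _.
  have : n%:R * `|lam (psi t) - t| * `|A| <= n%:R * (e' * `|t|) * `|A|.
    rewrite ler_wpM2r// ler_wpM2l//; apply: le_trans xt _.
    by rewrite ler_wpM2r// ge_min lexx orbT.
  move=> /le_trans; apply.
  have -> : n%:R * (e' * `|t|) * `|A| = e' * (n%:R * `|A|) * `|t| by ring.
  rewrite ler_wpM2r//.
  have : e' * (n%:R * `|A| + 1) = e / 4 by rewrite /e' divfK// lt0r_neq0.
  lra.
have : e * `|t| <= e * (2 * `|lam (psi t)|) by rewrite ler_pM2l.
lra.
Qed.

Lemma Ad_P g : adP g (Ad g).
Proof. by have [A gA] := adP_ex g; rewrite (Ad_eq gA). Qed.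

Lemma Ad1 : Ad 1%g = 1%:M.
Proof.
apply: Ad_eq => e e0; exists 1 => // x _.
by rewrite mul1g invg1 mulg1 mulmx1 subrr normr0 mulr_ge0// ltW.
Qed.

Lemma AdM g h : Ad (g * h)%g = Ad h *m Ad g.
Proof.
apply: Ad_eq => e e0.
have pos (A : 'M[R]_n) : exists2 k : R, 0 < k & n%:R * `|A| <= k.
  by exists (n%:R * `|A| + 1); rewrite ?lerDl// ltr_wpDl// mulr_ge0.
have [K K0 KA] := pos (Ad g); have [L L0 LA] := pos (Ad h).
have eK : 0 < Num.min 1 (e / 2 / K) by rewrite lt_min ltr01 !divr_gt0.
have eL : 0 < e / 2 / (L + 1) by rewrite !divr_gt0// addr_gt0.
have [d1 d10 H1] := Ad_P h eK; have [d2 d20 H2] := Ad_P g eL.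
have [d3 d30 H3] := conj_cont C h d20.
exists (Num.min d1 d3); first by rewrite lt_min d10.
move=> x xd; have h1 := H1 _ (sm_minl xd); have h2 := H2 _ (H3 _ (sm_minr xd)).
have -> : (g * h * x * (g * h)^-1)%g = (g * (h * x * h^-1) * g^-1)%g.
  by rewrite invgM !mulgA.
set y := (h * x * h^-1)%g in h1 h2 *.
have -> : lam (g * y * g^-1)%g - lam x *m (Ad h *m Ad g) =
   (lam (g * y * g^-1)%g - lam y *m Ad g) + (lam y - lam x *m Ad h) *m Ad g.
  by rewrite mulmxBl mulmxA; apply/rowP => j; rewrite !mxE; ring.
apply: le_trans (ler_normD _ _) _.
have h1' : `|lam y - lam x *m Ad h| <= `|lam x|.
  by apply: le_trans h1 _; rewrite ler_piMl// ge_min lexx.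
have l1 : `|lam y| <= (L + 1) * `|lam x|.
  rewrite -[lam y](subrK (lam x *m Ad h)) mulrDl mul1r addrC.
  apply: le_trans (ler_normD _ _) _; apply: lerD h1'.
  by apply: le_trans (mx_norm_mul _ _) _; rewrite mulrAC ler_wpM2r.
have l2 : e / 2 / (L + 1) * `|lam y| <= e / 2 * `|lam x|.
  by rewrite -mulrA ler_pM2l ?divr_gt0// ler_pdivrMl// addr_gt0.
have l3 : `|(lam y - lam x *m Ad h) *m Ad g| <= e / 2 * `|lam x|.
  apply: le_trans (mx_norm_mul _ _) _.
  have : n%:R * `|lam y - lam x *m Ad h| * `|Ad g| <= n%:R * (e / 2 / K * `|lam x|) * `|Ad g|.
    rewrite ler_wpM2r// ler_wpM2l//; apply: le_trans h1 _.
    by rewrite ler_wpM2r// ge_min lexx orbT.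
  move=> /le_trans; apply.
  have -> : n%:R * (e / 2 / K * `|lam x|) * `|Ad g| = e / 2 / K * (n%:R * `|Ad g|) * `|lam x|.
    by ring.
  rewrite ler_wpM2r//.
  have ek : e / 2 / K * (n%:R * `|Ad g|) <= e / 2 / K * K.
    by rewrite ler_pM2l// !divr_gt0.
  by apply: le_trans ek _; rewrite divfK// lt0r_neq0.
by apply: le_trans (lerD (le_trans h2 l2) l3) _; rewrite -mulrDl -splitr.
Qed.

(** Evaluate lam (g x) twice, as g times x and as (g x g^-1) times g. The term lam g cancels, so the
    coordinates of g x g^-1 and of x differ by a small multiple of their size. Smallness of g does
    not depend on x, whereas the range of x may depend on g. *)
Lemma Ad_near1 (e : R) : 0 < e -> exists2 d : R, 0 < d &
  forall g, sm d g -> `|Ad g - 1%:M| <= e.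
Proof.
(* The bound 1/2 gives |y| <= 3 |lam x| for y = lam (g x g^-1); with e / 8 the difference is then at
   most e / 2 |lam x|, and the other half is the error of [Ad_P]. *)
move=> e0; pose e' := Num.min (1 / 2) (e / 8).
have e'0 : 0 < e' by rewrite lt_min !divr_gt0.
have e'2 : e' <= 1 / 2 by rewrite ge_min lexx.
have e'8 : e' <= e / 8 by rewrite ge_min lexx orbT.
have [d1 d10 H1] := lam_mulr C e'0; have [d2 d20 H2] := lam_mull C e'0.
exists (Num.min d1 d2); first by rewrite lt_min d10.
move=> g gd; have e2 : 0 < e / 2 by rewrite divr_gt0.
have [d3 d30 H3] := Ad_P g e2; have [d4 d40 H4] := conj_cont C g d20.
have [r r0 Hr] := lam_surj C.
pose m := Num.min (Num.min r d1) (Num.min d3 d4).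
have m0 : 0 < m by rewrite !lt_min r0 d10 d30.
apply: (mx_norm_le_local (d := m)) => //; first exact: ltW.
move=> v; rewrite !lt_min => /andP[/andP[vr v1] /andP[v3 v4]].
have [x dx xv] := Hr v vr; rewrite -xv in v1 v3 v4 *.
have [_ h1] := H1 g x (sm_minl gd) (conj dx v1).
have [_ h2] := H2 _ g (H4 x (conj dx v4)) (sm_minr gd).
have h3 := H3 x (conj dx v3).
rewrite mulgVK in h2; set y := lam (g * x * g^-1)%g in h2 h3.
have -> : lam x *m (Ad g - 1%:M) = (y - lam x) - (y - lam x *m Ad g).
  by rewrite mulmxBr mulmx1; apply/rowP => j; rewrite !mxE; ring.
have h4 : `|y - lam x| <= e' * (`|lam x| + `|y|).
  have -> : y - lam x = (lam (g * x)%g - lam g - lam x) - (lam (g * x)%g - y - lam g).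
    by apply/rowP => j; rewrite !mxE; ring.
  by apply: le_trans (ler_normB _ _) _; lra.
have h5 : `|y| <= 3 * `|lam x|.
  have := ler_distD (lam x) y 0; rewrite !subr0.
  have : e' * (`|lam x| + `|y|) <= 1 / 2 * (`|lam x| + `|y|) by rewrite ler_wpM2r// addr_ge0.
  lra.
apply: le_trans (ler_normB _ _) _.
have : e' * (`|lam x| + `|y|) <= e / 8 * (`|lam x| + `|y|) by rewrite ler_wpM2r// addr_ge0.
have : e / 8 * `|y| <= e / 8 * (3 * `|lam x|) by rewrite ler_wpM2l// divr_ge0// ltW.
have : 0 <= e * `|lam x| by rewrite mulr_ge0// ltW.
lra.
Qed.

End Adjoint.

(** * Smooth functions *)

Section FrechetEpsilon.
Context {R : realType} {V W : normedModType R}.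
Implicit Types (f g : V -> W) (x v : V).

Definition fder f x (L : V -> W) := forall e : R, 0 < e -> exists2 d : R, 0 < d &
  forall h, `|h| < d -> `|f (x + h) - f x - L h| <= e * `|h|.

Lemma near0P (P : V -> Prop) :
  (\forall h \near 0, P h) <-> exists2 d : R, 0 < d & forall h, `|h| < d -> P h.
Proof.
split=> [/nbhs_ballP[d d0 Hd]|[d d0 Hd]].
  by exists d => // h hd; apply: Hd; rewrite -ball_normE /= sub0r normrN.
apply/nbhs_ballP; exists d => // h; rewrite -ball_normE /= sub0r normrN.
exact: Hd.
Qed.

Lemma fderE f x (L : V -> W) :
  fder f x L <-> f \o shift x = cst (f x) + L +o_ 0 id.
Proof.
have E k : (f \o shift x - (cst (f x) + L)) k = f (x + k) - f x - L k.
  by rewrite !fctE /= /shift opprD addrA [k + x]addrC.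
split=> [h|/eqaddoP h].
  apply/eqaddoP => e e0; apply/near0P; have [d d0 Hd] := h _ e0.
  by exists d => // k /Hd; rewrite E.
by move=> e e0; have /near0P[d d0 Hd] := h _ e0; exists d => // k /Hd; rewrite E.
Qed.

Lemma differentiable_fder f x : differentiable f x -> fder f x ('d f x).
Proof. by move=> /diff_locallyP[_ /fderE]. Qed.

Lemma fder_differentiable f x (L : V -> W) (K : R) : linear L ->
  (forall h, `|L h| <= K * `|h|) -> fder f x L ->
  differentiable f x /\ forall h, 'd f x h = L h.
Proof.
move=> linL LK /fderE fL.
pose L' : {linear V -> W} := HB.pack L (GRing.isLinear.Build R V W *:%R L linL).
have cL : continuous L'.
  apply: bounded_linear_continuous; apply/linear_boundedP.
  by apply: filterS (nbhs_pinfty_ge (num_real K)) => r Kr u; apply: le_trans (LK u) _;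
    rewrite ler_wpM2r.
have E : 'd f x = L' :> (V -> W) by exact: diff_unique.
split; last by move=> h; rewrite E.
by apply/diff_locallyP; rewrite E.
Qed.

Lemma diff_bounded f x : differentiable f x ->
  exists2 K : R, 0 < K & forall h, `|'d f x h| <= K * `|h|.
Proof. by move=> df; apply: linear_lipschitz; exact: diff_continuous. Qed.

Lemma near_eq_differentiable f g x : (\forall y \near x, f y = g y) ->
  differentiable f x -> differentiable g x.
Proof.
move=> fg df; have [K K0 HK] := diff_bounded df.
apply: (proj1 (fder_differentiable (K := K) (L := 'd f x) _ HK _)).
  exact: linearP.
move=> e e0; have [d d0 Hd] := differentiable_fder df e0.
have /nbhs_ballP[r r0 Hr] := fg; exists (Num.min d r); first by rewrite lt_min d0.
move=> h; rewrite lt_min => /andP[hd hr].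
rewrite -(Hr (x + h)); last by rewrite -ball_normE /= opprD addrA subrr sub0r normrN.
by rewrite -(nbhs_singleton fg); exact: Hd.
Qed.

End FrechetEpsilon.

Section Smooth.
Context {R : realType} {V : normedModType R}.
Variable Om : set V.
Hypothesis oOm : open Om.

(** Stronger than [smooth_on]: Frechet differentiability of all iterated derivatives gives the chain
    rule and continuity at once. *)
Definition Smooth (W : normedModType R) (f : V -> W) :=
  forall vs x, Om x -> differentiable (iterD vs f) x.

Lemma near_open (W : Type) (f g : V -> W) x : (forall y, Om y -> f y = g y) -> Om x ->
  \forall y \near x, f y = g y.
Proof. by move=> fg xO; apply: filterS (open_nbhs_nbhs (conj oOm xO)) => y /fg. Qed.

(** A coinduction principle: a class of differentiable functions that is stable under directional
    derivatives, up to equality on the open set [Om], consists of smooth functions. *)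
Lemma Smooth_family (W : normedModType R) (P : (V -> W) -> Prop) :
  (forall f, P f -> forall x, Om x -> differentiable f x) ->
  (forall f v, P f -> exists2 g, P g & forall x, Om x -> 'D_v f x = g x) ->
  forall f, P f -> Smooth f.
Proof.
move=> Pd PD f Pf vs.
have [g Pg fg] : exists2 g, P g & forall x, Om x -> iterD vs f x = g x.
  elim: vs => [|v vs [g Pg fg]]; first by exists f.
  have [g' Pg' gg'] := PD g v Pg; exists g' => // x xO.
  by rewrite -gg'//=; apply: near_eq_derive; exact: near_open.
move=> x xO; apply: near_eq_differentiable (Pd _ Pg x xO).
by apply: near_open => // y yO; rewrite fg.
Qed.

Lemma iterD_rcons (W : normedModType R) vs v (f : V -> W) :
  iterD (rcons vs v) f = iterD vs ('D_v f).
Proof. by elim: vs => //= a vs ->. Qed.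

Lemma Smooth_derive (W : normedModType R) (f : V -> W) v : Smooth f -> Smooth ('D_v f).
Proof. by move=> sf vs x xO; rewrite -iterD_rcons; exact: sf. Qed.

Lemma Smooth_diff (W : normedModType R) (f : V -> W) : Smooth f ->
  forall x, Om x -> differentiable f x.
Proof. by move=> sf x xO; exact: (sf [::] x xO). Qed.

Lemma Smooth_smooth_on (W : normedModType R) (f : V -> W) : Smooth f -> smooth_on Om f.
Proof.
move=> sf vs; split; last by move=> v x xO; apply: diff_derivable; exact: sf.
apply/subspace_continuousP => x xO; apply: cvg_within_filter.
exact: (differentiable_continuous (sf vs x xO)).
Qed.

(** The polynomial expressions in the members of G. *)
Inductive alg (G : (V -> R) -> Prop) : (V -> R) -> Prop :=
| alg_gen f : G f -> alg G f
| alg_cst a : alg G (cst a)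
| alg_add f g : alg G f -> alg G g -> alg G (f + g)
| alg_mul f g : alg G f -> alg G g -> alg G (f * g).

(* Up-to principle: the derivatives of the generators may use products, sums and functions
   already known to be smooth. *)
Lemma alg_Smooth (G : (V -> R) -> Prop) :
  (forall f, G f -> forall x, Om x -> differentiable f x) ->
  (forall f v, G f -> exists2 g, alg (fun f => G f \/ Smooth f) g &
     forall x, Om x -> 'D_v f x = g x) ->
  forall f, alg (fun f => G f \/ Smooth f) f -> Smooth f.
Proof.
move=> Gd GD.
have algd f : alg (fun f => G f \/ Smooth f) f -> forall x, Om x -> differentiable f x.
  elim=> {f} [f [Gf|sf]|a|f g _ IHf _ IHg|f g _ IHf _ IHg] x xO.
  - exact: Gd.
  - exact: Smooth_diff.
  - exact: differentiable_cst.
  - by apply: differentiableD; [exact: IHf|exact: IHg].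
  - by apply: differentiableM; [exact: IHf|exact: IHg].
apply: Smooth_family; first exact: algd.
move=> f v; elim=> {f} [f [Gf|sf]|a|f g af [f' af' ff'] ag [g' ag' gg']|
  f g af [f' af' ff'] ag [g' ag' gg']].
- exact: GD.
- by exists ('D_v f) => //; apply: alg_gen; right; exact: Smooth_derive.
- by exists (cst 0); [exact: alg_cst|move=> x _; rewrite derive_cst].
- exists (f' + g'); first exact: alg_add.
  move=> x xO; rewrite deriveD; last 2 first.
  + exact: diff_derivable (algd _ af x xO).
  + exact: diff_derivable (algd _ ag x xO).
  by rewrite ff'// gg'.
- exists (f * g' + g * f'); first by apply: alg_add; exact: alg_mul.
  move=> x xO; rewrite deriveM; last 2 first.
  + exact: diff_derivable (algd _ af x xO).
  + exact: diff_derivable (algd _ ag x xO).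
  by rewrite ff'// gg'.
Qed.

Lemma alg0_Smooth (f : V -> R) : alg (fun f => False \/ Smooth f) f -> Smooth f.
Proof. exact: alg_Smooth. Qed.

Lemma Smooth_cst a : Smooth (cst a : V -> R).
Proof. by apply: alg0_Smooth; exact: alg_cst. Qed.

Lemma SmoothD (f g : V -> R) : Smooth f -> Smooth g -> Smooth (f + g).
Proof. by move=> sf sg; apply: alg0_Smooth; apply: alg_add; apply: alg_gen; right. Qed.

Lemma SmoothM (f g : V -> R) : Smooth f -> Smooth g -> Smooth (f * g).
Proof. by move=> sf sg; apply: alg0_Smooth; apply: alg_mul; apply: alg_gen; right. Qed.

Lemma Smooth_ext (f g : V -> R) : (forall x, Om x -> f x = g x) -> Smooth f -> Smooth g.
Proof.
move=> fg sf; apply: (@Smooth_family R (fun h => Smooth h \/ h = g)); last by right.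
  move=> h [sh|->] x xO; first exact: Smooth_diff.
  by apply: near_eq_differentiable (Smooth_diff sf xO); exact: near_open.
move=> h v [sh|->]; first by exists ('D_v h) => //; left; exact: Smooth_derive.
exists ('D_v f); first by left; exact: Smooth_derive.
by move=> x xO; apply/esym/near_eq_derive; exact: near_open.
Qed.

Lemma Smooth_sum (I : Type) (r : seq I) (P : pred I) (f : I -> V -> R) :
  (forall i, Smooth (f i)) -> Smooth (fun x => \sum_(i <- r | P i) f i x).
Proof.
move=> sf; elim: r => [|i r IH].
  by rewrite (_ : (fun _ => _) = cst 0); [exact: Smooth_cst|apply/funext => x; rewrite big_nil].
rewrite (_ : (fun _ => _) =
  (fun x => (if P i then f i x else 0) + \sum_(j <- r | P j) f j x)).
  by apply: SmoothD => //; case: (P i) => //; exact: Smooth_cst.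
by apply/funext => x; rewrite big_cons; case: ifP; rewrite ?add0r.
Qed.

Lemma Smooth_prod (I : Type) (r : seq I) (P : pred I) (f : I -> V -> R) :
  (forall i, Smooth (f i)) -> Smooth (fun x => \prod_(i <- r | P i) f i x).
Proof.
move=> sf; elim: r => [|i r IH].
  by rewrite (_ : (fun _ => _) = cst 1); [exact: Smooth_cst|apply/funext => x; rewrite big_nil].
rewrite (_ : (fun _ => _) =
  (fun x => (if P i then f i x else 1) * \prod_(j <- r | P j) f j x)).
  by apply: SmoothM => //; case: (P i) => //; exact: Smooth_cst.
by apply/funext => x; rewrite big_cons; case: ifP; rewrite ?mul1r.
Qed.

(** The derivative of 1/f is - (1/f)^2 f', a polynomial in 1/f itself and a smooth function, so the
    up-to principle applies with the single generator 1/f. *)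
Lemma Smooth_inv (f : V -> R) : (forall x, Om x -> f x != 0) -> Smooth f ->
  Smooth (fun x => (f x)^-1).
Proof.
move=> f0 sf; apply: (@alg_Smooth (fun g => g = fun x => (f x)^-1)).
- by move=> g -> x xO; apply: differentiableV; [exact: Smooth_diff|exact: f0].
- move=> g v ->; exists ((cst (-1) * ((fun x => (f x)^-1) * (fun x => (f x)^-1))) * 'D_v f).
    by do ![apply: alg_mul|apply: alg_cst|by apply: alg_gen; left];
      apply: alg_gen; right; exact: Smooth_derive.
  move=> x xO; rewrite (@deriveV _ _ f)//; last 2 first.
    exact: f0.
    exact: diff_derivable (Smooth_diff sf xO).
  rewrite /= !fctE /= expr2 invfM mulN1r //.
by apply: alg_gen; left.
Qed.

Definition mxSmooth m k (A : V -> 'M[R]_(m, k)) := forall i j, Smooth (fun x => A x i j).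

Lemma mxSmooth_mul m k p (A : V -> 'M[R]_(m, k)) (B : V -> 'M[R]_(k, p)) :
  mxSmooth A -> mxSmooth B -> mxSmooth (fun x => A x *m B x).
Proof.
move=> sA sB i j; apply: (Smooth_ext (f := fun x => \sum_l (A x i l * B x l j))).
  by move=> x _; rewrite mxE.
by apply: Smooth_sum => l; apply: SmoothM.
Qed.

Lemma mxSmoothD m k (A B : V -> 'M[R]_(m, k)) :
  mxSmooth A -> mxSmooth B -> mxSmooth (fun x => A x + B x).
Proof.
move=> sA sB i j; apply: (Smooth_ext (f := (fun x => A x i j) + (fun x => B x i j))).
  by move=> x _; rewrite mxE.
exact: SmoothD.
Qed.

Lemma mxSmoothN m k (A : V -> 'M[R]_(m, k)) : mxSmooth A -> mxSmooth (fun x => - A x).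
Proof.
move=> sA i j; apply: (Smooth_ext (f := cst (-1) * (fun x => A x i j))).
  by move=> x _; rewrite mxE fctE mulN1r.
by apply: SmoothM; [exact: Smooth_cst|exact: sA].
Qed.

Lemma mxSmooth_cst m k (A : 'M[R]_(m, k)) : mxSmooth (fun=> A).
Proof. by move=> i j; exact: Smooth_cst. Qed.

Lemma Smooth_det n (A : V -> 'M[R]_n) : mxSmooth A -> Smooth (fun x => \det (A x)).
Proof.
move=> sA; apply: Smooth_sum => s; apply: SmoothM; first exact: Smooth_cst.
by apply: Smooth_prod => i; exact: sA.
Qed.

(** Cramer's rule writes each entry of the inverse as a cofactor divided by the determinant. *)
Lemma mxSmooth_inv n (A : V -> 'M[R]_n) : (forall x, Om x -> A x \in unitmx) ->
  mxSmooth A -> mxSmooth (fun x => invmx (A x)).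
Proof.
move=> uA sA i j.
apply: (Smooth_ext (f := (fun x => (\det (A x))^-1) * (fun x => cofactor (A x) j i))).
  by move=> x xO; rewrite /invmx uA// !mxE.
apply: SmoothM.
  apply: Smooth_inv; last exact: Smooth_det.
  by move=> x /uA; rewrite unitmxE unitfE.
apply: SmoothM; first exact: Smooth_cst.
apply: Smooth_det => a b; apply: (Smooth_ext (f := fun x => A x (lift j a) (lift i b))) => //.
by move=> x _; rewrite !mxE.
Qed.

End Smooth.

(** * Vector-valued maps and bootstrapping *)

Section SmoothVec.
Context {R : realType} {V : normedModType R}.
Variable Om : set V.
Hypothesis oOm : open Om.

Lemma fder_rV m (f : V -> 'rV[R]_m) x (L : V -> 'rV[R]_m) :
  (forall j, fder (fun y => f y 0 j) x (fun h => L h 0 j)) -> fder f x L.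
Proof.
move=> fL e e0; have /choice[d Hd] : forall j, exists d : R, 0 < d /\ forall h, `|h| < d ->
    `|f (x + h) 0 j - f x 0 j - L h 0 j| <= e * `|h|.
  by move=> j; have [d d0 Hd] := fL j e e0; exists d.
exists (\big[Num.min/1]_j d j).
  by elim/big_ind: _ => // [a b a0 b0|j _]; [rewrite lt_min a0|case: (Hd j)].
move=> h hd; apply: mx_norm_le; first by rewrite mulr_ge0// ltW.
move=> i j; rewrite ord1 !mxE; apply: (proj2 (Hd j)); apply: lt_le_trans hd _.
by rewrite (bigD1 j)//= ge_min lexx.
Qed.

Lemma differentiable_rV m (f : V -> 'rV[R]_m) x :
  (forall j, differentiable (fun y => f y 0 j) x) -> differentiable f x.
Proof.
move=> df; pose L h : 'rV[R]_m := \row_j 'd (fun y => f y 0 j) x h.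
have /choice[K HK] : forall j, exists K : R, 0 <= K /\
    forall h, `|'d (fun y => f y 0 j) x h| <= K * `|h|.
  by move=> j; have [K K0 HK] := diff_bounded (df j); exists K; rewrite ltW.
apply: (proj1 (fder_differentiable (L := L) (K := \sum_j K j) _ _ _)).
- by move=> a u v; apply/rowP => j; rewrite !mxE linearP.
- have K0 : 0 <= \sum_j K j by apply: sumr_ge0 => j _; case: (HK j).
  move=> h; apply: mx_norm_le; first by rewrite mulr_ge0.
  move=> i j; rewrite ord1 mxE; apply: le_trans (proj2 (HK j) h) _.
  rewrite ler_wpM2r// (bigD1 j)//= lerDl sumr_ge0// => k _.
  by case: (HK k).
- apply: fder_rV => j e e0; have [d d0 Hd] := differentiable_fder (df j) e0.
  by exists d => // h /Hd; rewrite !mxE.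
Qed.

Lemma derive_coordrV m (f : V -> 'rV[R]_m) x v j :
  differentiable f x -> 'D_v (fun y => f y 0 j) x = ('D_v f x) 0 j.
Proof. by move=> df; rewrite derive_mx ?mxE//; exact: diff_derivable. Qed.

Lemma Smooth_rV m (f : V -> 'rV[R]_m) : mxSmooth Om f -> Smooth Om f.
Proof.
have dP (g : V -> 'rV[R]_m) : mxSmooth Om g -> forall x, Om x -> differentiable g x.
  by move=> sg x xO; apply: differentiable_rV => j; exact: Smooth_diff (sg 0 j) _ xO.
apply: (Smooth_family oOm) => // g v sg; exists ('D_v g) => // i j.
rewrite ord1; apply: (Smooth_ext oOm (f := 'D_v (fun x => g x 0 j))).
  by move=> x xO; rewrite derive_coordrV//; exact: dP.
exact: Smooth_derive.
Qed.

Lemma Smooth_lin (f : V -> R) (K : R) : linear f -> (forall h, `|f h| <= K * `|h|) ->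
  Smooth Om f.
Proof.
move=> linf fK.
have fd x : differentiable f x /\ forall h, 'd f x h = f h.
  apply: fder_differentiable => // e e0; exists 1 => // h _.
  have fD : f (x + h) = f x + f h by have := linf 1 x h; rewrite !scale1r.
  by rewrite fD (addrC (f x)) addrK subrr normr0 mulr_ge0// ltW.
apply: (Smooth_family oOm (P := fun g => g = f \/ exists a, g = cst a)); last by left.
  move=> g [->|[a ->]] x _; first by case: (fd x).
  exact: differentiable_cst.
move=> g v [->|[a ->]].
  exists (cst (f v)); first by right; exists (f v).
  by move=> x _; have [fx fxv] := fd x; rewrite deriveE.
by exists (cst 0); [right; exists 0|move=> x _; rewrite derive_cst].
Qed.

(* If [Du] factors through [u] itself via functions smooth downstairs, differentiability of [u]
   bootstraps to smoothness. *)
Lemma Smooth_bootstrap m p (U : set 'rV[R]_m) (u : V -> 'rV[R]_m)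
    (N : 'rV[R]_m -> 'M[R]_(p, m)) (l : V -> V -> 'rV[R]_p) :
  (forall x, Om x -> U (u x)) -> mxSmooth U N -> (forall v, mxSmooth Om (l v)) ->
  (forall x, Om x -> differentiable u x) ->
  (forall x v, Om x -> 'd u x v = l v x *m N (u x)) ->
  forall g : 'rV[R]_m -> R, Smooth U g -> Smooth Om (g \o u).
Proof.
move=> uU sN sl ud uD g sg.
apply: (alg_Smooth oOm (G := fun f => exists2 g : 'rV[R]_m -> R, Smooth U g & f = g \o u)); last 1 first.
  by apply: alg_gen; left; exists g.
  move=> f [h sh ->] x xO; apply: differentiable_comp; first exact: ud.
  have := Smooth_diff sh (uU _ xO); exact.
move=> f v [h sh ->].
  pose G (f : V -> R) := (exists2 g : 'rV[R]_m -> R, Smooth U g & f = g \o u) \/ Smooth Om f.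
  have sumG (I : finType) (F : I -> V -> R) : (forall i : I, alg G (F i)) ->
      alg G (fun x => \sum_i F i x).
    move=> aF; elim: (index_enum I) => [|i r IH].
      by rewrite (_ : (fun _ => _) = cst 0); [exact: alg_cst|apply/funext => x; rewrite big_nil].
    rewrite (_ : (fun _ => _) = F i + (fun x => \sum_(j <- r) F j x)); first exact: alg_add.
    by apply/funext => x; rewrite big_cons.
  (* The chain rule in coordinates. Every factor is either smooth on [Om] or a smooth function
     composed with u, so the derivative stays in the generated algebra. *)
  exists (fun x => \sum_j ((\sum_k l v x 0 k * N (u x) k j) * 'D_(delta_mx 0 j) h (u x))).
    apply: (sumG _ (fun j x => _)) => j; apply: alg_mul.
      apply: (sumG _ (fun k x => _)) => k; apply: alg_mul; apply: alg_gen.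
        by right; exact: sl.
      by left; exists (fun y => N y k j).
    by apply: alg_gen; left; exists ('D_(delta_mx 0 j) h) => //; exact: Smooth_derive.
  move=> x xO; have hd := Smooth_diff sh (uU _ xO); have ux := ud x xO.
  rewrite deriveE; last exact: differentiable_comp.
  rewrite diff_comp//= uD// [X in 'd h _ X]row_sum_delta linear_sum.
  by apply: eq_bigr => j _; rewrite linearZ /= deriveE//= mxE.
Qed.

End SmoothVec.

(** * Logarithmic derivatives *)

Section LogDerivative.
Variables (R : realType) (n : nat) (T : groupType) (C : strict_chart R n T).
Local Notation dom := (dom C).
Local Notation lam := (lam C).
Local Notation sm := (sm C).
Local Notation Ad := (Ad C).
Variable c : 'I_n -> R -> T.
Hypothesis cD : forall i s t, c i (s + t) = (c i s * c i t)%g.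
Hypothesis c_tder : forall i, tder C (c i) (fun t => t *: delta_mx 0 i).
Local Notation psi := (psi c).
Local Notation psis := (psis c).
Let AdM g h : Ad (g * h)%g = Ad h *m Ad g := AdM cD c_tder g h.

(** The sign is that of psi^-1, whose adjoint enters the logarithmic derivative. *)
Definition Adc i (s : R) : 'M[R]_n := Ad (c i (- s)).

Lemma AdcD i s t : Adc i (s + t) = Adc i s *m Adc i t.
Proof. by rewrite /Adc -AdM -cD; congr (Ad (c i _)); ring. Qed.

(** The additivity defect of Adc - 1 is the product (Adc s - 1)(Adc t - 1), so this map is
    quasi-additive and differentiable at 0; the homomorphism property carries the derivative to
    every s. *)
Lemma Adc_der i : exists K : 'M[R]_n, forall s (e : R), 0 < e -> exists2 d : R, 0 < d &
  forall h, `|h| < d -> `|Adc i (s + h) - Adc i s - h *: (Adc i s *m K)| <= e * `|h|.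
Proof.
have small (e : R) : 0 < e -> exists2 d : R, 0 < d &
    forall t, `|t| < d -> `|Adc i t - 1%:M| <= e.
  move=> e0; have [d d0 Hd] := Ad_near1 cD c_tder e0.
  have [r r0 Hr] := tder_sm (c_tder i) (bounded_scale _) d0.
  by exists r => // t tr; apply/Hd/Hr; rewrite normrN.
have [||K HK] := @quasi_additive_derivable _ _ _ (fun s => Adc i s - 1%:M).
- move=> e e0; have n1 : 0 < n%:R + 1 :> R by rewrite ltr_wpDl.
  have [|d d0 Hd] := small (e / (n%:R + 1)); first by rewrite divr_gt0.
  exists d => // s t sd td.
  have -> : Adc i (s + t) - 1%:M - (Adc i s - 1%:M) - (Adc i t - 1%:M) =
      (Adc i s - 1%:M) *m (Adc i t - 1%:M).
    rewrite AdcD mulmxBl !mulmxBr !mulmx1 !mul1mx.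
    by apply/matrixP => a b; rewrite !mxE; ring.
  apply: le_trans (mx_norm_mul _ _) _; rewrite ler_wpM2r//.
  have := Hd _ sd; rewrite ler_pdivlMr// => h; apply: le_trans h.
  by rewrite mulrC ler_wpM2l// lerDl.
- exact: small.
exists K => s e e0; pose k := n%:R * `|Adc i s| + 1.
have k0 : 0 < k by rewrite ltr_wpDl// mulr_ge0.
have [|d d0 Hd] := HK (e / k); first by rewrite divr_gt0.
exists d => // h hd.
have -> : Adc i (s + h) - Adc i s - h *: (Adc i s *m K) =
    Adc i s *m (Adc i h - 1%:M - h *: K).
  by rewrite AdcD !mulmxBr mulmx1 -scalemxAr.
apply: le_trans (mx_norm_mul _ _) _.
apply: le_trans (ler_wpM2l _ (Hd _ hd)) _; first by rewrite mulr_ge0.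
rewrite mulrA ler_wpM2r// mulrA ler_pdivrMr// mulrC ler_wpM2l//; first exact: ltW.
by rewrite lerDl.
Qed.

Section SmoothAd.
Context {V : normedModType R}.
Variable Om : set V.
Hypothesis oOm : open Om.

(** By the linear equation Adc' = Adc K, derivatives of entries are linear combinations of entries,
    so the entries generate an algebra closed under differentiation. *)
Lemma Adc_Smooth i (l : V -> R) : linear l -> (forall h, `|l h| <= `|h|) ->
  mxSmooth Om (fun x => Adc i (l x)).
Proof.
move=> linl lh; have [K HK] := Adc_der i; move=> a b.
have lD x h : l (x + h) = l x + l h by have := linl 1 x h; rewrite !scale1r.
pose L x a b h := l h * (Adc i (l x) *m K) a b.
have fd x a' b' : differentiable (fun x => Adc i (l x) a' b') x /\
    forall h, 'd (fun x => Adc i (l x) a' b') x h = L x a' b' h.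
  apply: (fder_differentiable (K := `|(Adc i (l x) *m K) a' b'|)).
  - by move=> r u v; rewrite /L linl mulrDl -mulrA.
  - by move=> h; rewrite /L normrM mulrC ler_wpM2l.
  - move=> e e0; have [d d0 Hd] := HK (l x) _ e0; exists d => // h hd.
    have := Hd (l h) (le_lt_trans (lh h) hd).
    have := mx_norm_entry (Adc i (l x + l h) - Adc i (l x) - l h *: (Adc i (l x) *m K)) a' b'.
    rewrite lD => h1 h2.
    apply: le_trans (le_trans h2 _); last by rewrite ler_pM2l.
    by move: h1; rewrite /L; move: (Adc i (l x) *m K) => M; rewrite !mxE.
apply: (alg_Smooth oOm (G := fun f => exists a b, f = fun x => Adc i (l x) a b)).
- by move=> f [a' [b' ->]] x _; case: (fd x a' b').
- move=> f v [a' [b' ->]].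
  exists (fun x => \sum_k (l v * K k b') * Adc i (l x) a' k).
    elim: (index_enum _) => [|k r IH].
      by rewrite (_ : (fun _ => _) = cst 0); [exact: alg_cst|apply/funext => x; rewrite big_nil].
    rewrite (_ : (fun _ => _) = cst (l v * K k b') * (fun x => Adc i (l x) a' k) +
      (fun x => \sum_(j <- r) (l v * K j b') * Adc i (l x) a' j)).
      apply: alg_add => //; apply: alg_mul; first exact: alg_cst.
      by apply: alg_gen; left; exists a', k.
    by apply/funext => x; rewrite big_cons.
  move=> x _; have [fx fxv] := fd x a' b'; rewrite deriveE// fxv /L mxE big_distrr /=.
  by apply: eq_bigr => k _; ring.
by apply: alg_gen; left; exists a, b.
Qed.

(** Covers the identity and the two projections of a pair, so that one set of lemmas serves chart
    changes, inversion and multiplication. *)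
Definition lin1 (tau : V -> 'rV[R]_n) := linear tau /\ forall h, `|tau h| <= `|h|.

Lemma lin1_coord tau i : lin1 tau -> linear (fun x => tau x 0 i) /\
  forall h, `|tau h 0 i| <= `|h|.
Proof.
move=> [tl th]; split; last by move=> h; apply: le_trans (mx_norm_entry _ _ _) (th h).
by move=> a u v; rewrite tl !mxE.
Qed.

Lemma Ad_psis_Smooth s tau : lin1 tau -> mxSmooth Om (fun x => Ad (psis s (tau x))^-1%g).
Proof.
move=> tl; elim: s => [|i s IH] /=.
  by rewrite (_ : (fun _ => _) = fun=> Ad 1%g); [exact: mxSmooth_cst|
    apply/funext => x; rewrite invg1].
rewrite (_ : (fun _ => _) = fun x => Adc i (tau x 0 i) *m Ad (psis s (tau x))^-1%g).
  by apply: mxSmooth_mul => //; have [] := lin1_coord i tl; exact: Adc_Smooth.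
by apply/funext => x; rewrite invgM AdM /Adc (homN (cD i)).
Qed.

(* The Maurer-Cartan form of [psis s] in coordinates: psis s t^-1 d(psis s) = dt *m MC s t. *)
Fixpoint MC (s : seq 'I_n) (t : 'rV[R]_n) : 'M[R]_n :=
  if s is i :: s' then delta_mx i i *m Ad (psis s' t)^-1%g + MC s' t else 0.

Lemma MC_Smooth s tau : lin1 tau -> mxSmooth Om (fun x => MC s (tau x)).
Proof.
move=> tl; elim: s => [|i s IH] /=; first exact: mxSmooth_cst.
apply: mxSmoothD => //; apply: mxSmooth_mul => //; first exact: mxSmooth_cst.
exact: Ad_psis_Smooth.
Qed.

End SmoothAd.

Lemma lin1_id : lin1 (id : 'rV[R]_n -> 'rV[R]_n).
Proof. by split. Qed.

Lemma lin1_fst : lin1 (fst : 'rV[R]_n * 'rV[R]_n -> 'rV[R]_n).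
Proof. by split => // h; rewrite prod_normE le_max lexx. Qed.

Lemma lin1_snd : lin1 (snd : 'rV[R]_n * 'rV[R]_n -> 'rV[R]_n).
Proof. by split => // h; rewrite prod_normE le_max lexx orbT. Qed.

(** The left logarithmic derivative F^-1 dF at x. *)
Definition LD (V : normedModType R) (F : V -> T) (x : V) (L : V -> 'rV[R]_n) :=
  [/\ tder C (fun h => (F x)^-1 * F (x + h)%R)%g L, linear L & exists K, bounded_by L K].

Lemma bounded_mulmx (V : normedModType R) (L : V -> 'rV[R]_n) K (A : 'M[R]_n) :
  bounded_by L K -> bounded_by (fun h => L h *m A) (n%:R * K * `|A|).
Proof.
move=> [K0 LK]; split; first by rewrite !mulr_ge0.
move=> h; apply: le_trans (mx_norm_mul _ _) _.
have -> : n%:R * K * `|A| * `|h| = n%:R * (K * `|h|) * `|A| by ring.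
by rewrite ler_wpM2r// ler_wpM2l.
Qed.

Lemma tder_conj (V : normedModType R) (F : V -> T) L K g :
  tder C F L -> bounded_by L K -> tder C (fun h => g * F h * g^-1)%g (fun h => L h *m Ad g).
Proof.
move=> FL LK e e0; have K0 : 0 <= K by case: LK.
pose a := n%:R * `|Ad g| + 1; have a0 : 0 < a by rewrite ltr_wpDl// mulr_ge0.
have K1 : 0 < K + 1 by rewrite ltr_wpDl.
have [d1 d10 H1] := Ad_P cD c_tder g (e := e / 2 / (K + 1)) ltac:(by rewrite !divr_gt0).
have [d2 d20 H2] := FL (e / 2 / a) ltac:(by rewrite !divr_gt0).
have [d3 d30 H3] := tder_bound FL LK.
have [d4 d40 H4] := tder_sm FL LK d10.
have [d5 d50 H5] := conj_cont C g ltr01; have [d6 d60 H6] := tder_sm FL LK d50.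
exists (Num.min (Num.min d2 d3) (Num.min d4 d6)); first by rewrite !lt_min d20 d30 d40.
move=> h; rewrite !lt_min => /andP[/andP[/H2[_ h2] /H3[_ h3]] /andP[/H4/H1 h4 /H6/H5[h6 _]]].
split => //.
have -> : lam (g * F h * g^-1)%g - L h *m Ad g =
  (lam (g * F h * g^-1)%g - lam (F h) *m Ad g) + (lam (F h) - L h) *m Ad g.
  by rewrite mulmxBl; apply/rowP => j; rewrite !mxE; ring.
apply: le_trans (ler_normD _ _) _.
have m1 : e / 2 / (K + 1) * `|lam (F h)| <= e / 2 * `|h|.
  by rewrite -mulrA ler_pM2l ?divr_gt0// ler_pdivrMl.
have m2 : `|(lam (F h) - L h) *m Ad g| <= e / 2 * `|h|.
  apply: le_trans (mx_norm_mul _ _) _.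
  have : n%:R * `|lam (F h) - L h| * `|Ad g| <= n%:R * (e / 2 / a * `|h|) * `|Ad g|.
    by rewrite ler_wpM2r// ler_wpM2l.
  move=> /le_trans; apply.
  have -> : n%:R * (e / 2 / a * `|h|) * `|Ad g| = e / 2 / a * (n%:R * `|Ad g|) * `|h| by ring.
  rewrite ler_wpM2r//.
  have : e / 2 / a * a = e / 2 by rewrite divfK// lt0r_neq0.
  have : 0 < e / 2 / a by rewrite !divr_gt0.
  by rewrite {3}/a mulrDr; lra.
lra.
Qed.

(** The increment of F G at x is the increment of F conjugated by G(x)^-1, times the increment of
    G. *)
Lemma LD_mul (V : normedModType R) (F G : V -> T) x L M : LD F x L -> LD G x M ->
  LD (fun y => F y * G y)%g x (fun h => L h *m Ad (G x)^-1%g + M h).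
Proof.
move=> [FL linL [K LK]] [GM linM [K' MK]].
have LK' := bounded_mulmx (Ad (G x)^-1%g) LK.
split.
- have := tder_mul (tder_conj (G x)^-1%g FL LK) GM LK' MK; congr tder.
  by apply/funext => h; rewrite invgM invgK !mulgA mulgK.
- move=> a u v; rewrite linL linM mulmxDl -scalemxAl scalerDr.
  by apply/rowP => j; rewrite !mxE; ring.
- exists (n%:R * K * `|Ad (G x)^-1%g| + K').
  case: LK' MK => [a1 a2] [b1 b2]; split; first exact: addr_ge0.
  by move=> h; apply: le_trans (ler_normD _ _) _; rewrite mulrDl lerD.
Qed.

Lemma LD_cst (V : normedModType R) g (x : V) : LD (fun=> g) x (fun=> 0).
Proof.
split; last by exists 0; split => // h; rewrite normr0 mul0r.
  by have := @tder1 _ _ _ C V; congr tder; apply/funext => h; rewrite mulVg.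
by move=> a u v; rewrite scaler0 addr0.
Qed.

Lemma LD_mull (V : normedModType R) g (F : V -> T) x L :
  LD F x L -> LD (fun y => g * F y)%g x L.
Proof.
move=> [FL linL LK]; split => //; move: FL; congr tder.
by apply/funext => h; rewrite invgM -mulgA mulKg.
Qed.

(** F(x) F(x+h)^-1 is the inverse of the increment of F conjugated by F(x). *)
Lemma LD_inv (V : normedModType R) (F : V -> T) x L :
  LD F x L -> LD (fun y => (F y)^-1)%g x (fun h => - (L h *m Ad (F x))).
Proof.
move=> [FL linL [K LK]]; have LK' := bounded_mulmx (Ad (F x)) LK.
split.
- have := tder_inv (tder_conj (F x) FL LK) LK'; congr tder.
  by apply/funext => h; rewrite mulVKg invgM !invgK.
- by move=> a u v; rewrite linL mulmxDl -scalemxAl opprD scalerN.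
- exists (n%:R * K * `|Ad (F x)|); case: LK' => a1 a2; split => // h.
  by rewrite normrN.
Qed.

(** The factor c_i has logarithmic derivative h_i e_i; [LD_mul] moves it past the later factors at
    the price of the adjoint of their inverse, which is the recursion of [MC]. *)
Lemma LD_psis (V : normedModType R) s (tau : V -> 'rV[R]_n) x : lin1 tau ->
  LD (fun y => psis s (tau y)) x (fun h => tau h *m MC s (tau x)).
Proof.
move=> tl; elim: s => [|i s IH] /=.
  have := LD_cst 1%g x; congr LD; apply/funext => h; rewrite mulmx0//.
have [cl ch] := lin1_coord i tl.
have LDc : LD (fun y => c i (tau y 0 i)) x (fun h => tau h 0 i *: delta_mx 0 i).
  split.
  - have := tder_comp (c_tder i) ch; congr tder; apply/funext => h /=.
    rewrite -(homN (cD i)) -cD; congr (c i _).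
    have := cl 1 x h; rewrite !scale1r => ->; ring.
  - by move=> a u v; rewrite cl scalerDl scalerA.
  - exists `|delta_mx 0 i : 'rV[R]_n|; split => // h.
    by rewrite normrZ mulrC ler_wpM2l.
have := LD_mul LDc IH; congr LD; apply/funext => h.
rewrite mulmxDr mulmxA; congr (_ *m _ + _).
apply/rowP => j; rewrite !mxE (bigD1 i)//= mxE eqxx big1 ?addr0 => [|k ki].
  by rewrite ?mxE ?eqxx; case: (j == i); rewrite /= ?mulr1 ?mulr0.
by rewrite mxE (negPf ki) mulr0.
Qed.

Lemma MC0 s : MC s 0 = \sum_(i <- s) delta_mx i i.
Proof.
elim: s => [|i s IH] /=; first by rewrite big_nil.
by rewrite big_cons IH (psis0 cD) invg1 Ad1 mulmx1.
Qed.

Lemma MC_enum0 : MC (enum 'I_n) 0 = 1%:M.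
Proof. by rewrite MC0 big_enum /= scalar_mx_sum_delta; apply: eq_bigr => i _; rewrite scale1r. Qed.

End LogDerivative.

(** * Canonical coordinates as a chart at the identity *)

Section SecondKindChart.
Variables (R : realType) (n : nat) (T : groupType) (C : strict_chart R n T).
Local Notation dom := (dom C).
Local Notation lam := (lam C).
Local Notation sm := (sm C).
Variable c : 'I_n -> R -> T.
Hypothesis cD : forall i s t, c i (s + t) = (c i s * c i t)%g.
Hypothesis c_tder : forall i, tder C (c i) (fun t => t *: delta_mx 0 i).
Local Notation psi := (psi c).
Local Notation LD := (LD C).
Local Notation M := (MC C c (enum 'I_n)).

Lemma open_ball_norm (V : normedModType R) (r : R) : open [set t : V | `|t| < r].
Proof.
rewrite (_ : [set t | _] = ball (0 : V) r); first exact: ball_open.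
by apply/seteqP; split => t; rewrite -ball_normE /= sub0r normrN.
Qed.

Lemma psi_chart : exists2 r : R, 0 < r & [/\
  forall t t', `|t| < r -> `|t'| < r -> psi t = psi t' -> t = t',
  forall t, `|t| < r -> M t \in unitmx &
  forall t e, `|t| < r -> 0 < e -> exists2 d : R, 0 < d & forall y, sm d y ->
    exists t', [/\ `|t'| < r, `|t' - t| <= e & psi t' = (psi t * y)%g]].
Proof.
have [d d0 Hd] := lam_mulr C ltr01.
have m0 : 0 < Num.min d (1 / 2) by rewrite lt_min d0 divr_gt0.
have [r1 r10 H1] := psi_strict cD c_tder m0.
have [r2 r20 H2] : exists2 r : R, 0 < r & forall t, `|t| < r -> M t \in unitmx.
  have oT : open [set: 'rV[R]_n] by exact: openT.
  (* The determinant of M is continuous and equals 1 at 0, so M stays invertible near 0. *)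
  have /Smooth_diff/(_ 0 I) dd : Smooth setT (fun t => \det (M t)).
    by apply: Smooth_det => //; exact: (MC_Smooth cD c_tder oT _ (lin1_id R n)).
  have M0 : M 0 = 1%:M by exact: MC_enum0.
  have := differentiable_continuous dd; move/cvgrPdist_lt => /(_ _ ltr01)/near0P[r r0 Hr].
  exists r => // t /Hr; rewrite /= M0 det1 unitmxE unitfE => h.
  by apply: contraTneq h => ->; rewrite subr0 normr1 ltxx.
pose r := Num.min r1 r2; have r0 : 0 < r by rewrite lt_min r10.
have rr1 : r <= r1 by rewrite ge_min lexx.
have rr2 : r <= r2 by rewrite ge_min lexx orbT.
have half t t' : `|t| < r -> `|t'| < r ->
    `|lam (psi t) - lam (psi t') - (t - t')| <= 1 / 2 * `|t - t'|.
  move=> tr t'r; have [_ h] := H1 t t' (lt_le_trans tr rr1) (lt_le_trans t'r rr1).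
  by apply: le_trans h _; rewrite ler_wpM2r// ge_min lexx orbT.
exists r => //; split.
- move=> t t' tr t'r E; have := half t t' tr t'r; rewrite E subrr sub0r normrN => h.
  apply/eqP; rewrite -subr_eq0 -normr_eq0; apply/eqP.
  by have := normr_ge0 (t - t'); lra.
- by move=> t tr; apply: H2; exact: lt_le_trans tr rr2.
(* The closed s-ball around t stays inside the r-ball, where lam o psi is close to the identity, so
   [near_id_surj] can be centred at t. *)
move=> t e tr e0; pose s := Num.min e ((r - `|t|) / 2).
have s0 : 0 < s by rewrite lt_min e0 divr_gt0// subr_gt0.
have se : s <= e by rewrite ge_min lexx.
have sr : s <= (r - `|t|) / 2 by rewrite ge_min lexx orbT.
have inr t' : `|t' - t| <= s -> `|t'| < r.
  by move=> h; have := ler_distD t t' 0; rewrite !subr0; lra.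
(* Multiplication by y moves the coordinate by at most 2 |lam y| < s / 2, which is within reach of
   [near_id_surj]. *)
exists (Num.min d (s / 4)); first by rewrite lt_min d0 divr_gt0.
move=> y yd; have [[psid _] _] := H1 t t (lt_le_trans tr rr1) (lt_le_trans tr rr1).
have psm : sm d (psi t).
  have [h _] := H1 t t (lt_le_trans tr rr1) (lt_le_trans tr rr1); exact: sm_minl h.
have [pyd h1] := Hd _ _ psm (sm_minl yd); have [_ ys] := sm_minr yd.
have [||t' t's E] := @near_id_surj R n (lam \o psi) t s s0 _ (lam (psi t * y)%g).
- by move=> u u' us u's; apply: half; exact: inr.
- have := ler_distD (lam y) (lam (psi t * y)%g - lam (psi t)) 0; rewrite !subr0 /=; lra.
exists t'; split; [exact: inr|exact: le_trans t's se|].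
apply: (lam_inj (s := C)) => //.
by have [[]] := H1 t' t' (lt_le_trans (inr _ t's) rr1) (lt_le_trans (inr _ t's) rr1).
Qed.

Section WithRadius.
Variable r : R.
Hypothesis psi_inj : forall t t', `|t| < r -> `|t'| < r -> psi t = psi t' -> t = t'.
Hypothesis M_unit : forall t, `|t| < r -> M t \in unitmx.
Hypothesis psi_open : forall t e, `|t| < r -> 0 < e -> exists2 d : R, 0 < d &
  forall y, sm d y -> exists t', [/\ `|t'| < r, `|t' - t| <= e & psi t' = (psi t * y)%g].

Definition chi (x : T) : 'rV[R]_n := xget 0 [set t | `|t| < r /\ psi t = x].

Lemma chiK t : `|t| < r -> chi (psi t) = t.
Proof.
move=> tr; have [] := @xgetPex _ 0 [set u | `|u| < r /\ psi u = psi t]; first by exists t.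
by move=> ur; exact: psi_inj.
Qed.

Definition chi_dom (x : T) := exists2 t, `|t| < r & psi t = x.

Lemma chi_domP x : chi_dom x -> `|chi x| < r /\ psi (chi x) = x.
Proof. by move=> [t tr <-]; rewrite chiK. Qed.

Lemma chi_near x (e : R) : chi_dom x -> 0 < e -> exists2 d : R, 0 < d &
  forall y, sm d y -> chi_dom (x * y)%g /\ `|chi (x * y)%g - chi x| <= e.
Proof.
move=> [t tr <-] e0; have [d d0 Hd] := psi_open tr e0; exists d => // y /Hd[t' [t'r h <-]].
by rewrite !chiK//; split => //; exists t'.
Qed.

(** With D the increment of chi o F and l the coordinate of the increment of F, l = L h + o(h) and
    also l = D M + o(D) by [LD_psis]. Solving for D with M invertible leaves an error o(D) that can
    be absorbed. *)
Lemma chi_fder (V : normedModType R) (F : V -> T) x L : LD F x L -> chi_dom (F x) ->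
  differentiable (chi \o F) x /\
  forall h, 'd (chi \o F) x h = L h *m invmx (M (chi (F x))).
Proof.
move=> [FL linL [K LK]] Fx; have [tr tE] := chi_domP Fx; set t := chi (F x) in tr tE *.
set N := invmx (M t); have LN := bounded_mulmx N LK.
apply: (fder_differentiable (L := fun h => L h *m N) (K := n%:R * K * `|N|)).
- by move=> a u v; rewrite linL mulmxDl -scalemxAl.
- by case: LN.
move=> e e0; pose k := n%:R * `|N| + 1; have k0 : 0 < k by rewrite ltr_wpDl// mulr_ge0.
have K0 : 0 <= K by case: LK.
pose B := n%:R * K * `|N| + 1; have B0 : 0 < B by rewrite ltr_wpDl// !mulr_ge0.
pose a := Num.min (1 / 2) (e / (4 * B)) / k.
(* The bound 1/2 on a k absorbs the error in D and gives |D| <= 2 B |h|; the bound e / (4 B) then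
   brings the total error below e |h|. *)
have a0 : 0 < a by rewrite divr_gt0// lt_min !divr_gt0 ?mulr_gt0.
have ak : a * k = Num.min (1 / 2) (e / (4 * B)) by rewrite /a divfK ?lt0r_neq0.
have ak2 : a * k <= 1 / 2 by rewrite ak ge_min lexx.
have akB : a * k * (4 * B) <= e by rewrite ak -ler_pdivlMr ?mulr_gt0// ge_min lexx orbT.
have [d1 d10 H1] := FL _ a0.
have [psiL _ _] := LD_psis cD c_tder (enum 'I_n) t (lin1_id R n).
have [d2 d20 H2] := psiL _ a0.
have d2h : 0 < d2 / 2 by rewrite divr_gt0.
have [d3 d30 H3] := psi_open tr d2h.
have [d4 d40 H4] := tder_sm FL LK d30.
exists (Num.min d1 d4); first by rewrite lt_min d10.
move=> h; rewrite lt_min => /andP[/H1[_ h1] /H4/H3[t' [t'r t't E]]].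
rewrite tE mulVKg in E; rewrite -/(comp chi F) /= -E chiK//.
have [_ ] := H2 (t' - t) ltac:(by apply: le_lt_trans t't _; lra).
have -> : (t + (t' - t))%R = t' by rewrite addrC subrK.
rewrite -/psi E tE => h2; set D := t' - t in h2 *.
have -> : t' - chi (F x) - L h *m N = D - L h *m N by [].
set l := lam _ in h1 h2.
have DE : D - L h *m N = (l - L h) *m N - (l - D *m M t) *m N.
  rewrite -mulmxBl; have -> : l - L h - (l - D *m M t) = D *m M t - L h.
    by apply/rowP => j; rewrite !mxE; ring.
  by rewrite mulmxBl -mulmxA mulmxV ?mulmx1//; exact: M_unit.
have nN (v : 'rV[R]_n) : `|v *m N| <= k * `|v|.
  apply: le_trans (mx_norm_mul _ _) _; rewrite mulrAC ler_wpM2r//.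
  by rewrite lerDl.
have b1 : `|D - L h *m N| <= a * k * `|h| + a * k * `|D|.
  rewrite DE; apply: le_trans (ler_normB _ _) _; apply: lerD.
    by apply: le_trans (nN _) _; rewrite (mulrC a) -mulrA ler_pM2l.
  by apply: le_trans (nN _) _; rewrite (mulrC a) -mulrA ler_pM2l.
have b2 : `|D| <= 2 * B * `|h|.
  have := ler_distD (L h *m N) D 0; rewrite !subr0.
  have := LN.2 h; rewrite /B.
  have : a * k * `|D| <= 1 / 2 * `|D| by rewrite ler_wpM2r.
  have : a * k * `|h| <= 1 / 2 * `|h| by rewrite ler_wpM2r.
  have : 0 <= `|h| by []. lra.
apply: le_trans b1 _.
have ak0 : 0 <= a * k by rewrite mulr_ge0// ltW.
have : a * k * `|D| <= a * k * (2 * B * `|h|) by rewrite ler_wpM2l.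
have : a * k * (4 * B) * `|h| <= e * `|h| by rewrite ler_wpM2r.
have : a * k * `|h| <= a * k * (B * `|h|).
  by rewrite ler_wpM2l// ler_peMl// /B lerDr !mulr_ge0.
have : 0 <= a * k * (B * `|h|) by rewrite mulr_ge0// mulr_ge0// ltW.
lra.
Qed.

Lemma chi_Smooth (V : normedModType R) (Om : set V) (F : V -> T) (L : V -> V -> 'rV[R]_n) :
  open Om -> (forall x, Om x -> LD F x (L x)) -> (forall x, Om x -> chi_dom (F x)) ->
  (forall v, mxSmooth Om (fun x => L x v)) -> Smooth Om (chi \o F).
Proof.
move=> oOm FL Fd sL; apply: Smooth_rV => // i j; rewrite ord1.
have oU := @open_ball_norm 'rV[R]_n r.
have boot (g : 'rV[R]_n -> R) : Smooth [set t : 'rV[R]_n | `|t| < r] g -> Smooth Om (g \o (chi \o F)).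
  apply: (Smooth_bootstrap oOm (N := fun t => invmx (M t)) (l := fun v x => L x v)) => //.
  - by move=> x /Fd/chi_domP[].
  - apply: mxSmooth_inv => //.
    exact: (MC_Smooth cD c_tder oU _ (lin1_id R n)).
  - by move=> x xO; case: (chi_fder (FL x xO) (Fd x xO)).
  - by move=> x v xO; case: (chi_fder (FL x xO) (Fd x xO)).
apply: (boot (fun t => t 0 j)).
apply: (Smooth_lin oU (K := 1)); first by move=> a u v; rewrite !mxE.
by move=> h; rewrite mul1r mx_norm_entry.
Qed.

End WithRadius.
End SecondKindChart.

(** * Clifford semigroups *)

Section Clifford.
Variables (S : topologicalType) (mul : S -> S -> S) (inv : S -> S).
Hypothesis Hc : top_clifford mul inv.
Local Notation "x * y" := (mul x y).

Lemma cl_mulA x y z : x * (y * z) = x * y * z.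
Proof. by case: Hc. Qed.

Lemma cl_mulV x : x * inv x * x = x.
Proof. by case: Hc => _ [h _]; case: (h x). Qed.

Lemma cl_Vmul x : inv x * x * inv x = inv x.
Proof. by case: Hc => _ [h _]; case: (h x). Qed.

Lemma cl_inv_uniq x y : x * y * x = x -> y * x * y = y -> y = inv x.
Proof. by case: Hc => _ [_ [h _]]; exact: h. Qed.

Lemma cl_invC x : x * inv x = inv x * x.
Proof. by case: Hc => _ [_ [_ [h _]]]. Qed.

Lemma cl_mul_cont : continuous (fun p : S * S => p.1 * p.2).
Proof. by case: Hc => _ [_ [_ [_ []]]]. Qed.

Lemma cl_inv_cont : continuous inv.
Proof. by case: Hc => _ [_ [_ [_ []]]]. Qed.

Lemma cl_mul_near x y (O : set S) : nbhs (x * y) O ->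
  exists A B, [/\ nbhs x A, nbhs y B & forall a b, A a -> B b -> O (a * b)].
Proof.
move=> /(cl_mul_cont (x := (x, y)))[[A B] /= [Ax By] AB].
by exists A, B; split => // a b Aa Bb; exact: (AB (a, b)).
Qed.

Lemma idem_inv e : idem mul e -> inv e = e.
Proof. by move=> ee; apply/esym/cl_inv_uniq; rewrite !ee. Qed.

Lemma idem_mulV x : idem mul (x * inv x).
Proof. by rewrite /idem /= cl_mulA cl_mulV. Qed.

(** If x is the inverse of e f, then f x e is an inverse of e f as well, so x = f x e by uniqueness.
    This makes x idempotent, hence equal to its own inverse e f. *)
Lemma idem_mul e f : idem mul e -> idem mul f -> idem mul (e * f).
Proof.
move=> ee ff; have e2 z : e * (e * z) = e * z by rewrite cl_mulA ee.
have f2 z : f * (f * z) = f * z by rewrite cl_mulA ff.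
set x := inv (e * f).
have h z : x * (e * (f * (x * z))) = x * z.
  have h0 := cl_Vmul (e * f); rewrite -/x in h0.
  by rewrite -[in RHS]h0 -!cl_mulA.
have xE : f * (x * e) = x.
  apply: cl_inv_uniq.
    have h0 := cl_mulV (e * f); rewrite -/x -!cl_mulA in h0.
    by rewrite -!cl_mulA f2 e2.
  by rewrite -!cl_mulA e2 f2 h.
have xx : idem mul x.
  by rewrite /idem /= -xE -!cl_mulA h.
have -> : e * f = inv x.
  by apply: cl_inv_uniq; [exact: cl_Vmul|exact: cl_mulV].
by rewrite idem_inv.
Qed.

(** f e is an inverse of e f, and the idempotent e f is its own inverse. *)
Lemma idemC e f : idem mul e -> idem mul f -> e * f = f * e.
Proof.
move=> ee ff; have ef := idem_mul ee ff; have fe := idem_mul ff ee.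
have e2 z : e * (e * z) = e * z by rewrite cl_mulA ee.
have f2 z : f * (f * z) = f * z by rewrite cl_mulA ff.
rewrite -[LHS](idem_inv ef); apply/esym/cl_inv_uniq.
  by move: ef; rewrite /idem /= -!cl_mulA f2 e2.
by move: fe; rewrite /idem /= -!cl_mulA e2 f2.
Qed.

Section MaximalSubgroup.
Variable e : S.
Hypothesis ee : idem mul e.
Local Notation G := (maxsub mul inv e).

Lemma maxsub_mulel x : G x -> e * x = x.
Proof. by move=> <-; exact: cl_mulV. Qed.

Lemma maxsub_muler x : G x -> x * e = x.
Proof. by move=> <-; rewrite cl_invC cl_mulA cl_mulV. Qed.

Lemma maxsub_e : G e.
Proof. by rewrite /maxsub /= idem_inv. Qed.

Lemma maxsub_mulV x : G x -> x * inv x = e. Proof. by []. Qed.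

Lemma maxsub_Vmul x : G x -> inv x * x = e. Proof. by rewrite -cl_invC. Qed.

Lemma maxsub_inv x : G x -> G (inv x).
Proof.
move=> xG; have -> : G (inv x) = (inv x * inv (inv x) = e) by [].
have <- : x = inv (inv x) by apply: cl_inv_uniq; [exact: cl_Vmul|exact: cl_mulV].
exact: maxsub_Vmul.
Qed.

Lemma maxsub_mul x y : G x -> G y -> G (x * y).
Proof.
move=> xG yG; have iG := maxsub_inv xG.
have E : x * y * (inv y * inv x) = e.
  by rewrite cl_mulA -(cl_mulA x y) (maxsub_mulV yG) (maxsub_muler xG).
have E' : inv y * inv x * (x * y) = e.
  by rewrite cl_mulA -(cl_mulA (inv y)) (maxsub_Vmul xG) (maxsub_muler (maxsub_inv yG)) maxsub_Vmul.
have -> : G (x * y) = (x * y * inv (x * y) = e) by [].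
rewrite -(@cl_inv_uniq (x * y) (inv y * inv x)) ?E ?E'//.
  by rewrite cl_mulA (maxsub_mulel xG).
by rewrite cl_mulA (maxsub_mulel (maxsub_inv yG)).
Qed.

Definition Gtype := {x : S | G x}.
HB.instance Definition _ := gen_eqMixin Gtype.
HB.instance Definition _ := gen_choiceMixin Gtype.
Definition Gone : Gtype := exist _ e maxsub_e.
Definition Gmul (x y : Gtype) : Gtype := exist _ _ (maxsub_mul (svalP x) (svalP y)).
Definition Ginv (x : Gtype) : Gtype := exist _ _ (maxsub_inv (svalP x)).

Lemma Gtype_eq (x y : Gtype) : sval x = sval y -> x = y.
Proof. by case: x y => [x xG] [y yG] /= E; case: _ / E in yG *; congr exist; exact: Prop_irrelevance. Qed.

Lemma GmulA : associative Gmul.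
Proof. by move=> x y z; apply: Gtype_eq; exact: cl_mulA. Qed.
Lemma Gmul1 : left_id Gone Gmul.
Proof. by move=> x; apply: Gtype_eq; exact: maxsub_mulel (svalP x). Qed.
Lemma Gmulr1 : right_id Gone Gmul.
Proof. by move=> x; apply: Gtype_eq; exact: maxsub_muler (svalP x). Qed.
Lemma GmulV : left_inverse Gone Ginv Gmul.
Proof. by move=> x; apply: Gtype_eq; exact: maxsub_Vmul (svalP x). Qed.
Lemma GmulrV : right_inverse Gone Ginv Gmul.
Proof. by move=> x; apply: Gtype_eq; exact: maxsub_mulV (svalP x). Qed.

Definition Ggroup : groupType :=
  HB.pack_for groupType Gtype
    (isGroup.Build Gtype GmulA Gmul1 Gmulr1 GmulV GmulrV).

End MaximalSubgroup.
End Clifford.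

(** * Mean value estimates and criteria for C^1 maps *)

Section MeanValue.
Context {R : realType} {V : normedModType R} {m : nat}.

(** D is a parameter, so that Frechet derivatives and mere directional derivatives feed the same
    mean value estimate. *)
Definition dirder (f : V -> 'rV[R]_m) (z w : V) (D : 'rV[R]_m) :=
  forall e : R, 0 < e -> exists2 d : R, 0 < d & forall h : R, `|h| < d ->
    `|f (z + h *: w) - f z - h *: D| <= e * `|h|.

Lemma differentiable_dirder f z w : differentiable f z -> dirder f z w ('d f z w).
Proof.
move=> df e e0; have w1 : 0 < `|w| + 1 by rewrite ltr_wpDl.
have [|d d0 Hd] := differentiable_fder df (e := e / (`|w| + 1)); first by rewrite divr_gt0.
exists (d / (`|w| + 1)); first by rewrite divr_gt0.
move=> h; rewrite ltr_pdivlMr// => hd.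
have hw : `|h *: w| <= `|h| * (`|w| + 1) by rewrite normrZ ler_wpM2l// lerDl.
have := Hd (h *: w) (le_lt_trans hw hd); rewrite linearZ /= => H.
by apply: le_trans H _; rewrite -mulrA ler_pM2l// ler_pdivrMl// mulrC.
Qed.

Lemma derivable_dirder (f : V -> 'rV[R]_m) z b (k : R) : derivable f z b ->
  dirder f z (k *: b) (k *: 'D_b f z).
Proof.
move=> /derivable_nbhs/eqaddoP db e e0; have k1 : 0 < `|k| + 1 by rewrite ltr_wpDl.
have /near0P[d d0 Hd] := db (e / (`|k| + 1)) ltac:(by rewrite divr_gt0).
exists (d / (`|k| + 1)); first by rewrite divr_gt0.
move=> h; rewrite ltr_pdivlMr// => hd.
have hk : `|h * k| <= `|h| * (`|k| + 1) by rewrite normrM ler_wpM2l// lerDl.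
have := Hd (h * k) (le_lt_trans hk hd).
have -> : ((fun h => (f \o shift z) (h *: b)) - (cst (f z) + (fun h => h *: 'D_b f z))) (h * k)
    = f (z + h *: (k *: b)) - f z - h *: (k *: 'D_b f z).
  by rewrite !fctE /= /shift !scalerA opprD addrA [_ + z]addrC.
move=> H; apply: le_trans H _.
by rewrite -mulrA ler_pM2l// ler_pdivrMl// [leRHS]mulrC.
Qed.

Lemma segment_derive (f : V -> 'rV[R]_m) q w (t : R) D j : dirder f (q + t *: w) w D ->
  is_derive t 1 (fun s : R => f (q + s *: w) 0 j) (D 0 j).
Proof.
move=> df; have [dg dgE] : differentiable (fun s : R => f (q + s *: w) 0 j) t /\
    forall h, 'd (fun s : R => f (q + s *: w) 0 j) t h = h * D 0 j.
  apply: (fder_differentiable (L := fun h : R => h * D 0 j) (K := `|D 0 j|)).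
  - by move=> a u v; rewrite mulrDl -mulrA.
  - by move=> h; rewrite normrM mulrC.
  move=> e e0; have [d d0 Hd] := df e e0; exists d => // h /Hd.
  have -> : q + t *: w + h *: w = q + (t + h) *: w by rewrite -addrA -scalerDl.
  have := mx_norm_entry (f (q + (t + h) *: w) - f (q + t *: w) - h *: D) 0 j.
  by rewrite !mxE; exact: le_trans.
by apply: DeriveDef; [exact: diff_derivable|rewrite deriveE// dgE mul1r].
Qed.

(** The scalar mean value theorem is applied to each coordinate. The intermediate points differ, but
    the bound on D is uniform and the norm is the maximum over coordinates. *)
Lemma mean_value_bound (f : V -> 'rV[R]_m) (D : R -> 'rV[R]_m) A q w (e : R) : 0 <= e ->
  (forall t : R, 0 <= t <= 1 -> dirder f (q + t *: w) w (D t) /\ `|D t - A| <= e) ->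
  `|f (q + w) - f q - A| <= e.
Proof.
move=> e0 H; apply: mx_norm_le => // i j; rewrite ord1.
have [||c c01 E] := @MVT_segment R (fun s : R => f (q + s *: w) 0 j)
    (fun t => (D t) 0 j) 0 1 ler01.
- move=> t; rewrite in_itv /= => /andP[t0 t1]; apply: segment_derive.
  by have [|dt _] := H t; rewrite ?(ltW t0) ?(ltW t1).
- apply/subspace_continuousP => t; rewrite /= in_itv /= => /andP[t0 t1].
  apply: cvg_within_filter.
  have [|dt _] := H t; first by rewrite t0.
  have [dd _] := segment_derive j dt.
  by apply: differentiable_continuous; exact/derivable1_diffP.
have c01' : 0 <= c <= 1 by move: c01; rewrite in_itv.
have [_ Hc] := H c c01'; apply: le_trans Hc.
have := mx_norm_entry (D c - A) 0 j.
by move: E; rewrite subr0 mulr1 scale1r scale0r addr0 => E; rewrite !mxE -E.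
Qed.

(** On the segment from q to p, which stays in a ball around 0, the derivative is uniformly close to
    its value at 0. *)
Lemma C1_strict (f : V -> 'rV[R]_m) (O : set V) : open O -> O 0 -> C1_on O f ->
  forall e : R, 0 < e -> exists2 d : R, 0 < d & forall p q, `|p| < d -> `|q| < d ->
    `|f p - f q - 'd f 0 (p - q)| <= e * `|p - q|.
Proof.
move=> oO O0 [df dfc] e e0; have [d d0 Hd] := dfc 0 O0 e e0.
have /near0P[r r0 Hr] : \forall x \near 0, O x by exact: open_nbhs_nbhs.
exists (Num.min d r); first by rewrite lt_min d0.
move=> p q; rewrite !lt_min => /andP[pd pr] /andP[qd qr].
have {1}-> : p = q + (p - q) by rewrite addrC subrK.
apply: (mean_value_bound (D := fun t => 'd f (q + t *: (p - q)) (p - q))).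
  by rewrite mulr_ge0// ltW.
move=> t /andP[t0 t1].
have conv (s : R) : `|p| < s -> `|q| < s -> `|q + t *: (p - q)| < s.
  move=> ps qs; have -> : q + t *: (p - q) = (1 - t) *: q + t *: p.
    by rewrite scalerBr scalerBl scale1r addrA addrAC.
  apply: le_lt_trans (ler_normD _ _) _; rewrite !normrZ (ger0_norm t0) ger0_norm ?subr_ge0//.
  have [->|tn] := eqVneq t 0; first by rewrite subr0 mul1r mul0r addr0.
  have : (1 - t) * `|q| <= (1 - t) * s by rewrite ler_wpM2l ?subr_ge0// ltW.
  have : t * `|p| < t * s by rewrite ltr_pM2l// lt0r tn.
  lra.
have Ot := Hr _ (conv _ pr qr).
split; first exact: differentiable_dirder (df _ Ot).
by apply: Hd => //; rewrite subr0; exact: conv.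
Qed.

(** Continuous partial derivatives imply C^1. The basis b with coordinates k is left abstract so
    that it can be a basis of a product space. *)
Lemma partials_C1 (I : finType) (b : I -> V) (k : I -> V -> R) (f : V -> 'rV[R]_m)
    (O : set V) : open O ->
  (forall i, linear (k i)) -> (forall i h, `|k i h| <= `|h|) -> (forall i, `|b i| <= 1) ->
  (forall h, h = \sum_i k i h *: b i) ->
  (forall x v, O x -> derivable f x v) ->
  (forall x v, O x -> {for x, continuous ('D_v f)}) -> C1_on O f.
Proof.
move=> oO klin kb b1 hE fD fC.
pose N : R := #|I|%:R; have N0 : 0 <= N by [].
pose L x h := \sum_i k i h *: 'D_(b i) f x.
have Llin x : linear (L x).
  move=> a u v; rewrite /L scaler_sumr -big_split; apply: eq_bigr => i _.
  by rewrite klin scalerDl scalerA.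
have unif x (e : R) : O x -> 0 < e -> exists2 d : R, 0 < d & forall y, `|y - x| < d ->
    O y /\ forall i, `|'D_(b i) f y - 'D_(b i) f x| <= e.
  move=> Ox e0.
  have : \forall y \near x, O y /\ forall i, `|'D_(b i) f y - 'D_(b i) f x| <= e.
    apply: filterI; first exact: open_nbhs_nbhs.
    apply: filter_forall => i; have /cvgrPdist_le/(_ e e0) := fC x (b i) Ox.
    by apply: filterS => y h; rewrite distrC; exact: h.
  move=> /nbhs_ballP[d d0 Hd]; exists d => // y yx; apply: Hd.
  by rewrite -ball_normE /= distrC.
have Lsum x y (e : R) v : (forall i, `|'D_(b i) f y - 'D_(b i) f x| <= e) ->
    `|L y v - L x v| <= N * e * `|v|.
  move=> h; rewrite /L -sumrB; apply: le_trans (ler_norm_sum _ _ _) _.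
  have -> : N * e * `|v| = \sum_(i : I) `|v| * e.
    by rewrite sumr_const -mulr_natl /N -mulrA [e * _]mulrC.
  apply: ler_sum => i _; rewrite -scalerBr normrZ ler_pM//.
have fL x : O x -> fder f x (L x).
  move=> Ox e e0; pose e' := e / (N + 1); have N1 : 0 < N + 1 by rewrite ltr_wpDl.
  have e'0 : 0 < e' by rewrite divr_gt0.
  have [d d0 Hd] := unif x e' Ox e'0.
  exists (d / (N + 1)); first by rewrite divr_gt0.
  move=> h; rewrite ltr_pdivlMr// => hd.
  (* Coordinates are switched on one at a time, each step costing at most e' |h| by the mean value
     bound. The radius d / (N + 1) keeps the whole path within distance d of x. *)
  have part (s : seq I) : (size s)%:R * `|h| < d ->
      `|\sum_(i <- s) k i h *: b i| <= (size s)%:R * `|h| /\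
      `|f (x + \sum_(i <- s) k i h *: b i) - f x - \sum_(i <- s) k i h *: 'D_(b i) f x|
        <= (size s)%:R * (e' * `|h|).
    elim: s => [|i s IH] /=.
      by rewrite !big_nil addr0 subrr subr0 !normr0 !mul0r lexx.
    rewrite -natr1 !big_cons => hs.
    have h0 := normr_ge0 h.
    have [|IH1 IH2] := IH; first by lra.
    have kib (t : R) : 0 <= t <= 1 -> `|t *: (k i h *: b i)| <= `|h|.
      move=> /andP[t0 t1]; rewrite !normrZ ger0_norm//.
      have a1 : `|k i h| * `|b i| <= `|h| by rewrite -[leRHS]mulr1 ler_pM.
      by apply: le_trans a1; rewrite ler_piMl// mulr_ge0.
    split.
      have := kib 1; rewrite scale1r ler01 lexx => /(_ isT) a1.
      by apply: le_trans (ler_normD _ _) _; lra.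
    set Ss := \sum_(j <- s) k j h *: b j in IH1 IH2 *.
    have MV : `|f (x + Ss + k i h *: b i) - f (x + Ss) - k i h *: 'D_(b i) f x| <= e' * `|h|.
      apply: (mean_value_bound
        (D := fun t => k i h *: 'D_(b i) f (x + Ss + t *: (k i h *: b i)))).
        by rewrite mulr_ge0// ltW.
      move=> t t01; have [|Oy Dy] := Hd (x + Ss + t *: (k i h *: b i)).
        have -> : x + Ss + t *: (k i h *: b i) - x = Ss + t *: (k i h *: b i).
          by rewrite -[x + Ss + _]addrA [x + _]addrC addrK.
        by apply: le_lt_trans (ler_normD _ _) _; have := kib t t01; lra.
      split; first by apply: derivable_dirder; exact: fD.
      by rewrite -scalerBr normrZ mulrC ler_pM.
    have -> : x + (k i h *: b i + Ss) = x + Ss + k i h *: b i by rewrite -addrA [Ss + _]addrC.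
    set Ds := \sum_(j <- s) k j h *: 'D_(b j) f x in IH2 *.
    have -> : f (x + Ss + k i h *: b i) - f x - (k i h *: 'D_(b i) f x + Ds) =
      (f (x + Ss + k i h *: b i) - f (x + Ss) - k i h *: 'D_(b i) f x) + (f (x + Ss) - f x - Ds).
      move: (f (x + Ss + k i h *: b i)) (f (x + Ss)) (f x) (k i h *: 'D_(b i) f x) => a1 a2 a3 a4.
      by apply/rowP => j; rewrite !mxE; ring.
    by apply: le_trans (ler_normD _ _) _; lra.
  have [|_] := part (index_enum I).
    have -> : size (index_enum I) = #|I| by rewrite cardT enumT.
    by rewrite -/N; have := normr_ge0 h; lra.
  rewrite -hE -/(L x h) => H; apply: le_trans H _.
  have -> : size (index_enum I) = #|I| by rewrite cardT enumT.
  rewrite -/N mulrA ler_wpM2r//.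
  have : e' * (N + 1) = e by rewrite /e' divfK// lt0r_neq0.
  by lra.
have dL x : O x -> differentiable f x /\ forall h, 'd f x h = L x h.
  move=> Ox; apply: (fder_differentiable (K := \sum_i `|'D_(b i) f x|)) => //.
    move=> h; apply: le_trans (ler_norm_sum _ _ _) _; rewrite mulr_suml.
    by apply: ler_sum => i _; rewrite normrZ mulrC ler_wpM2l.
  exact: fL.
split; first by move=> x /dL[].
move=> x0 Ox0 e e0; have N1 : 0 < N + 1 by rewrite ltr_wpDl.
have [|d d0 Hd] := unif x0 (e / (N + 1)) Ox0; first by rewrite divr_gt0.
exists d => // x Ox xd v; have [_ h] := Hd x xd.
rewrite (dL x Ox).2 (dL x0 Ox0).2; apply: le_trans (Lsum _ _ _ _ h) _.
rewrite ler_wpM2r//; have : e / (N + 1) * (N + 1) = e by rewrite divfK// lt0r_neq0.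
have : 0 < e / (N + 1) by rewrite divr_gt0.
by lra.
Qed.

End MeanValue.

Lemma within_open_continuous (X Y : topologicalType) (A : set X) (f : X -> Y) x (B : set Y) :
  open A -> {within A, continuous f} -> A x -> nbhs (f x) B ->
  \forall y \near x, A y /\ B (f y).
Proof.
move=> oA /subspace_continuousP cf Ax fB; have := cf x Ax B fB.
rewrite /= /within /= => h; have Axn : nbhs x A by exact: open_nbhs_nbhs.
by apply: filterS2 Axn h => y Ay /(_ Ay).
Qed.

(** * The C^1 chart at an idempotent *)

Section LocalChart.
Variables (R : realType) (S : topologicalType) (mul : S -> S -> S) (inv : S -> S).
Hypothesis Hc : top_clifford mul inv.
Local Notation "x ** y" := (mul x y) (at level 40, left associativity).
Variables (e : S) (n : nat) (U W : set S) (V : set 'rV[R]_n).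
Variables (phi : S -> 'rV[R]_n) (psi : 'rV[R]_n -> S).
Hypothesis ee : idem mul e.
Hypotheses (oU : open U) (oW : open W) (Ue : U e) (UW : U `<=` W) (oV : open V).
Hypothesis phiK : forall x, W x -> V (phi x) /\ psi (phi x) = x.
Hypothesis psiK : forall y, V y -> W (psi y) /\ phi (psi y) = y.
Hypotheses (cphi : {within W, continuous phi}) (cpsi : {within V, continuous psi}).
Hypothesis phie : phi e = 0.
Hypothesis f_C1 : C1_on [set p : 'rV[R]_n * 'rV[R]_n | (phi @` U) p.1 /\ (phi @` U) p.2]
  (fun p => phi (psi p.1 ** psi p.2)).

Let f (p : 'rV[R]_n * 'rV[R]_n) := phi (psi p.1 ** psi p.2).
Let We : W e. Proof. exact: UW. Qed.
Let V0 : V 0. Proof. by rewrite -phie; case: (phiK We). Qed.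
Let psi0 : psi 0 = e. Proof. by rewrite -phie; case: (phiK We). Qed.

Lemma phi_imageE : phi @` U = [set y | V y /\ U (psi y)].
Proof.
apply/seteqP; split => [y [x Ux <-]|y [Vy Uy]] /=.
  by have [Vx ->] := phiK (UW Ux).
by exists (psi y) => //; case: (psiK Vy).
Qed.

Lemma open_phi_image : open (phi @` U).
Proof.
rewrite phi_imageE openE => y [Vy Uy]; 
exact: (within_open_continuous oV cpsi Vy (open_nbhs_nbhs (conj oU Uy))).
Qed.

Lemma open_prodset (X Y : topologicalType) (A : set X) (B : set Y) : open A -> open B ->
  open [set p : X * Y | A p.1 /\ B p.2].
Proof.
move=> oA oB; rewrite openE => -[x y] [/= Ax By].
by exists (A, B) => //=; split; exact: open_nbhs_nbhs.
Qed.

Lemma f_strict (d' : R) : 0 < d' -> exists2 d : R, 0 < d & forall p q, `|p| < d -> `|q| < d ->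
  `|f p - f q - 'd f 0 (p - q)| <= d' * `|p - q|.
Proof.
move: d'; apply: (C1_strict _ _ f_C1).
  exact: open_prodset open_phi_image open_phi_image.
by split; exists e.
Qed.

Lemma phi_small (O : set S) : nbhs e O -> exists2 d : R, 0 < d &
  forall x, W x -> `|phi x| < d -> O x.
Proof.
move=> Oe; have : \forall y \near (0 : 'rV[R]_n), V y /\ O (psi y).
  by apply: within_open_continuous => //; rewrite psi0.
move=> /near0P[d d0 Hd]; exists d => // x Wx xd.
by have [_] := Hd _ xd; have [_ ->] := phiK Wx.
Qed.

Lemma near_phi_small (d : R) : 0 < d -> \forall x \near e, U x /\ `|phi x| < d.
Proof.
move=> d0; have Un : nbhs e U by exact: open_nbhs_nbhs.
have : \forall x \near e, W x /\ `|phi x| < d.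
  apply: (@within_open_continuous _ _ W phi e [set y | `|y| < d]) => //.
  rewrite phie.
  have h : \forall y \near (0 : 'rV[R]_n), `|y| < d by apply/near0P; exists d.
  exact: h.
by apply: filterS2 Un => x Ux [_ h].
Qed.

(** Commutation makes y = x e an idempotent below e, so y is treated first; once x e = e is known,
    the same kind of comparison forces x = e. In each case two increments of f along one axis are
    known exactly, and the derivative at 0 is eliminated between them. *)
Lemma idem_isolated : \forall x \near e, idem mul x -> x = e.
Proof.
have [d d0 Hd] := f_strict (d' := 1 / 4) ltac:(by rewrite divr_gt0).
have Nn := near_phi_small d0; have := Nn; rewrite -{1}ee => /(cl_mul_near Hc)[A [B [Ae Be AB]]].
near=> x => xx.
have xC : x ** e = e ** x by exact: (idemC Hc).
have [Ux xd] : U x /\ `|phi x| < d by near: x.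
have [Uy yd] : U (x ** e) /\ `|phi (x ** e)| < d.
  by apply: AB; [near: x|exact: nbhs_singleton].
set y := x ** e in Uy yd.
have yy : y ** y = y by exact: (idem_mul Hc).
have ye : y ** e = y by rewrite /y -(cl_mulA Hc) ee.
have ey : e ** y = y by rewrite /y xC (cl_mulA Hc) ee.
have [Vy psiy] := phiK (UW Uy); have [Vx psix] := phiK (UW Ux).
have prodn a b (r : R) : `|a| < r -> `|b| < r -> `|(a, b) : 'rV[R]_n * 'rV[R]_n| < r.
  by move=> ar br; rewrite prod_normE gt_max ar.
have z0 : `|0 : 'rV[R]_n| < d by rewrite normr0.
have f00 : f (0, 0) = 0 by rewrite /f /= psi0 ee.
have n0l (w : 'rV[R]_n) : `|(0, w) : 'rV[R]_n * 'rV[R]_n| = `|w|.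
  by rewrite prod_normE /= normr0 max_r.
have n0r (w : 'rV[R]_n) : `|(w, 0) : 'rV[R]_n * 'rV[R]_n| = `|w|.
  by rewrite prod_normE /= normr0 max_l.
(* In direction (0, w) the increment of f is 0 when taken at (w, 0), but w when taken at 0. Both are
   within |w| / 4 of the same derivative, so w = 0. *)
have ye' : y = e.
  set w := phi y in yd psiy.
  have f1 : f (w, w) = w by rewrite /f /= psiy yy.
  have f2 : f (w, 0) = w by rewrite /f /= psiy psi0 ye.
  have f3 : f (0, w) = w by rewrite /f /= psiy psi0 ey.
  have h1 := Hd (w, w) (w, 0) (prodn _ _ _ yd yd) (prodn _ _ _ yd z0).
  have h2 := Hd (0, w) (0, 0) (prodn _ _ _ z0 yd) (prodn _ _ _ z0 z0).
  have E1 : (w, w) - (w, 0) = (0, w) by congr pair; rewrite /= ?subrr ?subr0.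
  have E2 : (0, w) - (0, 0) = (0, w) :> 'rV[R]_n * 'rV[R]_n by rewrite subr0.
  rewrite E1 f1 f2 subrr sub0r normrN n0l in h1.
  rewrite E2 f3 f00 subr0 n0l in h2.
  have := ler_distD ('d f 0 (0, w)) w 0; rewrite !subr0 => h3.
  have w0 : w = 0 by apply/eqP; rewrite -normr_eq0; apply/eqP; have := normr_ge0 w; lra.
  by rewrite -psiy w0 psi0.
(* In direction (u, 0) the increment of f is now u when taken at (0, u), but 0 when taken at 0. *)
have xe : x ** e = e by exact: ye'.
have ex : e ** x = e by rewrite -xC.
set u := phi x in xd psix.
have f1 : f (u, u) = u by rewrite /f /= psix xx.
have f2 : f (u, 0) = 0 by rewrite /f /= psix psi0 xe.
have f3 : f (0, u) = 0 by rewrite /f /= psix psi0 ex.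
have h1 := Hd (u, u) (0, u) (prodn _ _ _ xd xd) (prodn _ _ _ z0 xd).
have h2 := Hd (u, 0) (0, 0) (prodn _ _ _ xd z0) (prodn _ _ _ z0 z0).
have E1 : (u, u) - (0, u) = (u, 0) by congr pair; rewrite /= ?subrr ?subr0.
have E2 : (u, 0) - (0, 0) = (u, 0) :> 'rV[R]_n * 'rV[R]_n by rewrite subr0.
rewrite E1 f1 f3 subr0 n0r in h1.
rewrite E2 f2 f00 subr0 sub0r normrN n0r in h2.
have := ler_distD ('d f 0 (u, 0)) u 0; rewrite !subr0 => h3.
have u0 : u = 0 by apply/eqP; rewrite -normr_eq0; apply/eqP; have := normr_ge0 u; lra.
by rewrite -psix u0 psi0.
Unshelve. all: by end_near. Qed.

(** y y^-1 is idempotent and depends continuously on y, so near a point of G_e it equals the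
    isolated idempotent e. *)
Lemma open_maxsub : open (maxsub mul inv e).
Proof.
rewrite openE => x xG.
have := idem_isolated; rewrite -{1}xG => /(cl_mul_near Hc)[A [B [Ax Bx AB]]].
have : nbhs x (inv @^-1` B) by exact: (cl_inv_cont Hc) Bx.
apply: filterS2 Ax => y Ay By; exact: AB Ay By (idem_mulV Hc y).
Qed.

Local Notation G := (maxsub mul inv e).
Local Notation T := (Ggroup Hc ee).
Local Notation val := (fun x : T => sval x).

Lemma near_G : \forall x \near e, G x.
Proof. by apply: open_nbhs_nbhs; split; [exact: open_maxsub|exact: maxsub_e]. Qed.

(** Openness of G_e makes e an identity for all nearby points, so f(w, 0) = w = f(0, w) for small
    w. *)
Lemma df0 (u v : 'rV[R]_n) : 'd f 0 (u, v) = u + v.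
Proof.
have [d d0 Hd] := phi_small (filterI (near_G) (open_nbhs_nbhs (conj oU Ue))).
have /near0P[dV dV0 HdV] : \forall y \near (0 : 'rV[R]_n), V y by exact: open_nbhs_nbhs.
have prod0l (w : 'rV[R]_n) : `|(0, w) : 'rV[R]_n * 'rV[R]_n| = `|w|.
  by rewrite prod_normE /= normr0 max_r.
have prod0r (w : 'rV[R]_n) : `|(w, 0) : 'rV[R]_n * 'rV[R]_n| = `|w|.
  by rewrite prod_normE /= normr0 max_l.
have n0 (r : R) : 0 < r -> `|0 : 'rV[R]_n * 'rV[R]_n| < r by rewrite normr0.
have f00 : f 0 = 0 by rewrite /f /= psi0 ee.
have Gpsi w : `|w| < Num.min d dV -> G (psi w) /\ phi (psi w) = w.
  rewrite lt_min => /andP[wd wV]; have [Ww pw] := psiK (HdV _ wV).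
  by split => //; have [] := Hd (psi w) Ww; rewrite ?pw.
(* A homogeneous map that agrees with the identity to first order at 0 is the identity: rescale w
   towards 0. *)
have small (A : 'rV[R]_n -> 'rV[R]_n) : (forall a w, A (a *: w) = a *: A w) ->
    (forall r : R, 0 < r -> exists2 s : R, 0 < s & forall w, `|w| < s -> `|w - A w| <= r * `|w|) ->
    forall w, A w = w.
  move=> Al As w; apply/eqP; rewrite eq_sym -subr_eq0 -normr_eq0 eq_le normr_ge0 andbT.
  apply/ler_addgt0Pr => r r0; rewrite add0r.
  have w1 : 0 < `|w| + 1 by rewrite ltr_wpDl.
  have [|s s0 Hs] := As (r / (`|w| + 1)); first by rewrite divr_gt0.
  pose a := s / (`|w| + 1) / 2; have a0 : 0 < a by rewrite !divr_gt0.
  have h1 : a * (`|w| + 1) = s / 2 by rewrite /a mulrAC divfK ?lt0r_neq0.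
  clearbody a; have aw : `|a *: w| < s.
    have h2 : a * `|w| <= a * (`|w| + 1) by rewrite ler_pM2l// lerDl.
    by rewrite normrZ (gtr0_norm a0); lra.
  have := Hs _ aw; rewrite Al -scalerBr !normrZ (gtr0_norm a0) mulrCA ler_pM2l// => h.
  apply: le_trans h _; rewrite -mulrA ler_piMr ?(ltW r0)// ler_pdivrMl// mulr1.
  by rewrite lerDl.
have A1 : forall w, 'd f 0 (w, 0) = w.
  apply: small => [a w|r r0].
    by rewrite -linearZ; congr ('d f 0 (_, _)); rewrite scaler0.
  have [s s0 Hs] := f_strict r0; exists (Num.min s (Num.min d dV)); first by rewrite !lt_min s0 d0.
  move=> w; rewrite lt_min => /andP[ws /Gpsi[Gw pw]].
  have ws' : `|(w, 0) : 'rV[R]_n * 'rV[R]_n| < s by rewrite prod0r.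
  have := Hs (w, 0) 0 ws' (n0 _ s0); rewrite f00 !subr0 prod0r.
  by rewrite /f /= psi0 (maxsub_muler Hc Gw) pw.
have A2 : forall w, 'd f 0 (0, w) = w.
  apply: small => [a w|r r0].
    by rewrite -linearZ; congr ('d f 0 (_, _)); rewrite scaler0.
  have [s s0 Hs] := f_strict r0; exists (Num.min s (Num.min d dV)); first by rewrite !lt_min s0 d0.
  move=> w; rewrite lt_min => /andP[ws /Gpsi[Gw pw]].
  have ws' : `|(0, w) : 'rV[R]_n * 'rV[R]_n| < s by rewrite prod0l.
  have := Hs (0, w) 0 ws' (n0 _ s0); rewrite f00 !subr0 prod0l.
  by rewrite /f /= psi0 (maxsub_mulel Hc Gw) pw.
have -> : (u, v) = (u, 0) + (0, v) by congr pair; rewrite /= ?addr0 ?add0r.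
by rewrite linearD A1 A2.
Qed.

Lemma local_strict_chart : exists C : strict_chart R n T,
  dom C = [set x | U (sval x)] /\ lam C = fun x => phi (sval x).
Proof.
pose small d (x : T) := U (sval x) /\ `|phi (sval x)| < d.
have chart_near (O : set S) : nbhs e O -> exists2 d : R, 0 < d & forall x, small d x -> O (sval x).
  move=> /phi_small[d d0 Hd]; exists d => // x [Ux xd]; exact: Hd (UW Ux) xd.
unshelve eexists; first apply: (@StrictChart R n T [set x | U (sval x)] (fun x => phi (sval x))).
- exact: Ue.
- exact: phie.
- move=> x y Ux Uy E; apply: Gtype_eq.
  have [_ <-] := phiK (UW Ux); have [_ <-] := phiK (UW Uy).
  by rewrite E.
- have /near0P[dV dV0 HdV] : \forall y \near (0 : 'rV[R]_n), V y by exact: open_nbhs_nbhs.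
  have [d d0 Hd] := phi_small (filterI (near_G) (open_nbhs_nbhs (conj oU Ue))).
  exists (Num.min d dV); first by rewrite lt_min d0.
  move=> z; rewrite lt_min => /andP[zd zV]; have [Wz pz] := psiK (HdV _ zV).
  have [Gz Uz] : (G `&` U) (psi z) by apply: Hd; rewrite ?pz.
  by exists (exist _ (psi z) Gz).
- move=> r r0; have [d d0 Hd] := f_strict r0.
  have Un : nbhs (mul e e) U by rewrite ee; exact: open_nbhs_nbhs.
  have [A [B [Ae Be AB]]] := cl_mul_near Hc Un.
  have [d1 d10 H1] := chart_near _ (filterI Ae Be).
  exists (Num.min d d1); first by rewrite lt_min d0.
  move=> x x' y y'; rewrite !lt_min => -[Ux /andP[xd x1]] [Ux' /andP[x'd x'1]].
  move=> [Uy /andP[yd y1]] [Uy' /andP[y'd y'1]]; split.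
    by apply: AB; [case: (H1 x (conj Ux x1))|case: (H1 y (conj Uy y1))].
  have := Hd (phi (sval x), phi (sval y)) (phi (sval x'), phi (sval y')).
  rewrite /f /= (phiK (UW Ux)).2 (phiK (UW Uy)).2 (phiK (UW Ux')).2 (phiK (UW Uy')).2.
  have -> : (phi (sval x), phi (sval y)) - (phi (sval x'), phi (sval y')) =
    (phi (sval x) - phi (sval x'), phi (sval y) - phi (sval y')) by [].
  rewrite -/f df0 => H; apply: le_trans (H _ _) _; rewrite ?prod_normE ?gt_max ?xd ?x'd//.
  by rewrite ler_wpM2l ?(ltW r0)// ge_max lerDl lerDr !normr_ge0.
- move=> r r0; have := near_phi_small r0; rewrite -{1}(idem_inv Hc ee) => ni.
  have /chart_near[d d0 Hd] : nbhs e (inv @^-1` [set x | U x /\ `|phi x| < r]).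
    exact: (cl_inv_cont Hc) ni.
  by exists d => // x xd; exact: Hd xd.
- move=> g r r0; have := near_phi_small r0.
  have gg : e = mul (mul (sval g) e) (inv (sval g)).
    by rewrite (maxsub_muler Hc (svalP g)) (maxsub_mulV (svalP g)).
  rewrite {1}gg => /(cl_mul_near Hc)[A [B [Ae Be AB]]].
  have [A' [B' [A'g B'e AB']]] := cl_mul_near Hc Ae.
  have [d d0 Hd] := chart_near _ B'e; exists d => // x xd.
  apply: AB; last exact: nbhs_singleton Be.
  by apply: AB' (Hd _ xd); exact: nbhs_singleton A'g.
by [].
Qed.

Variable C : strict_chart R n T.
Hypotheses (domC : dom C = [set x | U (sval x)]) (lamC : lam C = fun x => phi (sval x)).

(** Together with [local_chart_near], this identifies the topology of S near x with the translates
    of the sets [sm C d] by x. The converse half relies on G_e being open in S. *)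
Lemma local_chart_nbhs (x : T) (O : set S) : nbhs (sval x) O ->
  exists2 d : R, 0 < d & forall y : T, sm C d y -> O (sval (x * y)%g).
Proof.
rewrite /sm domC lamC.
rewrite -{1}(maxsub_muler Hc (svalP x)) => /(cl_mul_near Hc)[A [B [Ax Be AB]]].
have [d d0 Hd] := phi_small Be; exists d => // y [Uy yd].
by apply: AB; [exact: nbhs_singleton Ax|exact: Hd (UW Uy) yd].
Qed.

Lemma local_chart_near (x : T) (d : R) : 0 < d ->
  \forall z \near sval x, exists2 y : T, z = sval (x * y)%g & sm C d y.
Proof.
rewrite /sm domC lamC.
move=> d0.
have nb : nbhs (inv (sval x) ** sval x) (G `&` [set z | U z /\ `|phi z| < d]).
  by rewrite (maxsub_Vmul Hc (svalP x)); exact: filterI near_G (near_phi_small d0).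
have [A [B [Ax Bx AB]]] := cl_mul_near Hc nb.
have Gx : nbhs (sval x) G.
  by apply: open_nbhs_nbhs; split; [exact: open_maxsub|exact: svalP x].
apply: filterS2 Bx Gx => z /(AB _ _ (nbhs_singleton Ax))[Gxz xz] Gz.
exists (exist _ _ Gxz) => //=.
by rewrite (cl_mulA Hc) (maxsub_mulV (svalP x)) (maxsub_mulel Hc Gz).
Qed.

End LocalChart.

(** * The Lie group structure of a maximal subgroup *)

Section LieGroupOfStrictChart.
Variables (R : realType) (S : topologicalType) (mul : S -> S -> S) (inv : S -> S).
Hypothesis Hc : top_clifford mul inv.
Variables (e : S) (ee : idem mul e) (n : nat).
Local Notation Gs := (maxsub mul inv e).
Local Notation T := (Ggroup Hc ee).
Variable C : strict_chart R n T.
Hypothesis nbhs_C : forall (x : T) (O : set S), nbhs (sval x) O ->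
  exists2 d : R, 0 < d & forall y : T, sm C d y -> O (sval (x * y)%g).
Hypothesis near_C : forall (x : T) (d : R), 0 < d ->
  \forall z \near sval x, exists2 y : T, z = sval (x * y)%g & sm C d y.

(** S is not assumed Hausdorff; separation comes from the chart. A common point x a = y b of small
    translates would make x^-1 y = a b^-1 small. *)
Lemma strict_chart_hausdorff (x y : S) : Gs x -> Gs y -> x <> y ->
  exists U1 U2 : set S, open U1 /\ open U2 /\ U1 x /\ U2 y /\ U1 `&` U2 `&` Gs = set0.
Proof.
move=> xG yG xy; pose x' : T := exist _ x xG; pose y' : T := exist _ y yG.
have [e1 e10 He1] : exists2 r : R, 0 < r & ~ sm C r (x'^-1 * y')%g.
  apply: contrapT => h; apply: xy.
  suff /mulg1_eq : (x'^-1 * y')%g = 1%g by rewrite invgK => /(congr1 sval).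
  by apply: (@sm_eq1 _ _ _ C) => d d0; apply: contrapT => ns; apply: h; exists d.
have [d d0 Hd] := sm_mul C e10; have [d' d'0 Hd'] := inv_cont C d0.
pose m := Num.min d d'; have m0 : 0 < m by rewrite lt_min d0.
have near_open (z : T) : exists2 U : set S, open U /\ U (sval z) &
    forall w, U w -> exists2 a : T, w = sval (z * a)%g & sm C m a.
  have : nbhs (sval z) [set w | exists2 a : T, w = sval (z * a)%g & sm C m a] := near_C z m0.
  by rewrite nbhsE => -[U [oU Uz] HU]; exists U.
have [U1 [oU1 U1x] H1] := near_open x'; have [U2 [oU2 U2y] H2] := near_open y'.
exists U1, U2; do 4 split => //; apply/seteqP; split => // z [[/H1[a za sa] /H2[b zb sb]] _].
apply: He1; have E : (x' * a)%g = (y' * b)%g by apply: Gtype_eq; rewrite -za.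
have -> : (x'^-1 * y' = a * b^-1)%g.
  by rewrite -[in LHS](mulgK b y') -E !mulgA mulVg mul1g.
by apply: Hd; [exact: sm_minl sa|apply: Hd'; exact: sm_minr sb].
Qed.

Variable c : 'I_n -> R -> T.
Hypothesis cD : forall i s t, c i (s + t) = (c i s * c i t)%g.
Hypothesis c_tder : forall i, tder C (c i) (fun t => t *: delta_mx 0 i).
Local Notation Psi := (psi c).
Local Notation M := (MC C c (enum 'I_n)).
Local Notation Ad := (Ad C).
Variable r : R.
Hypothesis r0 : 0 < r.
Hypothesis psi_inj : forall t t', `|t| < r -> `|t'| < r -> Psi t = Psi t' -> t = t'.
Hypothesis M_unit : forall t, `|t| < r -> M t \in unitmx.
Hypothesis psi_open : forall t e, `|t| < r -> 0 < e -> exists2 d : R, 0 < d &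
  forall y, sm C d y -> exists t', [/\ `|t'| < r, `|t' - t| <= e & Psi t' = (Psi t * y)%g].
Local Notation chi := (chi c r).
Local Notation chi_dom := (chi_dom c r).

(** Chart maps are total functions on S, so points outside the subgroup receive the junk value 1. *)
Definition toG (x : S) : T :=
  if pselect (Gs x) is left xG then exist _ x xG else 1%g.

Lemma toGK (x : T) : toG (sval x) = x.
Proof.
rewrite /toG; case: pselect => [xG|[]]; last exact: svalP x.
by apply: Gtype_eq.
Qed.

Lemma svalG x : Gs x -> sval (toG x) = x.
Proof. by rewrite /toG; case: pselect. Qed.

(** Left translates are used because the left logarithmic derivative ignores a constant left factor:
    (g F)^-1 d(g F) = F^-1 dF. *)
Definition translated_chart (g : T) : chart R S n :=
  Chart [set x | Gs x /\ chi_dom (g^-1 * toG x)%g] [set t | `|t| < r]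
    (fun x => chi (g^-1 * toG x)%g) (fun t => sval (g * Psi t)%g).

Lemma chi_step g x (d : R) : Gs x -> chi_dom (g^-1 * toG x)%g -> 0 < d ->
  \forall z \near x, [/\ Gs z, chi_dom (g^-1 * toG z)%g &
    `|chi (g^-1 * toG z)%g - chi (g^-1 * toG x)%g| <= d].
Proof.
move=> Gx cx d0; have [d1 d10 H1] := chi_near psi_inj psi_open cx d0.
have := near_C (toG x) d10; rewrite (svalG Gx); apply: filterS => _ [y -> /H1[h1 h2]].
split; first exact: svalP (toG x * y)%g.
  by rewrite toGK mulgA.
by rewrite toGK mulgA.
Qed.

Lemma translated_is_chart g : is_chart Gs (translated_chart g).
Proof.
refine (conj _ (conj _ (conj _ (conj _ (conj _ (conj _ _)))))).
- by move=> x [].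
- exists [set x | Gs x /\ chi_dom (g^-1 * toG x)%g].
    rewrite openE => x [Gx cx].
    by apply: filterS (chi_step Gx cx ltr01) => z [].
  by apply/seteqP; split => [x []//|x []].
- exact: open_ball_norm.
- move=> x [Gx /(chi_domP psi_inj)[h1 h2]]; split; first exact: h1.
  have -> : ch_psi (translated_chart g) (ch_phi (translated_chart g) x) =
    sval (g * Psi (chi (g^-1 * toG x)))%g by [].
  by rewrite h2 mulVKg svalG.
- move=> t tr.
  have -> : ch_phi (translated_chart g) (ch_psi (translated_chart g) t) =
    chi (g^-1 * toG (sval (g * Psi t)%g))%g by [].
  have -> : ch_W (translated_chart g) (ch_psi (translated_chart g) t) =
    (Gs (sval (g * Psi t)%g) /\ chi_dom (g^-1 * toG (sval (g * Psi t)%g))%g) by [].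
  rewrite toGK mulKg (chiK psi_inj tr); split => //; split.
    exact: svalP (g * Psi t)%g.
  by exists t.
- apply/subspace_continuousP => x [Gx cx]; apply: cvg_within_filter.
  apply/cvgrPdist_le => d d0; apply: filterS (chi_step Gx cx d0) => z [_ _].
  by rewrite distrC.
- apply/subspace_continuousP => t tr; apply: cvg_within_filter.
  move=> O /nbhs_C[d d0 Hd].
  have [tL _ [K LK]] := LD_psis cD c_tder (enum 'I_n) t (lin1_id R n).
  have [d1 d10 H1] := tder_sm tL LK d0.
  have near_t : \forall s \near t, `|t - s| < d1 by exact: near_dist.
  apply: filterS near_t => s ts.
  have E : (g * Psi t * ((Psi t)^-1 * Psi (t + (s - t))%R))%g = (g * Psi s)%g.
    by rewrite -mulgA mulVKg [(t + _)%R]addrC subrK.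
  change (O (sval (g * Psi s)%g)).
  by rewrite -E; apply: Hd; apply: H1; rewrite distrC.
Qed.

Lemma LD_chi_dom_open (V : normedModType R) (F : V -> T) L :
  (forall x, LD C F x (L x)) -> open [set x | chi_dom (F x)].
Proof.
move=> FL; rewrite openE => x Fx; have [d d0 Hd] := chi_near psi_inj psi_open Fx ltr01.
have [tL _ [K LK]] := FL x; have [d1 d10 H1] := tder_sm tL LK d0.
apply: filterS (near_dist x d10) => y xy.
have [|h _] := Hd _ (H1 (y - x) _); first by rewrite distrC.
have E : (F x * ((F x)^-1 * F (x + (y - x))%R))%g = F y by rewrite mulVKg addrC subrK.
by change (chi_dom (F y)); rewrite -E.
Qed.

(** The common form of the three smoothness conditions on an atlas: F is a translate of psi, a
    product of two such translates, or an inverse. *)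
Lemma chi_smooth_on (V : normedModType R) (B : set V) (F : V -> T) L g : open B ->
  (forall x, LD C F x (L x)) ->
  (forall (Om : set V) v, open Om -> mxSmooth Om (fun x => L x v)) ->
  smooth_on [set x | B x /\ ch_W (translated_chart g) (sval (F x))]
    (fun x => ch_phi (translated_chart g) (sval (F x))).
Proof.
move=> oB FL sL.
have FL' x : LD C (fun y => g^-1 * F y)%g x (L x) by exact: LD_mull.
have -> : [set x | B x /\ ch_W (translated_chart g) (sval (F x))] =
    B `&` [set x | chi_dom (g^-1 * F x)%g].
  apply/seteqP; split => x /= [Bx]; first by rewrite toGK => -[].
  by move=> h; rewrite toGK; do 2 split => //; exact: svalP (F x).
have -> : (fun x => ch_phi (translated_chart g) (sval (F x))) = chi \o (fun x => g^-1 * F x)%g.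
  by apply/funext => x /=; rewrite toGK.
have oOm : open (B `&` [set x | chi_dom (g^-1 * F x)%g]).
  by apply: openI => //; exact: LD_chi_dom_open FL'.
apply: Smooth_smooth_on; apply: (chi_Smooth cD c_tder psi_inj M_unit psi_open oOm (L := L)).
- by move=> x _; exact: FL'.
- by move=> x [].
- by move=> v; exact: sL.
Qed.

Let AdM g h : Ad (g * h)%g = Ad h *m Ad g := AdM cD c_tder g h.

Lemma strict_chart_lie_group : lie_group R mul inv Gs.
Proof.
split; first by move=> x y; exact: strict_chart_hausdorff.
exists n, [set translated_chart g | g in setT].
have oB : open [set t : 'rV[R]_n | `|t| < r] by exact: open_ball_norm.
have LDPsi x : LD C Psi x (fun h => h *m M x).
  exact: (LD_psis cD c_tder (enum 'I_n) x (lin1_id R n)).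
split; first by move=> _ [g _ <-]; exact: translated_is_chart.
split.
  move=> x Gx; exists (translated_chart (toG x)); first by exists (toG x).
  by split => //; exists 0; [rewrite normr0|rewrite mulVg psi0].
split.
  move=> _ _ [g1 _ <-] [g2 _ <-].
  apply: (chi_smooth_on (L := fun x h => h *m M x) g2 oB); first by move=> x; exact: LD_mull.
  move=> Om v oOm; apply: mxSmooth_mul => //; first exact: mxSmooth_cst.
  exact: (MC_Smooth cD c_tder oOm _ (lin1_id R n)).
split.
  move=> _ _ _ [g1 _ <-] [g2 _ <-] [g3 _ <-].
  have oB2 : open [set p : 'rV[R]_n * 'rV[R]_n | `|p.1| < r /\ `|p.2| < r].
    rewrite openE => -[x y] [/= xr yr].
    by exists ([set t | `|t| < r], [set t | `|t| < r]) => //=; split; exact: open_nbhs_nbhs.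
  have := @chi_smooth_on _ _ (fun p => (g1 * Psi p.1) * (g2 * Psi p.2))%g
    (fun x h => h.1 *m M x.1 *m Ad (g2 * Psi x.2)^-1%g + h.2 *m M x.2) g3 oB2.
  move=> H; have {H} : smooth_on _ _ := H _ _.
  have -> : [set p : 'rV[R]_n * 'rV[R]_n | [/\ ch_V (translated_chart g1) p.1,
      ch_V (translated_chart g2) p.2 & ch_W (translated_chart g3)
      (mul (ch_psi (translated_chart g1) p.1) (ch_psi (translated_chart g2) p.2))]] =
    [set p : 'rV[R]_n * 'rV[R]_n | (`|p.1| < r /\ `|p.2| < r) /\
      ch_W (translated_chart g3) (sval ((g1 * Psi p.1) * (g2 * Psi p.2))%g)].
    by apply/seteqP; split => p; [case|case => -[]].
  apply.
  - move=> x.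
    have h1 : LD C (fun p : 'rV[R]_n * 'rV[R]_n => g1 * Psi p.1)%g x (fun h => h.1 *m M x.1).
      by apply: LD_mull; exact: (LD_psis cD c_tder (enum 'I_n) x (lin1_fst R n)).
    have h2 : LD C (fun p : 'rV[R]_n * 'rV[R]_n => g2 * Psi p.2)%g x (fun h => h.2 *m M x.2).
      by apply: LD_mull; exact: (LD_psis cD c_tder (enum 'I_n) x (lin1_snd R n)).
    exact: (LD_mul cD c_tder h1 h2).
  - move=> Om v oOm; apply: mxSmoothD => //.
      apply: mxSmooth_mul => //.
        apply: mxSmooth_mul => //; first exact: mxSmooth_cst.
        exact: (MC_Smooth cD c_tder oOm _ (lin1_fst R n)).
      rewrite (_ : (fun _ => _) = fun x => Ad g2^-1%g *m Ad (Psi x.2)^-1%g).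
        apply: mxSmooth_mul => //; first exact: mxSmooth_cst.
        exact: (Ad_psis_Smooth cD c_tder oOm _ (lin1_snd R n)).
      by apply/funext => x; rewrite invgM AdM.
    apply: mxSmooth_mul => //; first exact: mxSmooth_cst.
    exact: (MC_Smooth cD c_tder oOm _ (lin1_snd R n)).
move=> _ _ [g1 _ <-] [g2 _ <-].
apply: (chi_smooth_on (F := fun u => (g1 * Psi u)^-1%g)
  (L := fun x h => - (h *m M x *m Ad (g1 * Psi x)%g)) g2 oB).
  by move=> x; have := LD_mull g1 (LDPsi x); exact: LD_inv.
move=> Om v oOm; apply: mxSmoothN => //; apply: mxSmooth_mul => //.
  apply: mxSmooth_mul => //; first exact: mxSmooth_cst.
  exact: (MC_Smooth cD c_tder oOm _ (lin1_id R n)).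
(* Smoothness is available for Ad of Psi(x)^-1, so Ad of Psi(x) is written as its inverse matrix. *)
rewrite (_ : (fun _ => _) = fun x => invmx (Ad (Psi x)^-1%g) *m Ad g1).
  apply: mxSmooth_mul => //; last exact: mxSmooth_cst.
  apply: mxSmooth_inv => //; last exact: (Ad_psis_Smooth cD c_tder oOm _ (lin1_id R n)).
  move=> x _; apply: (mulmx1_unit (A := Ad (Psi x)) _).2.
  by rewrite -AdM mulVg Ad1.
apply/funext => x; rewrite AdM; congr (_ *m _).
have h : Ad (Psi x) *m Ad (Psi x)^-1%g = 1%:M by rewrite -AdM mulVg Ad1.
have [_ u] := mulmx1_unit h.
by rewrite -[LHS]mulmx1 -(mulmxV u) mulmxA h mul1mx.
Qed.

End LieGroupOfStrictChart.

(** * Continuous partial derivatives and the equivalence *)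

Lemma within_continuous_at (X Y : topologicalType) (A : set X) (f : X -> Y) x :
  {within A, continuous f} -> nbhs x A -> {for x, continuous f}.
Proof.
move=> /subspace_continuousP c nA B /(c x (nbhs_singleton nA)).
rewrite /= /within /= => h; change (nbhs x (f @^-1` B)).
by apply: filterS2 nA h => y Ay /(_ Ay).
Qed.

(** Serves to recentre a Lie group chart so that e has coordinate 0. *)
Lemma C1_on_translate (R : realType) (V W : normedModType R) (f : V -> W) (A O : set V) a b :
  (forall p, A p -> O (p + a)) -> C1_on O f -> C1_on A (fun p => f (p + a) - b).
Proof.
move=> AO [df dfc].
have dsh p : A p -> differentiable (fun p => f (p + a) - b) p /\
    forall h, 'd (fun p => f (p + a) - b) p h = 'd f (p + a) h.
  move=> /AO Op; have [K K0 HK] := diff_bounded (df _ Op).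
  apply: (fder_differentiable (K := K)) => //; first exact: linearP.
  move=> d d0; have [s s0 Hs] := differentiable_fder (df _ Op) d0; exists s => // h /Hs.
  by rewrite opprB addrA subrK [p + a + h]addrAC.
split; first by move=> p /dsh[].
move=> p0 p0A d d0; have [s s0 Hs] := dfc _ (AO _ p0A) d d0; exists s => // p pA pp v.
rewrite (dsh p pA).2 (dsh p0 p0A).2; apply: Hs; first exact: AO.
by rewrite opprD addrACA subrr addr0.
Qed.

Section PairBasis.
Variables (R : realType) (n : nat).
Local Notation P := ('rV[R]_n * 'rV[R]_n)%type.

Definition pair_basis (i : 'I_n + 'I_n) : P :=
  match i with inl a => (delta_mx 0 a, 0) | inr a => (0, delta_mx 0 a) end.

Definition pair_coord (i : 'I_n + 'I_n) (h : P) : R :=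
  match i with inl a => h.1 0 a | inr a => h.2 0 a end.

Lemma pair_partials_C1 m (f : P -> 'rV[R]_m) (O : set P) : open O ->
  (forall x v, O x -> derivable f x v) ->
  (forall x v, O x -> {for x, continuous ('D_v f)}) -> C1_on O f.
Proof.
move=> oO fD fC; apply: (partials_C1 (b := pair_basis) (k := pair_coord)) => //.
- by move=> [a|a] r u v; rewrite /pair_coord /= !mxE.
- move=> [a|a] h; rewrite prod_normE le_max /=; apply/orP; [left|right]; exact: mx_norm_entry.
- have d1 a : `|delta_mx 0 a : 'rV[R]_n| <= 1.
    by apply: mx_norm_le => // i j; rewrite mxE; case: (_ && _); rewrite ?normr0 ?normr1.
  by move=> [a|a]; rewrite prod_normE /= ge_max normr0 d1 ler01.
- move=> [u v]; rewrite big_sumType /=.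
  transitivity ((u, 0) + (0, v) : P); first by congr pair; rewrite /= ?addr0 ?add0r.
  have pl (w : 'rV[R]_n) : (w, 0) = \sum_(i < n) w 0 i *: (delta_mx 0 i, 0) :> P.
    rewrite {1}[w]row_sum_delta; elim/big_rec2: _ => // i y1 y2 _ <-.
    by congr pair; rewrite /= ?scaler0 ?addr0.
  have pr (w : 'rV[R]_n) : (0, w) = \sum_(i < n) w 0 i *: (0, delta_mx 0 i) :> P.
    rewrite {1}[w]row_sum_delta; elim/big_rec2: _ => // i y1 y2 _ <-.
    by congr pair; rewrite /= ?scaler0 ?addr0.
  by rewrite pl pr.
Qed.

End PairBasis.

Section Equivalence.
Variables (R : realType) (S : topologicalType) (mul : S -> S -> S) (inv : S -> S).
Hypothesis Hc : top_clifford mul inv.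

Lemma maxsub_disjoint (e f x : S) : maxsub mul inv e x -> maxsub mul inv f x -> e = f.
Proof. by move=> <-. Qed.

(** G_e meets each G_f in all of it or not at all, and both traces are relatively open. *)
Lemma strong_semilattice_open (e : S) : strong_semilattice_top_groups mul inv ->
  idem mul e -> open (maxsub mul inv e).
Proof.
move=> [_ /(_ (maxsub mul inv e))[_ h]] ee; apply: h => f ff.
have [<-|ef] := pselect (e = f).
  by exists setT; [exact: openT|rewrite setTI setIid].
exists set0; first exact: open0.
apply/seteqP; split => x [] // xe xf.
by case: ef; exact: maxsub_disjoint xe xf.
Qed.

(** Every x lies in the open piece G_e with e = x x^-1, so relative openness on the pieces is
    openness in S. *)
Lemma open_strong_semilattice : (forall e, idem mul e -> open (maxsub mul inv e)) ->
  strong_semilattice_top_groups mul inv.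
Proof.
move=> oG; split.
  move=> e f ee ff _; apply: continuous_subspaceT => x.
  apply: (@continuous_comp _ _ _ (fun y => (e, y)) (fun p : S * S => mul p.1 p.2)).
    exact: (cvg_pair (cvg_cst e) cvg_id).
  exact: (cl_mul_cont Hc).
move=> A; split => [oA e ee|h]; first by exists A.
rewrite openE => x Ax; pose e := mul x (inv x).
have ee : idem mul e := idem_mulV Hc x.
have [Q oQ E] := h e ee; have [Qx _] : (Q `&` maxsub mul inv e) x by rewrite -E.
have hn : nbhs x (Q `&` maxsub mul inv e).
  by apply: open_nbhs_nbhs; split; [exact: openI oQ (oG e ee)|split].
by apply: filterS hn => y; rewrite -E => -[].
Qed.

Lemma C1_open_maxsub : C1_at_idempotents_findim R mul ->
  forall e, idem mul e -> open (maxsub mul inv e).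
Proof.
move=> H e ee; have := H e ee.
move=> [n] [U] [W] [V] [phi] [psi] [oU] [oW] [Ue] [UW] [oV] [h1] [h2] [h3] [h4] [h5] [_ h7].
exact: (open_maxsub Hc ee oU oW Ue UW oV h1 h2 h3 h4 h5 h7).
Qed.

Lemma C1_lie_group : C1_at_idempotents_findim R mul ->
  forall e, idem mul e -> lie_group R mul inv (maxsub mul inv e).
Proof.
move=> H e ee; have := H e ee.
move=> [n] [U] [W] [V] [phi] [psi] [oU] [oW] [Ue] [UW] [oV] [h1] [h2] [h3] [h4] [h5] [_ h7].
have [C [dC lC]] := local_strict_chart Hc ee oU oW Ue UW oV h1 h2 h3 h4 h5 h7.
have nC := local_chart_nbhs Ue UW oV h1 h4 h5 dC lC.
have nC' := local_chart_near oU oW Ue UW oV h1 h2 h3 h4 h5 h7 dC lC.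
have /choice[c Hcc] := fun i : 'I_n => one_param C (delta_mx 0 i).
have cD i : forall s t, c i (s + t) = (c i s * c i t)%g by case: (Hcc i).
have ct i : tder C (c i) (fun t => t *: delta_mx 0 i) by case: (Hcc i).
have [r r0 [r1 r2 r3]] := psi_chart cD ct.
exact: (strict_chart_lie_group nC nC' cD ct r0 r1 r2 r3).
Qed.

(** One chart around e is used for both factors and for the product. Since G_e is open, a relatively
    open chart domain is open in S. *)
Lemma C1_of_lie_group : strong_semilattice_top_groups mul inv ->
  (forall e, idem mul e -> lie_group R mul inv (maxsub mul inv e)) ->
  C1_at_idempotents_findim R mul.
Proof.
move=> SS LG e ee; have oG := strong_semilattice_open SS ee.
have [_ [n [A [Achart [Acov [_ [Amul _]]]]]]] := LG e ee.
have eG : maxsub mul inv e e by exact: (maxsub_e Hc ee).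
have [[W V phi psi] Ac /= We] := Acov e eG.
have := Achart _ Ac; move=> [/= WG] [[Q oQ WE]] [oV] [phiK] [psiK] [cphi cpsi].
have oW : open W by rewrite WE; exact: openI.
have := Amul _ _ _ Ac Ac Ac; rewrite /= => Sm.
pose a := phi e; have [Va psia] := phiK e We.
have Wn : nbhs (mul e e) W by rewrite ee; exact: open_nbhs_nbhs.
have [A1 [B1 [Ae Be AB]]] := cl_mul_near Hc Wn.
(* U is shrunk so that products of two of its points stay in the chart domain W. *)
pose U := (A1 `&` B1 `&` W)°.
have U1 : U `<=` A1 `&` B1 `&` W by exact: interior_subset.
have oU : open U by exact: open_interior.
have Ue : U e by apply: filterI; [exact: filterI|exact: open_nbhs_nbhs].
have UW : U `<=` W by move=> x /U1[].
have shiftn (v : 'rV[R]_n) (B : set 'rV[R]_n) : nbhs (v + a) B -> \forall y \near v, B (y + a).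
  move=> /nbhs_ballP[d d0 Hd].
  have : \forall y \near v, `|v - y| < d by exact: near_dist.
  apply: filterS => y vy; apply: Hd.
  have : ball_ (fun x : 'rV[R]_n => `|x|) (v + a) d (y + a) by rewrite /= opprD addrACA subrr addr0.
  by rewrite mx_norm_ball.
exists n, U, W, [set v | V (v + a)], (fun x => phi x - a), (fun v => psi (v + a)).
have phiU v : ((fun x => phi x - a) @` U) v -> V (v + a) /\ U (psi (v + a)).
  by move=> [x Ux <-]; rewrite subrK; have [Vx ->] := phiK x (UW _ Ux).
split; first exact: oU.
split; first exact: oW.
split; first exact: Ue.
split; first exact: UW.
split.
  rewrite openE => v Vv; apply: shiftn; exact: open_nbhs_nbhs.
split.
  by move=> x Wx; rewrite /= subrK; exact: phiK.
split.
  by move=> v /psiK[h1 h2]; split => //; rewrite h2 addrK.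
split.
  move/subspace_continuousP : cphi => cphi; apply/subspace_continuousP => x Wx.
  exact: (cvgB (cphi x Wx) (cvg_cst a)).
split.
  apply/subspace_continuousP => v Vv; apply: cvg_within_filter => B nB.
  have := within_open_continuous oV cpsi Vv nB; move=> /shiftn; apply: filterS => y [] //.
split; first by rewrite subrr.
split; first by move=> u v /U1[[Au _] _] /U1[[_ Bv] _]; exact: AB.
pose g (p : 'rV[R]_n * 'rV[R]_n) := phi (mul (psi (p.1 + a)) (psi (p.2 + a))) - a.
suff : C1_on [set p : 'rV[R]_n * 'rV[R]_n | ((fun x => phi x - a) @` U) p.1 /\
  ((fun x => phi x - a) @` U) p.2] g by [].
pose aa : 'rV[R]_n * 'rV[R]_n := (a, a).
pose f (p : 'rV[R]_n * 'rV[R]_n) := phi (mul (psi p.1) (psi p.2)).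
pose D := [set p : 'rV[R]_n * 'rV[R]_n | (V p.1 /\ U (psi p.1)) /\ (V p.2 /\ U (psi p.2))].
have oVU : open [set v | V v /\ U (psi v)].
  rewrite openE => v [Vv Uv].
  exact: (within_open_continuous oV cpsi Vv (open_nbhs_nbhs (conj oU Uv))).
have oD : open D by exact: (open_prodset oVU oVU).
have fC1 : C1_on D f.
  have Dsub p : D p -> [/\ V p.1, V p.2 & W (mul (psi p.1) (psi p.2))].
    by move=> [[h1 /U1[[h2 _] _]] [h3 /U1[[_ h4] _]]]; split => //; exact: AB.
  apply: pair_partials_C1 => //.
    (* Only orders 0 and 1 of [Sm] enter: the empty list gives existence of directional derivatives,
       the list of one vector v their continuity. *)
    by move=> x v /Dsub Dx; exact: (Sm [::]).2.
  move=> x v Dx; apply: within_continuous_at (Sm [:: v]).1 _.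
  by apply: filterS (open_nbhs_nbhs (conj oD Dx)) => y /Dsub.
apply: (C1_on_translate (f := f) (O := D) (a := aa) a) fC1.
move=> p [/phiU p1 /phiU p2].
have -> : p + aa = (p.1 + a, p.2 + a) by [].
by split.
Qed.

End Equivalence.

Theorem theorem6p11 (S : topologicalType) (mul : S -> S -> S) (inv : S -> S) :
  top_clifford mul inv ->
  (C1_at_idempotents_findim Rdefinitions.R mul <->
   (strong_semilattice_top_groups mul inv /\
    forall e, idem mul e -> lie_group Rdefinitions.R mul inv (maxsub mul inv e))).
Proof.
move=> Hc; split=> [H|[SS LG]]; last exact: (C1_of_lie_group Hc SS LG).
split; last exact: (C1_lie_group Hc H).
by apply: open_strong_semilattice => //; exact: (C1_open_maxsub Hc H).
Qed.
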